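(* For every $r$ with $0<r<1$, one has $U_r=F(\overline{\mathbb D}(0,r))$, where $$F(z)=\frac{(3+\bar z)(1+z)^3}{3+3z+\bar z+z^2},\qquad z\in\mathbb D.$$
   Context: $\mathbb D=\{z\in\mathbb C:|z|<1\}$ and $\overline{\mathbb D}(a,r)=\{z\in\mathbb C:|z-a|\le r\}$. An analytic function $g$ on $\mathbb D$ with $g(0)=g'(0)-1=0$ is called convex if it is univalent and $g(\mathbb D)$ is a convex set. $\mathcal C$ denotes the class of close-to-convex functions, that is, analytic functions $f$ on $\mathbb D$ with $f(0)=f'(0)-1=0$ such that $\operatorname{Re}[e^{i\lambda}f'(z)/g'(z)]>0$ for all $z\in\mathbb D$, for some convex function $g$ (normalized by $g(0)=g'(0)-1=0$) and some real constant $\lambda$ with $|\lambda|<\pi/2$. Every $f\in\mathcal C$ is univalent, so $f(z)\neq0$ for $0<|z|<1$. For $0<r<1$, $U_r=\{r/f(r): f\in\mathcal C\}$. *)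

(* Defs.v *)
From Stdlib Require Import Reals.
From Coquelicot Require Import Coquelicot.

Open Scope R_scope.
Open Scope C_scope.

Definition unit_disk (z : C) : Prop := (Cmod z < 1)%R.

Definition closed_disk (a : C) (r : R) (z : C) : Prop := (Cmod (z - a) <= r)%R.

Definition image (h : C -> C) (A : C -> Prop) (w : C) : Prop :=
  exists z : C, A z /\ w = h z.

Definition convex_set (A : C -> Prop) : Prop :=
  forall (w1 w2 : C) (t : R),
    A w1 -> A w2 -> (0 <= t <= 1)%R -> A (RtoC (1 - t)%R * w1 + RtoC t * w2).

(* A function on the unit disk is represented by a total function on [C];
   only its values on the disk are used.  Since the disk is open, analyticity
   is complex differentiability at each of its points: scalars and values are
   both taken in [C], so the derivative is complex and not merely real. *)
Definition analytic_on_disk (f : C -> C) : Prop :=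
  forall z : C, unit_disk z -> @ex_derive C_AbsRing C_NormedModule f z.

Definition normalized (f : C -> C) : Prop :=
  f 0 = 0 /\ C_derive f 0 - 1 = 0.

Definition univalent_on_disk (f : C -> C) : Prop :=
  forall z1 z2 : C, unit_disk z1 -> unit_disk z2 -> f z1 = f z2 -> z1 = z2.

Definition convex_function (g : C -> C) : Prop :=
  analytic_on_disk g /\ normalized g /\
  univalent_on_disk g /\ convex_set (image g unit_disk).

Definition expi (lambda : R) : C := (cos lambda, sin lambda).

(* [C_derive g z] never vanishes on the disk, as [g] is univalent there. *)
Definition close_to_convex (f : C -> C) : Prop :=
  analytic_on_disk f /\ normalized f /\
  exists (g : C -> C) (lambda : R),
    convex_function g /\ (Rabs lambda < PI / 2)%R /\
    forall z : C, unit_disk z ->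
      (0 < Re (expi lambda * (C_derive f z / C_derive g z)))%R.

(* [f r] is nonzero for [0 < r < 1], as [f] is univalent with [f 0 = 0]. *)
Definition U (r : R) (w : C) : Prop :=
  exists f : C -> C, close_to_convex f /\ w = RtoC r / f (RtoC r).

Definition F (z : C) : C :=
  (3 + Cconj z) * (1 + z) ^ 3 / (3 + 3 * z + Cconj z + z ^ 2).

(* Main.v *)
Require Import Defs.
From Stdlib Require Import Reals Lra Lia Psatz Classical ClassicalEpsilon FunctionalExtensionality.
From Coquelicot Require Import Coquelicot.

(** Writing s = 1 + z, the claim is that phi = f(r)/r satisfies
    |2 phi s^2 - 1 - s| <= |1 - s|   for some |s - 1| <= r,
    and that the values 1/phi with this property are those of F on |z| <= r.

    For the first part, suppose the inequality fails for all such s.  Then the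
    kernel H(y) = phi y + log(1 - r y)/r maps the unit circle to a strictly
    convex curve, because 1 + y H''/H' = (phi s^2 - 1)/(phi s^2 - s) has
    positive real part at s = 1 - r y.  The linear functional
    L(P) = int_0^1 G(t) P(rt) dt - phi P(0) does not vanish on functions P with
    values in a half-plane as soon as it does not vanish on the quotients
    (1 - xz)/(1 - yz), |x| = |y| = 1.  This duality is used twice, as in
    Ruscheweyh and Sheil-Small's proof of the Polya-Schoenberg conjecture: it
    reduces f' = p g' to f' = g'(1 - xz)/(1 - yz), which, by choosing the point
    of the convex curve g(|z| = 1) opposite to the one at 1/x, is
    P(z)/((1 - yz)(1 - bz)) with P in a half-plane; the second application
    leaves int_0^1 (1 - xrt)/((1 - y1 rt)(1 - y2 rt)(1 - y3 rt)) dt <> phi, and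
    equality there would make H(y1), H(y2), H(y3) collinear.

    For the second part, a point z of least modulus satisfying the inequality
    satisfies a Lagrange condition, whose only admissible solution is the
    envelope point 2 phi (1 + z)^2 = 2 + z - z conj(D)/D, D = (3 + conj z)(1 + z),
    that is, 1/phi = F(z).  Conversely these values are attained by
    f(u) = u (1 - (x + y)u/2)/(1 - yu)^2, for which f' = (1 - xu)/(1 - yu)^3. *)

Local Open Scope C_scope.

(** The inequality comes from the functions that attain the region: f' = (1 - xu)/(1 - yu)^3 gives
    phi = (1 - (x + y)r/2)/s^2 with s = 1 - yr, hence 1 - s = yr and 2 phi s^2 - 1 - s = -xr, so
    that the inequality says |xr| <= |yr|. With a = phi s^2 - 1 and b = phi s^2 - s it reads |a + b|
    <= |a - b|; its failure is Re(a/b) > 0, the curvature condition on H. H(y) is phi y minus the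
    integral of y/(1 - yrt) over 0 <= t <= 1. In the partial fractions of the three-point kernel the
    terms phi y add up to exactly phi, so equality with phi leaves B1 H(y1) + B2 H(y2) + B3 H(y3) =
    0, where B1 + B2 + B3 = 0 and the ratios of the B's are real cross-ratios. Functions of the
    class are analytic in the open disk only, whereas the duality argument needs values on the
    circle. They are therefore dilated by r/q, the inequality is proved with q in place of r for
    every q in (r, 1), and a minimizer of |z| over a compact set brings r back. *)

Lemma C_eq (z w : C) : Re z = Re w -> Im z = Im w -> z = w.
Proof. destruct z, w; simpl; congruence. Qed.

Lemma Cminus_self (z : C) : z - z = 0.
Proof. ring. Qed.

Lemma Re_RtoC_mult (t : R) (z : C) : Re (RtoC t * z) = (t * Re z)%R.
Proof. destruct z; simpl; ring. Qed.

Lemma Im_RtoC_mult (t : R) (z : C) : Im (RtoC t * z) = (t * Im z)%R.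
Proof. destruct z; simpl; ring. Qed.

Lemma Cmod_sqr (z : C) : (Cmod z * Cmod z = Re z * Re z + Im z * Im z)%R.
Proof.
  unfold Cmod. rewrite sqrt_sqrt; destruct z; simpl; nra.
Qed.

Lemma Cmod_minus_sym (z w : C) : Cmod (z - w) = Cmod (w - z).
Proof. rewrite <- Cmod_opp. f_equal. ring. Qed.

Lemma Cmod_minus_triangle (z w : C) : (Cmod z - Cmod w <= Cmod (z - w))%R.
Proof.
  pose proof (Cmod_triangle (z - w) w) as h.
  replace (z - w + w) with z in h by ring. lra.
Qed.

Lemma Re_le_mod (z : C) : (Rabs (Re z) <= Cmod z)%R.
Proof.
  pose proof (Cmod_sqr z). pose proof (Cmod_ge_0 z).
  apply Rabs_le. split; nra.
Qed.

Lemma Im_le_mod (z : C) : (Rabs (Im z) <= Cmod z)%R.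
Proof.
  pose proof (Cmod_sqr z). pose proof (Cmod_ge_0 z).
  apply Rabs_le. split; nra.
Qed.

Lemma Re_pos_neq_0 (z : C) : (0 < Re z)%R -> z <> 0.
Proof. intros h e. subst. simpl in h. lra. Qed.

Lemma Cconj_RtoC (a : R) : Cconj (RtoC a) = RtoC a.
Proof. apply C_eq; simpl; ring. Qed.

Lemma Cmod_RtoC_nonneg (a : R) : (0 <= a)%R -> Cmod (RtoC a) = a.
Proof. intro h. now rewrite Cmod_R, Rabs_pos_eq. Qed.

Lemma RtoC_neq_0 (s : R) : s <> 0%R -> RtoC s <> 0.
Proof. intros h e. apply h. now apply RtoC_inj. Qed.

Lemma Cconj_mult_self (z : C) : z * Cconj z = RtoC (Cmod z * Cmod z).
Proof. rewrite Cmod_sqr. destruct z; apply C_eq; simpl; ring. Qed.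

(** Turns bounds on a modulus into bounds on a real part, for integrals and for the maximum
    principle. *)
Lemma unimodular_rotation (z : C) : exists k : C, Cmod k = 1%R /\ k * z = RtoC (Cmod z).
Proof.
  destruct (classic (z = 0)) as [-> | hz].
  - exists 1. rewrite Cmod_0, Cmod_1. split; [reflexivity | ring].
  - pose proof (proj1 (Cmod_gt_0 z) hz) as hm.
    assert (hm0 : RtoC (Cmod z) <> 0) by (apply RtoC_neq_0; lra).
    exists (Cconj z / RtoC (Cmod z)). split.
    + rewrite Cmod_div, Cmod_conj, Cmod_RtoC_nonneg by (lra || auto). field. lra.
    + replace (Cconj z / RtoC (Cmod z) * z) with (z * Cconj z / RtoC (Cmod z)) by (field; auto).
      rewrite Cconj_mult_self, RtoC_mult. field. auto.
Qed.

(** * Limits and derivatives *)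

(** Limits are measured in the Euclidean modulus, so that estimates are direct; [clim_Re_Im] relates
    them to coordinatewise limits and [near_locally] to the uniform structure behind complex
    derivatives. *)
Definition clim {T : Type} (F : (T -> Prop) -> Prop) (f : T -> C) (l : C) : Prop :=
  forall eps : R, (0 < eps)%R -> F (fun x => (Cmod (f x - l) < eps)%R).

Definition near (z : C) (P : C -> Prop) : Prop :=
  exists d : R, (0 < d)%R /\ forall w : C, (Cmod (w - z) < d)%R -> P w.

Global Instance near_filter (z : C) : Filter (near z).
Proof.
  split.
  - exists 1%R. split; [lra | auto].
  - intros P Q [d [hd hP]] [e [he hQ]]. exists (Rmin d e). split.
    + apply Rmin_pos; auto.
    + intros w hw. split; [apply hP | apply hQ];
        eapply Rlt_le_trans; eauto; [apply Rmin_l | apply Rmin_r].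
  - intros P Q hPQ [d [hd hP]]. exists d. split; auto.
Qed.

Section Limits.

Context {T : Type} {F : (T -> Prop) -> Prop} {FF : Filter F}.
Implicit Types f g : T -> C.

Lemma clim_const (c : C) : clim F (fun _ => c) c.
Proof.
  intros e he. apply filter_forall. intros _.
  replace (c - c) with (RtoC 0) by ring. now rewrite Cmod_0.
Qed.

Lemma clim_plus f g (a b : C) :
  clim F f a -> clim F g b -> clim F (fun x => f x + g x) (a + b).
Proof.
  intros hf hg e he.
  assert (he2 : (0 < e / 2)%R) by lra.
  generalize (filter_and _ _ (hf _ he2) (hg _ he2)).
  apply filter_imp. intros x [h1 h2].
  replace (f x + g x - (a + b)) with ((f x - a) + (g x - b)) by ring.
  eapply Rle_lt_trans; [apply Cmod_triangle | lra].
Qed.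

Lemma clim_mult f g (a b : C) :
  clim F f a -> clim F g b -> clim F (fun x => f x * g x) (a * b).
Proof.
  intros hf hg e he.
  pose proof (Cmod_ge_0 a) as ha. pose proof (Cmod_ge_0 b) as hb.
  (* If both errors are below d <= 1, the error of the product is at most d^2 + d(|a| + |b|) <=
     dM. *)
  set (M := (Cmod a + Cmod b + 1)%R).
  set (d := Rmin 1 (e / (2 * M))).
  assert (hM : (0 < M)%R) by (unfold M; lra).
  assert (hd : (0 < d)%R).
  { apply Rmin_pos; [lra |]. apply Rdiv_lt_0_compat; lra. }
  assert (hd1 : (d <= 1)%R) by apply Rmin_l.
  assert (hdM : (d * M <= e / 2)%R).
  { apply Rle_trans with (e / (2 * M) * M)%R.
    - apply Rmult_le_compat_r; [lra | apply Rmin_r].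
    - right. field. lra. }
  generalize (filter_and _ _ (hf d hd) (hg d hd)).
  apply filter_imp. intros x [h1 h2].
  replace (f x * g x - a * b) with ((f x - a) * (g x - b) + (a * (g x - b) + b * (f x - a)))
    by ring.
  eapply Rle_lt_trans; [apply Cmod_triangle |].
  rewrite Cmod_mult.
  eapply Rle_lt_trans; [apply Rplus_le_compat_l, Cmod_triangle |].
  rewrite !Cmod_mult.
  pose proof (Cmod_ge_0 (f x - a)). pose proof (Cmod_ge_0 (g x - b)).
  unfold M in hdM. nra.
Qed.

Lemma clim_inv f (a : C) : a <> 0 -> clim F f a -> clim F (fun x => / f x) (/ a).
Proof.
  intros ha hf e he.
  assert (hma : (0 < Cmod a)%R) by now apply Cmod_gt_0.
  set (m := Cmod a) in *.
  set (d := Rmin (m / 2) (e * (m * m / 2))).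
  assert (hd : (0 < d)%R).
  { apply Rmin_pos; [lra |]. apply Rmult_lt_0_compat; [lra | nra]. }
  generalize (hf d hd). apply filter_imp. intros x hx.
  assert (h1 : (Cmod (f x - a) < m / 2)%R) by (eapply Rlt_le_trans; [exact hx | apply Rmin_l]).
  assert (h2 : (Cmod (f x - a) < e * (m * m / 2))%R)
    by (eapply Rlt_le_trans; [exact hx | apply Rmin_r]).
  assert (h3 : (m / 2 < Cmod (f x))%R).
  { pose proof (Cmod_minus_triangle a (f x)) as h. rewrite Cmod_minus_sym in h.
    fold m in h. lra. }
  assert (hfx : f x <> 0).
  { intro e0. rewrite e0, Cmod_0 in h3. lra. }
  replace (/ f x - / a) with (- (f x - a) * / (f x * a)) by (field; auto).
  rewrite Cmod_mult, Cmod_opp, Cmod_inv, Cmod_mult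
    by (now apply Cmult_neq_0).
  fold m. apply Rmult_lt_reg_r with (Cmod (f x) * m)%R; [nra |].
  rewrite Rmult_assoc, Rinv_l by nra.
  assert (e * (m * m / 2) < e * (Cmod (f x) * m))%R.
  { apply Rmult_lt_compat_l; nra. }
  lra.
Qed.

Lemma clim_opp f (a : C) : clim F f a -> clim F (fun x => - f x) (- a).
Proof.
  intros hf e he. generalize (hf e he). apply filter_imp. intros x hx.
  replace (- f x - - a) with (- (f x - a)) by ring. now rewrite Cmod_opp.
Qed.

Lemma clim_minus f g (a b : C) :
  clim F f a -> clim F g b -> clim F (fun x => f x - g x) (a - b).
Proof. intros hf hg. apply clim_plus; [exact hf | now apply clim_opp]. Qed.

Lemma clim_conj f (a : C) : clim F f a -> clim F (fun x => Cconj (f x)) (Cconj a).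
Proof.
  intros hf e he. generalize (hf e he). apply filter_imp. intros x hx.
  rewrite <- Cminus_conj. now rewrite Cmod_conj.
Qed.

Lemma clim_ext_loc f g (a : C) : F (fun x => f x = g x) -> clim F f a -> clim F g a.
Proof.
  intros h hf e he. generalize (filter_and _ _ h (hf e he)). apply filter_imp.
  intros x [h1 h2]. now rewrite <- h1.
Qed.

Lemma clim_ext f g (a : C) : (forall x, f x = g x) -> clim F f a -> clim F g a.
Proof. intro h. apply clim_ext_loc. now apply filter_forall. Qed.

Lemma clim_comp (h : C -> C) f (a b : C) :
  clim (near a) h b -> clim F f a -> clim F (fun x => h (f x)) b.
Proof.
  intros hh hf e he. destruct (hh e he) as [d [hd hd']].
  generalize (hf d hd). apply filter_imp. auto.
Qed.

Lemma clim_eq f (a b : C) : clim F f a -> a = b -> clim F f b.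
Proof. now intros h <-. Qed.

End Limits.

Lemma clim_id (z : C) : clim (near z) (fun w => w) z.
Proof. intros e he. now exists e. Qed.

Lemma clim_RtoC (t : R) : clim (locally t) RtoC (RtoC t).
Proof.
  intros e he. exists (mkposreal e he). intros s hs.
  rewrite <- RtoC_minus, Cmod_R. exact hs.
Qed.

Section Derivatives.

Context {T : Type} (N : T -> (T -> Prop) -> Prop) (i : T -> C).
Context {NF : forall x, Filter (N x)}.

(* Caratheodory's form of differentiability: [E] is the difference quotient,
   extended continuously to the base point.  Taking [i] to be the identity of
   [C] or the inclusion of [R] covers complex derivatives and curves at once. *)
Definition gder (f : T -> C) (x : T) (l : C) : Prop :=
  exists E : T -> C,
    (forall w, f w = f x + E w * (i w - i x)) /\ clim (N x) E l.

Lemma gder_const (c : C) (x : T) : gder (fun _ => c) x 0.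
Proof. exists (fun _ => 0). split; [intros; ring | apply clim_const]. Qed.

Lemma gder_incl (x : T) : gder i x 1.
Proof. exists (fun _ => 1). split; [intros; ring | apply clim_const]. Qed.

Lemma gder_plus (f g : T -> C) (x : T) (a b : C) :
  gder f x a -> gder g x b -> gder (fun t => f t + g t) x (a + b).
Proof.
  intros [E [hE cE]] [G [hG cG]]. exists (fun w => E w + G w). split.
  - intro w. rewrite (hE w), (hG w) at 1. ring.
  - now apply clim_plus.
Qed.

Lemma gder_opp (f : T -> C) (x : T) (a : C) : gder f x a -> gder (fun t => - f t) x (- a).
Proof.
  intros [E [hE cE]]. exists (fun w => - E w). split.
  - intro w. rewrite (hE w) at 1. ring.
  - now apply clim_opp.
Qed.

Lemma gder_minus (f g : T -> C) (x : T) (a b : C) :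
  gder f x a -> gder g x b -> gder (fun t => f t - g t) x (a - b).
Proof. intros hf hg. apply gder_plus; [exact hf | now apply gder_opp]. Qed.

Hypothesis ci : forall x, clim (N x) i (i x).

Lemma gder_clim (f : T -> C) (x : T) (l : C) : gder f x l -> clim (N x) f (f x).
Proof.
  intros [E [hE cE]].
  apply clim_ext with (fun w => f x + E w * (i w - i x)); [now intro |].
  apply clim_eq with (f x + l * (i x - i x)); [| ring].
  apply clim_plus; [apply clim_const |].
  apply clim_mult; [exact cE |].
  apply clim_minus; [apply ci | apply clim_const].
Qed.

Lemma gder_mult (f g : T -> C) (x : T) (a b : C) :
  gder f x a -> gder g x b -> gder (fun t => f t * g t) x (a * g x + f x * b).
Proof.
  intros hf hg. assert (cg := gder_clim _ _ _ hg).
  destruct hf as [E [hE cE]], hg as [G [hG cG]].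
  exists (fun w => E w * g w + f x * G w). split.
  - intro w. rewrite (hE w) at 1. rewrite (hG w). ring.
  - apply clim_plus; [now apply clim_mult |].
    apply clim_mult; [apply clim_const | exact cG].
Qed.

End Derivatives.

Definition cder : (C -> C) -> C -> C -> Prop := gder near (fun z => z).
Definition rder : (R -> C) -> R -> C -> Prop := gder locally RtoC.

Section Composition.

Context {T : Type} (N : T -> (T -> Prop) -> Prop) (i : T -> C).
Context {NF : forall x, Filter (N x)}.
Hypothesis ci : forall x, clim (N x) i (i x).

Lemma gder_comp (f : C -> C) (g : T -> C) (x : T) (a b : C) :
  cder f (g x) a -> gder N i g x b -> gder N i (fun t => f (g t)) x (a * b).
Proof.
  intros [E [hE cE]] hg. assert (cg := gder_clim N i ci _ _ _ hg).
  destruct hg as [G [hG cG]].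
  exists (fun w => E (g w) * G w). split.
  - intro w. rewrite (hE (g w)), <- Cmult_assoc. do 2 f_equal. rewrite (hG w) at 1. ring.
  - apply clim_mult; [| exact cG]. now apply clim_comp with (g x).
Qed.

End Composition.

Lemma cder_unique_at (f : C -> C) (z l l' : C) : cder f z l -> l = l' -> cder f z l'.
Proof. now intros h <-. Qed.

Lemma rder_unique_at (f : R -> C) (z : R) (l l' : C) : rder f z l -> l = l' -> rder f z l'.
Proof. now intros h <-. Qed.

Lemma cder_ext_loc (f g : C -> C) (z l : C) :
  near z (fun w => f w = g w) -> cder f z l -> cder g z l.
Proof.
  intros h [E [hE cE]].
  assert (h0 : f z = g z).
  { destruct h as [d [hd h]]. apply h. replace (z - z) with (RtoC 0) by ring. now rewrite Cmod_0. }
  (* The Caratheodory identity is required at every w, also where f and g differ; there the plain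
     difference quotient of g is used. *)
  exists (fun w => if excluded_middle_informative (f w = g w) then E w else (g w - g z) / (w - z)).
  split.
  - intro w. destruct (excluded_middle_informative (f w = g w)) as [e | ne].
    + rewrite <- e, <- h0. apply hE.
    + assert (w - z <> 0).
      { intro e. apply ne. replace w with z; [exact h0 |].
        replace z with (z + (w - z)) by (rewrite e; ring). ring. }
      field. exact H.
  - apply clim_ext_loc with E; [| exact cE].
    revert h. apply filter_imp. intros w e.
    now destruct (excluded_middle_informative (f w = g w)).
Qed.

Lemma cder_ext (f g : C -> C) (z l : C) : (forall w, f w = g w) -> cder f z l -> cder g z l.
Proof. intro h. apply cder_ext_loc. now apply filter_forall. Qed.

Lemma cder_of_eps (f : C -> C) (z l : C) :
  (forall eps, (0 < eps)%R -> near z (fun w => (Cmod (f w - f z - l * (w - z)) <= eps * Cmod (w - z))%R)) ->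
  cder f z l.
Proof.
  intro h.
  exists (fun w => if excluded_middle_informative (w = z) then l else (f w - f z) / (w - z)).
  assert (hn : forall w, w <> z -> w - z <> 0).
  { intros w hw e. apply hw. replace w with (z + (w - z)) by ring. rewrite e. ring. }
  split.
  - intro w. destruct (excluded_middle_informative (w = z)) as [-> | ne]; [ring |].
    field. auto.
  - intros e he. assert (he2 : (0 < e / 2)%R) by lra.
    generalize (h _ he2). apply filter_imp. intros w hw.
    destruct (excluded_middle_informative (w = z)) as [-> | ne].
    + replace (l - l) with (RtoC 0) by ring. now rewrite Cmod_0.
    + assert (hp : (0 < Cmod (w - z))%R) by (apply Cmod_gt_0; auto).
      replace (f w - f z - l * (w - z)) with (((f w - f z) / (w - z) - l) * (w - z)) in hw
        by (field; auto).
      rewrite Cmod_mult in hw. apply Rmult_le_reg_r in hw; [lra | exact hp].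
Qed.

Lemma eps_of_cder (f : C -> C) (z l : C) : cder f z l ->
  forall eps, (0 < eps)%R -> near z (fun w => (Cmod (f w - f z - l * (w - z)) <= eps * Cmod (w - z))%R).
Proof.
  intros [E [hE cE]] e he. generalize (cE e he). apply filter_imp. intros w hw.
  rewrite (hE w). replace (f z + E w * (w - z) - f z - l * (w - z)) with ((E w - l) * (w - z)) by ring.
  rewrite Cmod_mult. apply Rmult_le_compat_r; [apply Cmod_ge_0 | lra].
Qed.

Lemma cder_inv_fun (z : C) : z <> 0 -> cder Cinv z (- / (z * z)).
Proof.
  (* The expression agrees with / w for w <> 0 only, hence on the disk of radius |z| about z. *)
  intro hz. apply cder_ext_loc with
    (fun w => / z - / z * (w - z) / w).
  - exists (Cmod z). split; [now apply Cmod_gt_0 |]. intros w hw.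
    assert (w <> 0). { intros ->. rewrite Cmod_minus_sym in hw.
      replace (z - 0) with z in hw by ring. lra. }
    field. auto.
  - exists (fun w => - / z * / w). split.
    + intro w. unfold Cdiv. ring.
    + replace (- / (z * z)) with (- / z * / z) by (field; auto).
      apply clim_mult; [apply clim_const |]. apply clim_inv; [exact hz | apply clim_id].
Qed.

Lemma near_locally (z : C) (P : C -> Prop) :
  near z P <-> @locally (AbsRing_UniformSpace C_AbsRing) z P.
Proof.
  split.
  - intros [d [hd h]]. exists (mkposreal d hd). exact h.
  - intros [d h]. exists (pos d). split; [apply cond_pos | exact h].
Qed.

Lemma cder_is_derive (f : C -> C) (z l : C) :
  cder f z l <-> @is_derive C_AbsRing C_NormedModule f z l.
Proof.
  split.
  - intro h. split.
    + apply (is_linear_scal_l (K := C_AbsRing) (V := C_NormedModule)).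
    + intros y hy e.
      assert (ey : y = z). { symmetry. exact (is_filter_lim_locally_unique (V := AbsRing_NormedModule C_AbsRing) z y hy). }
      subst y.
      assert (hh := eps_of_cder f z l h e (cond_pos e)).
      apply (proj1 (near_locally z _)) in hh.
      revert hh. apply filter_imp. intros w hw.
      change (Cmod (f w - f z - (w - z) * l) <= e * Cmod (w - z))%R.
      now rewrite (Cmult_comm (w - z)).
  - intro h. apply cder_of_eps. intros e he.
    destruct h as [_ h]. specialize (h z (fun P hP => hP) (mkposreal e he)).
    apply near_locally.
    revert h. apply filter_imp. intros w hw.
    change (Cmod (f w - f z - (w - z) * l) <= e * Cmod (w - z))%R in hw.
    now rewrite (Cmult_comm l).
Qed.

Lemma cder_C_derive (f : C -> C) (z l : C) : cder f z l -> C_derive f z = l.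
Proof. intro h. apply is_C_derive_unique. apply cder_is_derive in h. exact h. Qed.

Lemma Re_minus (z w : C) : Re (z - w) = (Re z - Re w)%R.
Proof. reflexivity. Qed.

Lemma Im_minus (z w : C) : Im (z - w) = (Im z - Im w)%R.
Proof. reflexivity. Qed.

Lemma clim_Re_Im {T : Type} (F : (T -> Prop) -> Prop) {FF : Filter F} (f : T -> C) (l : C) :
  clim F f l <->
  filterlim (fun t => Re (f t)) F (locally (Re l)) /\ filterlim (fun t => Im (f t)) F (locally (Im l)).
Proof.
  split.
  - intro h. split; apply filterlim_locally; intro e;
      generalize (h e (cond_pos e)); apply filter_imp; intros t ht;
      (eapply Rle_lt_trans; [| exact ht]).
    + apply (Re_le_mod (f t - l)).
    + apply (Im_le_mod (f t - l)).
  - intros [h1 h2] e he. assert (he2 : (0 < e / 2)%R) by lra.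
    generalize (filter_and _ _ (proj1 (filterlim_locally _ _) h1 (mkposreal _ he2))
                 (proj1 (filterlim_locally _ _) h2 (mkposreal _ he2))).
    apply filter_imp. intros t [a b].
    change (Rabs (Re (f t) - Re l) < e / 2)%R in a.
    change (Rabs (Im (f t) - Im l) < e / 2)%R in b.
    pose proof (Cmod_sqr (f t - l)) as hs. pose proof (Cmod_ge_0 (f t - l)).
    rewrite Re_minus, Im_minus in hs.
    apply Rabs_def2 in a. apply Rabs_def2 in b. nra.
Qed.

Definition ccont {T : UniformSpace} (f : T -> C) (x : T) : Prop := clim (locally x) f (f x).

Lemma ccont_Re {T : UniformSpace} (f : T -> C) (x : T) :
  ccont f x -> continuous (fun t => Re (f t)) x.
Proof. intro h. exact (proj1 (proj1 (clim_Re_Im _ f (f x)) h)). Qed.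

Lemma ccont_Im {T : UniformSpace} (f : T -> C) (x : T) :
  ccont f x -> continuous (fun t => Im (f t)) x.
Proof. intro h. exact (proj2 (proj1 (clim_Re_Im _ f (f x)) h)). Qed.

Lemma continuous_RtoC {T : UniformSpace} (f : T -> R) (x : T) :
  continuous f x -> ccont (fun t => RtoC (f t)) x.
Proof.
  intro h. apply (proj2 (clim_Re_Im (locally x) _ _)). split; [exact h | apply continuous_const].
Qed.

Lemma is_derive_rder (f g : R -> R) (t a b : R) :
  is_derive f t a -> is_derive g t b -> rder (fun s => (f s, g s)) t (a, b).
Proof.
  intros hf hg. apply is_derive_Reals in hf. apply is_derive_Reals in hg.
  exists (fun s => if Req_dec_T s t then (a, b) else ((f s - f t) / (s - t), (g s - g t) / (s - t))%R).
  split.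
  - intro s. destruct (Req_dec_T s t) as [-> | n].
    + apply C_eq; simpl; ring.
    + rewrite <- RtoC_minus. apply C_eq; simpl; field; lra.
  - intros e he. assert (he2 : (0 < e / 2)%R) by lra.
    destruct (hf _ he2) as [d1 h1]. destruct (hg _ he2) as [d2 h2].
    assert (hd : (0 < Rmin d1 d2)%R) by (apply Rmin_pos; apply cond_pos).
    exists (mkposreal _ hd). intros s hs.
    change (Rabs (s - t) < Rmin d1 d2)%R in hs.
    destruct (Req_dec_T s t) as [-> | n].
    + rewrite Cminus_self, Cmod_0. exact he.
    + specialize (h1 (s - t)%R ltac:(lra) ltac:(eapply Rlt_le_trans; [exact hs | apply Rmin_l])).
      specialize (h2 (s - t)%R ltac:(lra) ltac:(eapply Rlt_le_trans; [exact hs | apply Rmin_r])).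
      replace (t + (s - t))%R with s in h1, h2 by (simpl in *; lra).
      set (z := ((f s - f t) / (s - t), (g s - g t) / (s - t))%R - (a, b)).
      pose proof (Cmod_sqr z) as hq. pose proof (Cmod_ge_0 z).
      unfold z at 3 4 5 6 in hq. rewrite Re_minus, Im_minus in hq. simpl in hq.
      apply Rabs_def2 in h1. apply Rabs_def2 in h2. nra.
Qed.

Lemma rder_is_derive (f : R -> C) (t : R) (l : C) : rder f t l ->
  is_derive (fun s => Re (f s)) t (Re l) /\ is_derive (fun s => Im (f s)) t (Im l).
Proof.
  intros [E [hE cE]].
  assert (key : forall e, (0 < e)%R -> exists d : posreal, forall h, h <> 0%R -> (Rabs h < d)%R ->
    (Cmod ((f (t + h)%R - f t) / RtoC h - l) < e)%R).
  { intros e he. destruct (cE e he) as [d hd]. exists d. intros h h0 hh.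
    specialize (hd (t + h)%R).
    replace ((f (t + h)%R - f t) / RtoC h) with (E (t + h)%R).
    - apply hd. change (Rabs (t + h - t) < d)%R. now replace (t + h - t)%R with h by ring.
    - rewrite (hE (t + h)%R), RtoC_plus. field. intro e0. apply h0. now apply RtoC_inj. }
  assert (hdiv : forall z h, h <> 0%R -> Re (z / RtoC h) = (Re z / h)%R /\ Im (z / RtoC h) = (Im z / h)%R).
  { intros z h h0. unfold Cdiv. rewrite <- RtoC_inv, Cmult_comm by exact h0.
    rewrite Re_RtoC_mult, Im_RtoC_mult. split; field; auto. }
  split; apply is_derive_Reals; intros e he; destruct (key e he) as [d hd]; exists d;
    intros h h0 hh; specialize (hd h h0 hh);
    destruct (hdiv (f (t + h)%R - f t) h h0) as [r1 r2];
    (eapply Rle_lt_trans; [| exact hd]).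
  - rewrite <- Re_minus, <- r1, <- Re_minus. apply Re_le_mod.
  - rewrite <- Im_minus, <- r2, <- Im_minus. apply Im_le_mod.
Qed.

Lemma rder_ccont (f : R -> C) (t : R) (l : C) : rder f t l -> ccont f t.
Proof. apply (gder_clim locally RtoC clim_RtoC). Qed.

Lemma cder_near (f : C -> C) (z l : C) : cder f z l -> clim (near z) f (f z).
Proof. apply (gder_clim near _ clim_id). Qed.

Lemma cder_comp (f g : C -> C) (z a b : C) :
  cder f (g z) a -> cder g z b -> cder (fun w => f (g w)) z (a * b).
Proof. apply (gder_comp near _ clim_id). Qed.

Lemma rder_comp (f : C -> C) (g : R -> C) (t : R) (a b : C) :
  cder f (g t) a -> rder g t b -> rder (fun s => f (g s)) t (a * b).
Proof. apply (gder_comp locally _ clim_RtoC). Qed.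

Lemma cder_mult (f g : C -> C) (z a b : C) :
  cder f z a -> cder g z b -> cder (fun w => f w * g w) z (a * g z + f z * b).
Proof. apply (gder_mult near _ clim_id). Qed.

Lemma rder_mult (f g : R -> C) (t : R) (a b : C) :
  rder f t a -> rder g t b -> rder (fun s => f s * g s) t (a * g t + f t * b).
Proof. apply (gder_mult locally _ clim_RtoC). Qed.

Lemma cder_div (f g : C -> C) (z a b : C) : g z <> 0 ->
  cder f z a -> cder g z b -> cder (fun w => f w / g w) z ((a * g z - f z * b) / (g z * g z)).
Proof.
  intros h hf hg. eapply cder_unique_at.
  - apply cder_mult; [exact hf |]. eapply (cder_comp Cinv); [| exact hg]. now apply cder_inv_fun.
  - simpl. field. auto.
Qed.

Lemma rder_div (f g : R -> C) (t : R) (a b : C) : g t <> 0 ->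
  rder f t a -> rder g t b -> rder (fun w => f w / g w) t ((a * g t - f t * b) / (g t * g t)).
Proof.
  intros h hf hg. eapply rder_unique_at.
  - apply rder_mult; [exact hf |]. eapply (rder_comp Cinv); [| exact hg]. now apply cder_inv_fun.
  - simpl. field. auto.
Qed.

Lemma rder_expi (t : R) : rder expi t (Ci * expi t).
Proof.
  eapply rder_unique_at.
  - apply (is_derive_rder cos sin t); [apply is_derive_cos | apply is_derive_sin].
  - apply C_eq; simpl; ring.
Qed.

Lemma ccont_expi (t : R) : ccont expi t.
Proof. eapply rder_ccont, rder_expi. Qed.

Lemma Cmod_expi (t : R) : Cmod (expi t) = 1%R.
Proof.
  transitivity (sqrt 1); [| apply sqrt_1].
  unfold Cmod, expi. simpl. f_equal.
  pose proof (sin2_cos2 t). unfold Rsqr in H. nra.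
Qed.

Lemma expi_neq_0 (t : R) : expi t <> 0.
Proof. intro e. pose proof (Cmod_expi t). rewrite e, Cmod_0 in H. lra. Qed.

Lemma expi_plus (s t : R) : expi (s + t) = expi s * expi t.
Proof. apply C_eq; simpl; [apply cos_plus | rewrite sin_plus; ring]. Qed.

Lemma expi_0 : expi 0 = 1.
Proof. apply C_eq; simpl; [apply cos_0 | apply sin_0]. Qed.

Lemma expi_opp (t : R) : expi (- t) = Cconj (expi t).
Proof. apply C_eq; simpl; [apply cos_neg | apply sin_neg]. Qed.

Lemma expi_inv (t : R) : / expi t = expi (- t).
Proof.
  pose proof (expi_neq_0 t).
  assert (e : expi t * expi (- t) = 1) by (rewrite <- expi_plus, Rplus_opp_r; apply expi_0).
  rewrite <- (Cmult_1_r (/ expi t)), <- e. field. auto.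
Qed.

Lemma expi_2PI (t : R) : expi (t + 2 * PI) = expi t.
Proof. apply C_eq; simpl; rewrite ?cos_plus, ?sin_plus, cos_2PI, sin_2PI; ring. Qed.

Lemma unit_expi (z : C) : Cmod z = 1%R -> exists t, (0 <= t < 2 * PI)%R /\ z = expi t.
Proof.
  intro h. pose proof (Cmod_sqr z) as hs. rewrite h in hs.
  destruct z as [x y]. simpl in hs.
  pose proof PI_RGT_0.
  assert (hx : (-1 <= x <= 1)%R) by (split; nra).
  pose proof (acos_bound x) as [a1 a2].
  assert (hsin : sin (acos x) = sqrt (1 - x²)) by (apply sin_acos; exact hx).
  destruct (Rle_lt_dec 0 y) as [hy | hy].
  - exists (acos x). split; [lra |]. apply C_eq; simpl.
    + now rewrite cos_acos.
    + rewrite hsin. symmetry. apply sqrt_lem_1; unfold Rsqr; nra.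
  - exists (2 * PI - acos x)%R.
    assert (ha : (0 < acos x)%R).
    { destruct (Req_dec (acos x) 0) as [e | e]; [| lra].
      assert (x = 1%R) by (rewrite <- (cos_acos x hx), e; apply cos_0). nra. }
    split; [lra |]. apply C_eq; simpl.
    + rewrite cos_minus, cos_2PI, sin_2PI, cos_acos by exact hx. ring.
    + rewrite sin_minus, cos_2PI, sin_2PI, hsin.
      assert (sqrt (1 - x²) = - y)%R by (apply sqrt_lem_1; unfold Rsqr; nra). lra.
Qed.

(** * Integrals of complex-valued functions *)

Definition CInt (f : R -> C) (a b : R) : C :=
  (RInt (fun t => Re (f t)) a b, RInt (fun t => Im (f t)) a b).

Definition cont_on (f : R -> C) (a b : R) : Prop := forall t, (a <= t <= b)%R -> ccont f t.

Lemma cont_on_ex (f : R -> C) (a b : R) : (a <= b)%R -> cont_on f a b ->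
  ex_RInt (fun t => Re (f t)) a b /\ ex_RInt (fun t => Im (f t)) a b.
Proof.
  intros hab h. split; apply (ex_RInt_continuous (V := R_CompleteNormedModule)); intros t ht;
    rewrite Rmin_left, Rmax_right in ht by exact hab.
  - now apply ccont_Re, h.
  - now apply ccont_Im, h.
Qed.

Lemma CInt_ext (f g : R -> C) (a b : R) : (a <= b)%R ->
  (forall t, (a <= t <= b)%R -> f t = g t) -> CInt f a b = CInt g a b.
Proof.
  intros hab h. unfold CInt. f_equal; apply RInt_ext; intros t ht;
    rewrite Rmin_left, Rmax_right in ht by exact hab; rewrite h; auto; lra.
Qed.

Lemma CInt_plus (f g : R -> C) (a b : R) : (a <= b)%R -> cont_on f a b -> cont_on g a b ->
  CInt (fun t => f t + g t) a b = CInt f a b + CInt g a b.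
Proof.
  intros hab hf hg. destruct (cont_on_ex f a b hab hf), (cont_on_ex g a b hab hg).
  apply C_eq; simpl; now apply (RInt_plus (V := R_CompleteNormedModule)).
Qed.

Lemma RInt_lin2 (f g : R -> R) (a b x y : R) : ex_RInt f a b -> ex_RInt g a b ->
  RInt (fun t => x * f t + y * g t)%R a b = (x * RInt f a b + y * RInt g a b)%R.
Proof.
  intros hf hg. apply is_RInt_unique.
  apply (is_RInt_plus (V := R_NormedModule)); apply (is_RInt_scal (V := R_NormedModule));
    now apply (RInt_correct (V := R_CompleteNormedModule)).
Qed.

Lemma CInt_scal (c : C) (f : R -> C) (a b : R) : (a <= b)%R -> cont_on f a b ->
  CInt (fun t => c * f t) a b = c * CInt f a b.
Proof.
  intros hab hf. destruct (cont_on_ex f a b hab hf) as [h1 h2].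
  apply C_eq; simpl.
  - replace (fst c * RInt (fun t => Re (f t)) a b - snd c * RInt (fun t => Im (f t)) a b)%R
      with (fst c * RInt (fun t => Re (f t)) a b + (- snd c) * RInt (fun t => Im (f t)) a b)%R by ring.
    rewrite <- RInt_lin2 by auto. apply RInt_ext. intros t _. unfold Re, Im. simpl. ring.
  - replace (fst c * RInt (fun t => Im (f t)) a b + snd c * RInt (fun t => Re (f t)) a b)%R
      with (fst c * RInt (fun t => Im (f t)) a b + (snd c) * RInt (fun t => Re (f t)) a b)%R by ring.
    rewrite <- RInt_lin2 by auto. apply RInt_ext. intros t _. unfold Re, Im. simpl. ring.
Qed.

Lemma cont_on_const (c : C) (a b : R) : cont_on (fun _ => c) a b.
Proof. intros t _. apply clim_const. Qed.

Lemma cont_on_mult (f g : R -> C) (a b : R) :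
  cont_on f a b -> cont_on g a b -> cont_on (fun t => f t * g t) a b.
Proof. intros hf hg t ht. apply clim_mult; [now apply hf | now apply hg]. Qed.

Lemma cont_on_scal (c : C) (f : R -> C) (a b : R) : cont_on f a b -> cont_on (fun t => c * f t) a b.
Proof. intro hf. apply cont_on_mult; [apply cont_on_const | exact hf]. Qed.

Lemma cont_on_plus (f g : R -> C) (a b : R) :
  cont_on f a b -> cont_on g a b -> cont_on (fun t => f t + g t) a b.
Proof. intros hf hg t ht. apply clim_plus; [now apply hf | now apply hg]. Qed.

Lemma cont_on_minus (f g : R -> C) (a b : R) :
  cont_on f a b -> cont_on g a b -> cont_on (fun t => f t - g t) a b.
Proof. intros hf hg t ht. apply clim_minus; [now apply hf | now apply hg]. Qed.

Lemma cont_on_conj (f : R -> C) (a b : R) : cont_on f a b -> cont_on (fun t => Cconj (f t)) a b.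
Proof. intros hf t ht. apply clim_conj. now apply hf. Qed.

Lemma CInt_minus (f g : R -> C) (a b : R) : (a <= b)%R -> cont_on f a b -> cont_on g a b ->
  CInt (fun t => f t - g t) a b = CInt f a b - CInt g a b.
Proof.
  intros hab hf hg.
  rewrite (CInt_ext _ (fun t => f t + (- 1) * g t)) by (auto; intros; ring).
  rewrite CInt_plus, CInt_scal; auto; [ring |]. apply cont_on_scal; exact hg.
Qed.

Lemma CInt_conj (f : R -> C) (a b : R) : (a <= b)%R -> cont_on f a b ->
  CInt (fun t => Cconj (f t)) a b = Cconj (CInt f a b).
Proof.
  intros hab hf. destruct (cont_on_ex f a b hab hf) as [h1 h2].
  apply C_eq; simpl; [reflexivity |].
  now apply (RInt_opp (V := R_CompleteNormedModule)).
Qed.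

Lemma CInt_const (c : C) (a b : R) : CInt (fun _ => c) a b = RtoC (b - a) * c.
Proof.
  unfold CInt. rewrite !RInt_const. destruct c. apply C_eq; simpl; unfold scal; simpl;
    unfold mult; simpl; ring.
Qed.

Lemma CInt_Chasles (f : R -> C) (a b c : R) : (a <= b)%R -> (b <= c)%R -> cont_on f a c ->
  CInt f a c = CInt f a b + CInt f b c.
Proof.
  intros hab hbc hf.
  destruct (cont_on_ex f a b hab) as [h1 h2]; [intros t ht; apply hf; lra |].
  destruct (cont_on_ex f b c hbc) as [h3 h4]; [intros t ht; apply hf; lra |].
  apply C_eq; simpl; symmetry; now apply (RInt_Chasles (V := R_CompleteNormedModule)).
Qed.

(** After a rotation that puts the integral on the positive axis, its modulus is the integral of a
    real part, which is at most g pointwise. *)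
Lemma CInt_mod_le (f : R -> C) (g : R -> R) (a b : R) : (a <= b)%R -> cont_on f a b ->
  ex_RInt g a b -> (forall t, (a <= t <= b)%R -> (Cmod (f t) <= g t)%R) ->
  (Cmod (CInt f a b) <= RInt g a b)%R.
Proof.
  intros hab hf hg h.
  destruct (unimodular_rotation (CInt f a b)) as [u [hu hI]].
  assert (hc : cont_on (fun t => u * f t) a b) by now apply cont_on_scal.
  replace (Cmod (CInt f a b)) with (Re (CInt (fun t => u * f t) a b)).
  - simpl. apply RInt_le; auto.
    + now apply (cont_on_ex (fun t => u * f t)).
    + intros t ht. apply Rle_trans with (Cmod (u * f t)).
      * apply Rle_trans with (Rabs (Re (u * f t))); [apply Rle_abs | apply Re_le_mod].
      * rewrite Cmod_mult, hu, Rmult_1_l. apply h. lra.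
  - rewrite CInt_scal by auto. rewrite hI. reflexivity.
Qed.

Lemma CInt_mod_le_const (f : R -> C) (M a b : R) : (a <= b)%R -> cont_on f a b ->
  (forall t, (a <= t <= b)%R -> (Cmod (f t) <= M)%R) -> (Cmod (CInt f a b) <= (b - a) * M)%R.
Proof.
  intros hab hf h. replace ((b - a) * M)%R with (RInt (fun _ => M) a b).
  - apply CInt_mod_le; auto. apply ex_RInt_const.
  - rewrite RInt_const. reflexivity.
Qed.

Lemma CInt_derive (f df : R -> C) (a b : R) : (a <= b)%R ->
  (forall t, (a <= t <= b)%R -> rder f t (df t)) -> cont_on df a b ->
  CInt df a b = f b - f a.
Proof.
  intros hab h hc.
  apply C_eq; simpl.
  - apply is_RInt_unique.
    apply (is_RInt_derive (V := R_CompleteNormedModule) (fun t => Re (f t)) (fun t => Re (df t)));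
      intros t ht; rewrite Rmin_left, Rmax_right in ht by exact hab.
    + now apply rder_is_derive, h.
    + now apply ccont_Re, hc.
  - apply is_RInt_unique.
    apply (is_RInt_derive (V := R_CompleteNormedModule) (fun t => Im (f t)) (fun t => Im (df t)));
      intros t ht; rewrite Rmin_left, Rmax_right in ht by exact hab.
    + now apply rder_is_derive, h.
    + now apply ccont_Im, hc.
Qed.

(** * Goursat's lemma and the Cauchy formula *)

Lemma nested_intervals (a b : nat -> R) :
  (forall n, (a n <= a (S n))%R) -> (forall n, (b (S n) <= b n)%R) ->
  (forall n, (a n <= b n)%R) -> exists l, forall n, (a n <= l <= b n)%R.
Proof.
  intros ha hb hab.
  assert (ma : forall n k, (a n <= a (k + n)%nat)%R).
  { intros n k. induction k; simpl; [lra |]. eapply Rle_trans; [exact IHk | apply ha]. }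
  assert (mb : forall n k, (b (k + n)%nat <= b n)%R).
  { intros n k. induction k; simpl; [lra |]. eapply Rle_trans; [apply hb | exact IHk]. }
  assert (cross : forall n m, (a n <= b m)%R).
  { intros n m. apply Rle_trans with (a (m + n)%nat); [apply ma |].
    apply Rle_trans with (b (m + n)%nat); [apply hab |].
    rewrite Nat.add_comm. apply mb. }
  destruct (completeness (fun x => exists n, x = a n)) as [l [h1 h2]].
  - exists (b 0%nat). intros x [n ->]. apply cross.
  - exists (a 0%nat), 0%nat. reflexivity.
  - exists l. intro n. split.
    + apply h1. now exists n.
    + apply h2. intros x [m ->]. apply cross.
Qed.

Section Goursat.

Variable I : R -> R -> R -> R -> C.

(** Picks a quarter rectangle carrying at least a fourth of |I|. The last quarter is the default: if
    the other three fail, additivity makes it qualify. *)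
Definition quarter (q : R * R * R * R) : R * R * R * R :=
  let '(a, b, c, d) := q in
  let m := ((a + b) / 2)%R in
  let n := ((c + d) / 2)%R in
  let big x y z t := Rle_dec (Cmod (I a b c d) / 4) (Cmod (I x y z t)) in
  if big a m c n then (a, m, c, n)
  else if big m b c n then (m, b, c, n)
  else if big a m n d then (a, m, n, d)
  else (m, b, n, d).

Variables a0 b0 c0 d0 : R.
Hypothesis hab : (a0 <= b0)%R.
Hypothesis hcd : (c0 <= d0)%R.
Hypothesis split_u : forall a m b c d, (a0 <= a <= m)%R -> (m <= b <= b0)%R -> (c0 <= c <= d)%R ->
  (d <= d0)%R -> I a b c d = I a m c d + I m b c d.
Hypothesis split_v : forall a b c m d, (a0 <= a <= b)%R -> (b <= b0)%R -> (c0 <= c <= m)%R ->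
  (m <= d <= d0)%R -> I a b c d = I a b c m + I a b m d.
Hypothesis small : forall u v eps, (a0 <= u <= b0)%R -> (c0 <= v <= d0)%R -> (0 < eps)%R ->
  exists del, (0 < del)%R /\ forall a b c d, (a0 <= a <= u)%R -> (u <= b <= b0)%R ->
    (c0 <= c <= v)%R -> (v <= d <= d0)%R -> (b - a <= del)%R -> (d - c <= del)%R ->
    (Cmod (I a b c d) <= eps * ((b - a) + (d - c)) ^ 2)%R.

Definition cells (n : nat) : R * R * R * R := Nat.iter n quarter (a0, b0, c0, d0).

(** Goursat's bisection. After n quarterings |I| is still at least 4^(-n) times its initial value,
    while [small] at the common point of the nested cells makes it o(4^(-n)). *)
Lemma additive_rectangle_zero : I a0 b0 c0 d0 = 0.
Proof.
  set (A n := fst (fst (fst (cells n)))). set (B n := snd (fst (fst (cells n)))).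
  set (Cc n := snd (fst (cells n))). set (D n := snd (cells n)).
  assert (eC : forall n, cells n = (A n, B n, Cc n, D n)).
  { intro n. unfold A, B, Cc, D. now destruct (cells n) as [[[? ?] ?] ?]. }
  assert (step : forall n, (a0 <= A n <= B n)%R /\ (B n <= b0)%R /\ (c0 <= Cc n <= D n)%R /\ (D n <= d0)%R ->
    (A n <= A (S n) <= B (S n))%R /\ (B (S n) <= B n)%R /\ (Cc n <= Cc (S n) <= D (S n))%R /\
    (D (S n) <= D n)%R /\ (B (S n) - A (S n) = (B n - A n) / 2)%R /\
    (D (S n) - Cc (S n) = (D n - Cc n) / 2)%R /\
    (Cmod (I (A n) (B n) (Cc n) (D n)) / 4 <= Cmod (I (A (S n)) (B (S n)) (Cc (S n)) (D (S n))))%R).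
  { intros n (h1 & h2 & h3 & h4).
    assert (e : cells (S n) = quarter (A n, B n, Cc n, D n)) by (rewrite <- eC; reflexivity).
    rewrite (eC (S n)) in e. unfold quarter in e.
    set (a := A n) in *. set (b := B n) in *. set (c := Cc n) in *. set (d := D n) in *.
    set (m := ((a + b) / 2)%R) in *. set (k := ((c + d) / 2)%R) in *.
    assert (hm : (a <= m <= b)%R) by (unfold m; lra).
    assert (hk : (c <= k <= d)%R) by (unfold k; lra).
    assert (hm' : (m - a = (b - a) / 2 /\ b - m = (b - a) / 2)%R) by (unfold m; lra).
    assert (hk' : (k - c = (d - c) / 2 /\ d - k = (d - c) / 2)%R) by (unfold k; lra).
    repeat match type of e with context [Rle_dec ?x ?y] => destruct (Rle_dec x y) end;
      injection e as -> -> -> ->; try (repeat split; lra).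
    assert (s : I a b c d = I a m c k + I a m k d + (I m b c k + I m b k d)).
    { rewrite (split_u a m b c d), (split_v a m c k d), (split_v m b c k d) by lra. reflexivity. }
    pose proof (Cmod_triangle (I a m c k + I a m k d) (I m b c k + I m b k d)).
    pose proof (Cmod_triangle (I a m c k) (I a m k d)).
    pose proof (Cmod_triangle (I m b c k) (I m b k d)).
    rewrite <- s in H. repeat split; lra. }
  assert (inv : forall n, (a0 <= A n <= B n)%R /\ (B n <= b0)%R /\ (c0 <= Cc n <= D n)%R /\ (D n <= d0)%R).
  { induction n.
    - unfold A, B, Cc, D; simpl. lra.
    - pose proof (step n IHn). lra. }
  assert (wid : forall n, (B n - A n = (b0 - a0) * (/ 2) ^ n)%R /\ (D n - Cc n = (d0 - c0) * (/ 2) ^ n)%R /\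
    (Cmod (I a0 b0 c0 d0) * ((/ 2) ^ n * (/ 2) ^ n) <= Cmod (I (A n) (B n) (Cc n) (D n)))%R).
  { induction n.
    - unfold A, B, Cc, D; simpl. lra.
    - pose proof (step n (inv n)). simpl. repeat split; try lra. }

  destruct (nested_intervals A B) as [u hu]; try (intro n; pose proof (step n (inv n)); pose proof (inv n); lra).
  destruct (nested_intervals Cc D) as [v hv]; try (intro n; pose proof (step n (inv n)); pose proof (inv n); lra).
  assert (hu0 : (a0 <= u <= b0)%R) by (pose proof (hu 0%nat); pose proof (inv 0%nat); lra).
  assert (hv0 : (c0 <= v <= d0)%R) by (pose proof (hv 0%nat); pose proof (inv 0%nat); lra).
  set (w := (b0 - a0 + (d0 - c0))%R).
  apply Cmod_eq_0. apply Rle_antisym; [| apply Cmod_ge_0].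
  apply Rnot_lt_le. intro hp. set (m := Cmod (I a0 b0 c0 d0)) in *.
  (* On the n-th cell, whose side sum is w / 2^n, this eps gives at most half of m / 4^n; the 1
     covers w = 0. *)
  assert (heps : (0 < m / (2 * (w ^ 2 + 1)))%R).
  { apply Rdiv_lt_0_compat; [exact hp |]. pose proof (pow2_ge_0 w). lra. }
  destruct (small u v _ hu0 hv0 heps) as [del [hdel hs]].
  assert (hw : (0 <= w)%R) by (unfold w; lra).
  assert (hlt : (0 < del / (w + 1))%R) by (apply Rdiv_lt_0_compat; lra).
  destruct (pow_lt_1_zero (/ 2) ltac:(rewrite Rabs_pos_eq; lra) _ hlt) as [n hn].
  specialize (hn n ltac:(lia)).
  assert (hpn : (0 < (/ 2) ^ n)%R) by (apply pow_lt; lra).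
  rewrite Rabs_pos_eq in hn by lra.
  assert (hdw : ((/ 2) ^ n * (w + 1) <= del)%R).
  { apply Rlt_le. apply Rmult_lt_reg_r with (/ (w + 1))%R; [apply Rinv_0_lt_compat; lra |].
    rewrite Rmult_assoc, Rinv_r by lra. unfold Rdiv in hn. lra. }
  destruct (wid n) as (w1 & w2 & w3). pose proof (inv n). pose proof (hu n). pose proof (hv n).
  specialize (hs (A n) (B n) (Cc n) (D n)).
  assert (hfin : (Cmod (I (A n) (B n) (Cc n) (D n)) <=
     m / (2 * (w ^ 2 + 1)) * (B n - A n + (D n - Cc n)) ^ 2)%R).
  { apply hs; try lra; unfold w in *; rewrite ?w1, ?w2; nra. }
  replace (B n - A n + (D n - Cc n))%R with (w * (/ 2) ^ n)%R in hfin by (rewrite w1, w2; unfold w; ring).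
  set (p := ((/ 2) ^ n)%R) in *.
  assert (hq : (m * (p * p) <= m / (2 * (w ^ 2 + 1)) * (w * p) ^ 2)%R) by lra.
  assert (hlast : (m / (2 * (w ^ 2 + 1)) * (w * p) ^ 2 <= m / 2 * (p * p))%R).
  { replace (m / (2 * (w ^ 2 + 1)) * (w * p) ^ 2)%R with (m / 2 * (p * p) * (w ^ 2 / (w ^ 2 + 1)))%R.
    - rewrite <- (Rmult_1_r (m / 2 * (p * p))) at 2. apply Rmult_le_compat_l; [nra |].
      pose proof (pow2_ge_0 w). apply Rmult_le_reg_r with (w ^ 2 + 1)%R; [lra |].
      unfold Rdiv. rewrite Rmult_assoc, Rinv_l by lra. lra.
    - field. pose proof (pow2_ge_0 w). lra. }
  assert (0 < p * p)%R by nra. nra.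
Qed.

End Goursat.

(** The radius is a parameter because integrals over the unit circle need R0 > 1, while functions of
    the class have R0 = 1 and reach the circle only after a dilation. *)
Definition holo (R0 : R) (f : C -> C) : Prop :=
  forall z, (Cmod z < R0)%R -> exists l, cder f z l.

Lemma Cmod_expi_minus_le (s t : R) : (s <= t)%R -> (Cmod (expi t - expi s) <= t - s)%R.
Proof.
  intro h. rewrite <- (CInt_derive expi (fun u => Ci * expi u)).
  - rewrite <- (Rmult_1_r (t - s)). apply CInt_mod_le_const; [exact h | |].
    + apply cont_on_mult; [apply cont_on_const |]. intros u _. apply ccont_expi.
    + intros u _. rewrite Cmod_mult, Cmod_expi, Cmod_Ci. lra.
  - exact h.
  - intros u _. apply rder_expi.
  - apply cont_on_mult; [apply cont_on_const |]. intros u _. apply ccont_expi.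
Qed.

Lemma Cmod_expi_minus (s t : R) : (Cmod (expi t - expi s) <= Rabs (t - s))%R.
Proof.
  destruct (Rle_dec s t).
  - rewrite Rabs_pos_eq by lra. now apply Cmod_expi_minus_le.
  - rewrite Cmod_minus_sym, Rabs_left by lra. pose proof (Cmod_expi_minus_le t s). lra.
Qed.

Lemma exp_minus_le (s t : R) : (s <= 0)%R -> (t <= 0)%R -> (Rabs (exp t - exp s) <= Rabs (t - s))%R.
Proof.
  intros hs ht.
  destruct (MVT_gen exp s t exp) as [c [hc e]].
  - intros x _. apply is_derive_exp.
  - intros x _. apply derivable_continuous_pt, derivable_pt_exp.
  - rewrite e, Rabs_mult. rewrite <- (Rmult_1_l (Rabs (t - s))) at 2.
    apply Rmult_le_compat_r; [apply Rabs_pos |].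
    rewrite Rabs_pos_eq by (left; apply exp_pos).
    rewrite <- exp_0. destruct hc as [_ hc].
    assert (c <= 0)%R by (eapply Rle_trans; [exact hc | apply Rmax_lub; auto]).
    destruct H as [H | ->]; [left; now apply exp_increasing | lra].
Qed.

Lemma rder_exp (u : R) : rder (fun u => RtoC (exp u)) u (RtoC (exp u)).
Proof. apply (is_derive_rder exp (fun _ => 0%R)); [apply is_derive_exp | apply (is_derive_const (V := R_NormedModule))]. Qed.

Lemma holo_clim (R0 : R) (f : C -> C) (z : C) : holo R0 f -> (Cmod z < R0)%R -> clim (near z) f (f z).
Proof. intros h hz. destruct (h z hz) as [l hl]. eapply cder_near; eauto. Qed.

Lemma clim_near_comp {T : UniformSpace} (f : C -> C) (g : T -> C) (x : T) :
  clim (near (g x)) f (f (g x)) -> ccont g x -> ccont (fun t => f (g t)) x.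
Proof. intros h hg. exact (clim_comp f g (g x) (f (g x)) h hg). Qed.

Lemma expi_minus_neq_0 (z : C) (t : R) : (Cmod z < 1)%R -> expi t - z <> 0.
Proof.
  intros h e. pose proof (Cmod_minus_triangle (expi t) z) as h1.
  rewrite Cmod_expi, e, Cmod_0 in h1. lra.
Qed.

Lemma expi_minus_mod (z : C) (t : R) : (1 - Cmod z <= Cmod (expi t - z))%R.
Proof. pose proof (Cmod_minus_triangle (expi t) z) as h. now rewrite Cmod_expi in h. Qed.

Section Cauchy.

Variable z0 : C.
Hypothesis hz0 : (Cmod z0 < 1)%R.

(** Contracts the unit circle to z0 as u tends to minus infinity. The exponential makes dZ / (Z -
    z0) pull back to du + [dlog t] dt, with coefficients independent of u. *)
Definition spiral (u t : R) : C := z0 + RtoC (exp u) * (expi t - z0).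
Definition dlog (t : R) : C := Ci * expi t / (expi t - z0).

Lemma spiral_mod (u t : R) : (u <= 0)%R -> (Cmod (spiral u t) <= 1)%R.
Proof.
  intro hu. unfold spiral.
  assert (he : (0 < exp u <= 1)%R).
  { split; [apply exp_pos |]. rewrite <- exp_0. destruct hu as [hu | ->]; [left; now apply exp_increasing | lra]. }
  replace (z0 + RtoC (exp u) * (expi t - z0)) with (RtoC (1 - exp u) * z0 + RtoC (exp u) * expi t)
    by (rewrite RtoC_minus; ring).
  eapply Rle_trans; [apply Cmod_triangle |].
  rewrite !Cmod_mult, !Cmod_R, !Rabs_pos_eq, Cmod_expi by lra. nra.
Qed.

Lemma spiral_lip (u v s t : R) : (u <= 0)%R -> (v <= 0)%R ->
  (Cmod (spiral v t - spiral u s) <= 2 * (Rabs (v - u) + Rabs (t - s)))%R.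
Proof.
  intros hu hv. unfold spiral.
  replace (z0 + RtoC (exp v) * (expi t - z0) - (z0 + RtoC (exp u) * (expi s - z0)))
    with (RtoC (exp v - exp u) * (expi t - z0) + RtoC (exp u) * (expi t - expi s))
    by (rewrite RtoC_minus; ring).
  eapply Rle_trans; [apply Cmod_triangle |].
  rewrite !Cmod_mult, !Cmod_R.
  pose proof (exp_minus_le u v hu hv). pose proof (Cmod_expi_minus s t).
  assert (Cmod (expi t - z0) <= 2)%R.
  { unfold Cminus. eapply Rle_trans; [apply Cmod_triangle |]. rewrite Cmod_opp, Cmod_expi. lra. }
  assert (Rabs (exp u) <= 1)%R.
  { rewrite Rabs_pos_eq by (left; apply exp_pos). rewrite <- exp_0.
    destruct hu as [hu | ->]; [left; now apply exp_increasing | lra]. }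
  pose proof (Rabs_pos (exp v - exp u)). pose proof (Rabs_pos (exp u)).
  pose proof (Cmod_ge_0 (expi t - z0)). pose proof (Cmod_ge_0 (expi t - expi s)).
  pose proof (Rabs_pos (v - u)). pose proof (Rabs_pos (t - s)). nra.
Qed.

Lemma spiral_rder_u (u t : R) : rder (fun u => spiral u t) u (RtoC (exp u) * (expi t - z0)).
Proof.
  eapply rder_unique_at.
  - apply gder_plus; [apply locally_filter | apply gder_const, locally_filter |].
    apply rder_mult; [apply rder_exp | apply gder_const, locally_filter].
  - simpl. ring.
Qed.

Lemma spiral_rder_t (u t : R) : rder (fun t => spiral u t) t (RtoC (exp u) * (Ci * expi t)).
Proof.
  eapply rder_unique_at.
  - apply gder_plus; [apply locally_filter | apply gder_const, locally_filter |].
    apply rder_mult; [apply gder_const, locally_filter |].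
    apply gder_minus; [apply locally_filter | apply rder_expi | apply gder_const, locally_filter].
  - simpl. ring.
Qed.

Lemma dlog_cont (t : R) : ccont dlog t.
Proof.
  unfold ccont, dlog. apply clim_mult.
  - apply clim_mult; [apply clim_const | apply ccont_expi].
  - apply clim_inv; [now apply expi_minus_neq_0 |].
    apply clim_minus; [apply ccont_expi | apply clim_const].
Qed.

Lemma dlog_mod (t : R) : (Cmod (dlog t) <= / (1 - Cmod z0))%R.
Proof.
  unfold dlog. pose proof (expi_minus_neq_0 z0 t hz0).
  rewrite Cmod_div, Cmod_mult, Cmod_Ci, Cmod_expi by auto.
  pose proof (expi_minus_mod z0 t). unfold Rdiv. rewrite !Rmult_1_l.
  apply Rinv_le_contravar; lra.
Qed.

(* The integral of the closed form [f(Z) dZ / (Z - z0)], pulled back by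
   [spiral], along the boundary of a coordinate rectangle. *)
Definition boundary (f : C -> C) (a b c d : R) : C :=
  CInt (fun u => f (spiral u c)) a b + CInt (fun t => f (spiral b t) * dlog t) c d
  - CInt (fun u => f (spiral u d)) a b - CInt (fun t => f (spiral a t) * dlog t) c d.

Definition disk_cont (f : C -> C) : Prop := forall z, (Cmod z <= 1)%R -> clim (near z) f (f z).

Lemma disk_cont_u (f : C -> C) (a b t : R) : disk_cont f -> (b <= 0)%R ->
  cont_on (fun u => f (spiral u t)) a b.
Proof.
  intros hf hb u hu. apply clim_near_comp; [apply hf, spiral_mod; lra |].
  eapply rder_ccont, spiral_rder_u.
Qed.

Lemma disk_cont_t (f : C -> C) (u a b : R) : disk_cont f -> (u <= 0)%R ->
  cont_on (fun t => f (spiral u t) * dlog t) a b.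
Proof.
  intros hf hb. apply cont_on_mult; [| intros t _; apply dlog_cont].
  intros t ht. apply clim_near_comp; [apply hf, spiral_mod; lra |].
  eapply rder_ccont, spiral_rder_t.
Qed.

Lemma boundary_plus (f g : C -> C) (a b c d : R) : (a <= b <= 0)%R -> (c <= d)%R ->
  disk_cont f -> disk_cont g ->
  boundary (fun z => f z + g z) a b c d = boundary f a b c d + boundary g a b c d.
Proof.
  intros hab hcd hf hg. unfold boundary.
  rewrite !CInt_plus by (try apply disk_cont_u; auto; lra).
  rewrite (CInt_ext (fun t => (f (spiral b t) + g (spiral b t)) * dlog t)
             (fun t => f (spiral b t) * dlog t + g (spiral b t) * dlog t)) by (auto; intros; ring).
  rewrite (CInt_ext (fun t => (f (spiral a t) + g (spiral a t)) * dlog t)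
             (fun t => f (spiral a t) * dlog t + g (spiral a t) * dlog t)) by (auto; intros; ring).
  rewrite !CInt_plus by (try apply disk_cont_t; auto; lra). ring.
Qed.

(** The constant k pulls back to k du + k [dlog t] dt, whose opposite sides cancel, and l (Z - z0)
    leaves l dZ, which has the primitive l Z. *)
Lemma boundary_affine (k l : C) (a b c d : R) : (a <= b <= 0)%R -> (c <= d)%R ->
  boundary (fun z => k + l * (z - z0)) a b c d = 0.
Proof.
  intros hab hcd.
  assert (hk : disk_cont (fun _ => k)) by (intros z _; apply clim_const).
  assert (hl : disk_cont (fun z => l * (z - z0))).
  { intros z _. apply clim_mult; [apply clim_const |]. apply clim_minus; [apply clim_id | apply clim_const]. }
  rewrite (boundary_plus (fun _ => k) (fun z => l * (z - z0))) by auto.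
  unfold boundary.
  rewrite !CInt_const.
  assert (e1 : forall t, CInt (fun u => l * (spiral u t - z0)) a b = l * (spiral b t - spiral a t)).
  { intro t. rewrite (CInt_derive (fun u => l * spiral u t)); [ring | lra | |].
    - intros u _. eapply rder_unique_at.
      + apply rder_mult; [apply gder_const, locally_filter | apply spiral_rder_u].
      + unfold spiral. ring.
    - apply (disk_cont_u (fun z => l * (z - z0))); [auto | lra]. }
  assert (e2 : forall u, (u <= 0)%R -> CInt (fun t => l * (spiral u t - z0) * dlog t) c d = l * (spiral u d - spiral u c)).
  { intros u hu. rewrite (CInt_derive (fun t => l * spiral u t)); [ring | lra | |].
    - intros t _. eapply rder_unique_at.
      + apply rder_mult; [apply gder_const, locally_filter | apply spiral_rder_t].
      + unfold spiral, dlog. pose proof (expi_minus_neq_0 z0 t hz0). field. auto.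
    - apply (disk_cont_t (fun z => l * (z - z0))); auto. }
  rewrite !e1, !e2 by lra. ring.
Qed.

Lemma boundary_bound (f : C -> C) (M a b c d : R) : (a <= b <= 0)%R -> (c <= d)%R -> disk_cont f ->
  (forall u t, (a <= u <= b)%R -> (c <= t <= d)%R -> (Cmod (f (spiral u t)) <= M)%R) ->
  (Cmod (boundary f a b c d) <= 2 * M * / (1 - Cmod z0) * ((b - a) + (d - c)))%R.
Proof.
  intros hab hcd hf h. unfold boundary.
  assert (hM : (0 <= M)%R) by (eapply Rle_trans; [apply Cmod_ge_0 | apply (h a c); lra]).
  assert (hm : (1 <= / (1 - Cmod z0))%R).
  { rewrite <- Rinv_1. pose proof (Cmod_ge_0 z0). apply Rinv_le_contravar; lra. }
  set (m := (/ (1 - Cmod z0))%R) in *.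
  assert (e1 : forall t, (c <= t <= d)%R -> (Cmod (CInt (fun u => f (spiral u t)) a b) <= (b - a) * M)%R).
  { intros t ht. apply CInt_mod_le_const; [lra | apply disk_cont_u; [auto | lra] |]. intros; now apply h. }
  assert (e2 : forall u, (a <= u <= b)%R -> (Cmod (CInt (fun t => f (spiral u t) * dlog t)%C c d) <= (d - c) * (M * m))%R).
  { intros u hu. apply CInt_mod_le_const; [lra | apply disk_cont_t; [auto | lra] |]. intros t ht.
    rewrite Cmod_mult. apply Rmult_le_compat; try apply Cmod_ge_0; [now apply h | apply dlog_mod]. }
  pose proof (e1 c ltac:(lra)). pose proof (e1 d ltac:(lra)).
  pose proof (e2 a ltac:(lra)). pose proof (e2 b ltac:(lra)).
  set (I1 := CInt (fun u => f (spiral u c)) a b) in *.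
  set (I2 := CInt (fun t => f (spiral b t) * dlog t) c d) in *.
  set (I3 := CInt (fun u => f (spiral u d)) a b) in *.
  set (I4 := CInt (fun t => f (spiral a t) * dlog t) c d) in *.
  pose proof (Cmod_triangle (I1 + I2 - I3) (- I4)) as t1. rewrite Cmod_opp in t1.
  pose proof (Cmod_triangle (I1 + I2) (- I3)) as t2. rewrite Cmod_opp in t2.
  pose proof (Cmod_triangle I1 I2) as t3.
  assert ((b - a) * M <= (b - a) * (M * m))%R by (apply Rmult_le_compat_l; nra).
  unfold Cminus in *.
  nra.
Qed.

Lemma holo_disk_cont (R0 : R) (f : C -> C) : (1 < R0)%R -> holo R0 f -> disk_cont f.
Proof. intros h hf z hz. apply (holo_clim R0); [exact hf | lra]. Qed.

(** On a small cell f may be replaced by its error of affine approximation, because the affine part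
    integrates to zero; this error supplies the quadratic bound needed for the bisection. *)
Lemma boundary_zero (R0 : R) (f : C -> C) (a : R) : (1 < R0)%R -> holo R0 f -> (a <= 0)%R ->
  boundary f a 0 0 (2 * PI) = 0.
Proof.
  intros hR hf ha. pose proof PI_RGT_0.
  assert (hd : disk_cont f) by now apply (holo_disk_cont R0).
  apply (additive_rectangle_zero (boundary f)); try lra.
  - intros a' m b c d h1 h2 h3 h4. unfold boundary.
    rewrite (CInt_Chasles _ a' m b) by (try apply disk_cont_u; auto; lra).
    rewrite (CInt_Chasles (fun u => f (spiral u d)) a' m b) by (try apply disk_cont_u; auto; lra). ring.
  - intros a' b c m d h1 h2 h3 h4. unfold boundary.
    rewrite (CInt_Chasles (fun t => f (spiral b t) * dlog t) c m d) by (try apply disk_cont_t; auto; lra).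
    rewrite (CInt_Chasles (fun t => f (spiral a' t) * dlog t) c m d) by (try apply disk_cont_t; auto; lra). ring.
  - intros u v e hu hv he.
    assert (hz : (Cmod (spiral u v) <= 1)%R) by (apply spiral_mod; lra).
    set (z := spiral u v) in *.
    destruct (hf z) as [l hl]; [lra |].
    set (m := (/ (1 - Cmod z0))%R).
    assert (hm : (0 < m)%R) by (apply Rinv_0_lt_compat; lra).
    (* The factor 2 of [spiral_lip] and the factor 2 m of [boundary_bound] turn this into e. *)
    assert (he' : (0 < e / (4 * m))%R) by (apply Rdiv_lt_0_compat; lra).
    destruct (eps_of_cder f z l hl _ he') as [del [hdel hs]].
    (* Both sides of the cell are at most del / 8 and [spiral] is 2-Lipschitz, so the cell lands
       within del / 2 of z. *)
    exists (del / 8)%R. split; [lra |]. intros a' b c d h1 h2 h3 h4 h5 h6.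
    (* This is the tangent f z + l (w - z), expanded at z0 as [boundary_affine] requires. *)
    set (L := fun w => f z + l * (z0 - z) + l * (w - z0)).
    set (g := fun w => f w + - L w).
    assert (hL : disk_cont L).
    { intros w _. apply clim_plus; [apply clim_const |]. apply clim_mult; [apply clim_const |].
      apply clim_minus; [apply clim_id | apply clim_const]. }
    assert (hg : disk_cont g).
    { intros w hw. apply clim_plus; [now apply hd |]. apply clim_opp. now apply hL. }
    replace (boundary f a' b c d) with (boundary g a' b c d).
    2:{ rewrite <- (Cplus_0_r (boundary g a' b c d)).
        rewrite <- (boundary_affine (f z + l * (z0 - z)) l a' b c d) by lra. fold L.
        rewrite <- boundary_plus by (auto; lra).
        f_equal. apply functional_extensionality. intro w. unfold g. ring. }
    set (s := (b - a' + (d - c))%R).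
    apply Rle_trans with (2 * (e / (4 * m) * (2 * s)) * m * s)%R.
    + apply boundary_bound; [lra | lra | exact hg |].
      intros u' t hu' ht.
      assert (hlip : (Cmod (spiral u' t - z) <= 2 * s)%R).
      { eapply Rle_trans; [apply spiral_lip; lra |]. apply Rmult_le_compat_l; [lra |]. unfold s.
        apply Rplus_le_compat; apply Rabs_le; lra. }
      unfold g. replace (f (spiral u' t) + - L (spiral u' t)) with
        (f (spiral u' t) - f z - l * (spiral u' t - z)) by (unfold L; ring).
      eapply Rle_trans; [apply hs; unfold s in hlip; lra |].
      apply Rmult_le_compat_l; lra.
    + right. unfold s. field. lra.
Qed.

Lemma spiral_0 (t : R) : spiral 0 t = expi t.
Proof. unfold spiral. rewrite exp_0. ring. Qed.

Lemma spiral_period (u : R) : spiral u (2 * PI) = spiral u 0.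
Proof. unfold spiral. now rewrite <- (expi_2PI 0), Rplus_0_l. Qed.

(** The sides t = 0 and t = 2 PI of the rectangle have the same image and cancel, leaving the two
    circles. *)
Lemma circle_integral_spiral (R0 : R) (f : C -> C) (u : R) : (1 < R0)%R -> holo R0 f -> (u <= 0)%R ->
  CInt (fun t => f (expi t) * dlog t) 0 (2 * PI) = CInt (fun t => f (spiral u t) * dlog t) 0 (2 * PI).
Proof.
  intros hR hf hu. pose proof PI_RGT_0.
  pose proof (boundary_zero R0 f u hR hf hu) as h. unfold boundary in h.
  rewrite (CInt_ext (fun u0 => f (spiral u0 (2 * PI))) (fun u0 => f (spiral u0 0))) in h
    by (auto; intros; now rewrite spiral_period).
  rewrite (CInt_ext (fun t => f (spiral 0 t) * dlog t) (fun t => f (expi t) * dlog t)) in h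
    by (try lra; intros; now rewrite spiral_0).
  set (A := CInt (fun t => f (expi t) * dlog t) 0 (2 * PI)) in *.
  set (B := CInt (fun t => f (spiral u t) * dlog t) 0 (2 * PI)) in *.
  set (D := CInt (fun u0 => f (spiral u0 0)) u 0) in h.
  replace A with (D + A - D - B + B) by ring. rewrite h. ring.
Qed.

(** The integral over the contracted circle does not depend on u; as the circle shrinks to z0, f
    tends to f z0 uniformly on it. *)
Lemma circle_integral_point (R0 : R) (f : C -> C) : (1 < R0)%R -> holo R0 f ->
  CInt (fun t => f (expi t) * dlog t) 0 (2 * PI) = f z0 * CInt dlog 0 (2 * PI).
Proof.
  intros hR hf. pose proof PI_RGT_0.
  assert (hd : disk_cont f) by now apply (holo_disk_cont R0).
  assert (cd : cont_on dlog 0 (2 * PI)) by (intros t _; apply dlog_cont).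
  set (m := (/ (1 - Cmod z0))%R).
  assert (hm : (0 < m)%R) by (apply Rinv_0_lt_compat; lra).
  set (X := CInt (fun t => f (expi t) * dlog t) 0 (2 * PI)). rewrite <- CInt_scal by (auto; lra).
  set (Y := CInt (fun t => f z0 * dlog t) 0 (2 * PI)).
  assert (hc : Cmod (X - Y) = 0%R).
  { apply Rle_antisym; [| apply Cmod_ge_0]. apply Rnot_lt_le. intro hp.
    set (e := (Cmod (X - Y) / (4 * PI * m))%R).
    assert (he : (0 < e)%R) by (apply Rdiv_lt_0_compat; nra).
    destruct (hd z0 ltac:(lra) e he) as [del [hdel hs]].
    (* Points of the contracted circle are within 2 exp u of z0, which del / 3 keeps below del; the
       minimum with 0 keeps the circle in the closed unit disk. *)
    set (u := Rmin 0 (ln (del / 3))).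
    assert (hu : (u <= 0)%R) by apply Rmin_l.
    assert (heu : (exp u <= del / 3)%R).
    { rewrite <- (exp_ln (del / 3)) by lra.
      destruct (Rmin_r 0 (ln (del / 3))) as [h | h]; [left; now apply exp_increasing |].
      unfold u. rewrite h. lra. }
    assert (hX : X = CInt (fun t => f (spiral u t) * dlog t) 0 (2 * PI))
      by (apply (circle_integral_spiral R0); auto).
    assert (hb : (Cmod (X - Y) <= (2 * PI - 0) * (e * m))%R).
    { rewrite hX. unfold Y. rewrite <- CInt_minus.
      - apply CInt_mod_le_const; [lra | |].
        + apply cont_on_minus; [now apply disk_cont_t |]. apply cont_on_scal; exact cd.
        + intros t ht. replace (f (spiral u t) * dlog t - f z0 * dlog t) with ((f (spiral u t) - f z0) * dlog t) by ring.
          rewrite Cmod_mult. apply Rmult_le_compat; try apply Cmod_ge_0; [| apply dlog_mod].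
          left. apply hs. unfold spiral. replace (z0 + RtoC (exp u) * (expi t - z0) - z0) with (RtoC (exp u) * (expi t - z0)) by ring.
          rewrite Cmod_mult, Cmod_RtoC_nonneg by (left; apply exp_pos).
          assert (Cmod (expi t - z0) <= 2)%R.
          { unfold Cminus. eapply Rle_trans; [apply Cmod_triangle |]. rewrite Cmod_opp, Cmod_expi. lra. }
          pose proof (exp_pos u). pose proof (Cmod_ge_0 (expi t - z0)). nra.
      - lra.
      - now apply disk_cont_t.
      - apply cont_on_scal; exact cd. }
    replace ((2 * PI - 0) * (e * m))%R with (Cmod (X - Y) / 2)%R in hb
      by (unfold e; field; lra).
    lra. }
  apply Cmod_eq_0 in hc. replace X with (X - Y + Y) by ring. rewrite hc. ring.
Qed.

End Cauchy.

(** * The principal logarithm and the winding number of the circle *)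

Definition carg (z : C) : R := atan (Im z / Re z).

(* The principal logarithm; meaningful only on the right half-plane. *)
Definition Clog (z : C) : C := (ln (Re z ^ 2 + Im z ^ 2) / 2, carg z)%R.

Lemma is_derive_Clog (x y : R -> R) (t a b : R) : (0 < x t)%R -> is_derive x t a -> is_derive y t b ->
  is_derive (fun s => ln (x s ^ 2 + y s ^ 2) / 2)%R t ((x t * a + y t * b) / (x t ^ 2 + y t ^ 2))%R /\
  is_derive (fun s => atan (y s / x s)) t ((x t * b - y t * a) / (x t ^ 2 + y t ^ 2))%R.
Proof.
  intros hp h1 h2. assert (hn : (0 < x t ^ 2 + y t ^ 2)%R) by nra.
  assert (e1 : Derive (fun s : R => x s) t = a) by (apply is_derive_unique; exact h1).
  assert (e2 : Derive (fun s : R => y s) t = b) by (apply is_derive_unique; exact h2).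
  split; auto_derive.
  - simpl in hn. repeat split; [now exists a | now exists b | lra].
  - rewrite e1, e2. simpl in hn. field. nra.
  - repeat split; [now exists b | now exists a | lra].
  - rewrite e1, e2. field. nra.
Qed.

Lemma rder_Clog (g : R -> C) (t : R) (l : C) : (0 < Re (g t))%R -> rder g t l ->
  rder (fun s => Clog (g s)) t (l / g t).
Proof.
  intros hp hg. destruct (rder_is_derive g t l hg) as [h1 h2].
  destruct (is_derive_Clog (fun s => Re (g s)) (fun s => Im (g s)) t _ _ hp h1 h2) as [d1 d2].
  eapply rder_unique_at; [exact (is_derive_rder _ _ t _ _ d1 d2) |].
  destruct (g t) as [x y], l as [a b]. unfold Re, Im in *. simpl in *.
  apply C_eq; simpl; field; nra.
Qed.

Lemma polar_right (z : C) : (0 < Re z)%R -> z = RtoC (Cmod z) * expi (carg z).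
Proof.
  intro h. unfold carg.
  assert (hm : (0 < Cmod z)%R) by (apply Cmod_gt_0; now apply Re_pos_neq_0).
  pose proof (Cmod_sqr z) as hs.
  assert (e : sqrt (1 + (Im z / Re z)²) = (Cmod z / Re z)%R).
  { apply sqrt_lem_1.
    - pose proof (Rle_0_sqr (Im z / Re z)). lra.
    - left. now apply Rdiv_lt_0_compat.
    - unfold Rsqr. replace (Cmod z / Re z * (Cmod z / Re z))%R with (Cmod z * Cmod z / (Re z * Re z))%R by (field; lra).
      rewrite hs. field. lra. }
  apply C_eq.
  - rewrite Re_RtoC_mult. simpl. rewrite cos_atan, e. field. lra.
  - rewrite Im_RtoC_mult. simpl. rewrite sin_atan, e. field. lra.
Qed.

Lemma Re_1_minus_pos (z : C) : (Cmod z < 1)%R -> (0 < Re (1 - z))%R.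
Proof.
  intro h. pose proof (Re_le_mod z) as hr. apply Rabs_le_between in hr.
  rewrite Re_minus. simpl. unfold Re in *. lra.
Qed.

Lemma rder_const (c : C) (t : R) : rder (fun _ => c) t 0.
Proof. apply gder_const, locally_filter. Qed.

Lemma rder_plus (f g : R -> C) (t : R) (a b : C) :
  rder f t a -> rder g t b -> rder (fun s => f s + g s) t (a + b).
Proof. apply gder_plus, locally_filter. Qed.

Lemma rder_minus (f g : R -> C) (t : R) (a b : C) :
  rder f t a -> rder g t b -> rder (fun s => f s - g s) t (a - b).
Proof. apply gder_minus, locally_filter. Qed.

Lemma rder_RtoC (t : R) : rder RtoC t 1.
Proof. apply gder_incl, locally_filter. Qed.

Lemma cder_const (c z : C) : cder (fun _ => c) z 0.
Proof. apply gder_const, near_filter. Qed.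

Lemma cder_id (z : C) : cder (fun w => w) z 1.
Proof. apply gder_incl, near_filter. Qed.

Lemma cder_plus (f g : C -> C) (z a b : C) :
  cder f z a -> cder g z b -> cder (fun s => f s + g s) z (a + b).
Proof. apply gder_plus, near_filter. Qed.

Lemma cder_minus (f g : C -> C) (z a b : C) :
  cder f z a -> cder g z b -> cder (fun s => f s - g s) z (a - b).
Proof. apply gder_minus, near_filter. Qed.

Lemma cder_scal (c : C) (f : C -> C) (z a : C) : cder f z a -> cder (fun s => c * f s) z (c * a).
Proof.
  intro h. eapply cder_unique_at; [apply cder_mult; [apply cder_const | exact h] |]. simpl. ring.
Qed.

(** A primitive is it + log(1 - z0 e^(-it)). The logarithm is evaluated in the right half-plane and
    is periodic, so only it contributes. *)
Lemma dlog_integral (z0 : C) : (Cmod z0 < 1)%R -> CInt (dlog z0) 0 (2 * PI) = RtoC (2 * PI) * Ci.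
Proof.
  intro h. pose proof PI_RGT_0.
  rewrite (CInt_derive (fun t => RtoC t * Ci + Clog (1 - z0 / expi t))).
  - rewrite <- (expi_2PI 0), Rplus_0_l. ring.
  - lra.
  - intros t _. pose proof (expi_neq_0 t). pose proof (expi_minus_neq_0 z0 t h).
    assert (hq : (Cmod (z0 / expi t) < 1)%R) by (rewrite Cmod_div, Cmod_expi by auto; lra).
    pose proof (Re_1_minus_pos _ hq) as hp.
    eapply rder_unique_at.
    + apply rder_plus; [apply rder_mult; [apply rder_RtoC | apply rder_const] |].
      apply rder_Clog; [exact hp |].
      apply rder_minus; [apply rder_const |].
      apply rder_div; [auto | apply rder_const | apply rder_expi].
    + unfold dlog. simpl. apply Re_pos_neq_0 in hp. field. repeat split; auto.
  - intros t _. now apply dlog_cont.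
Qed.

(** * Cauchy and Poisson formulas as averages over the circle *)

Definition avg (f : R -> C) : C := / RtoC (2 * PI) * CInt f 0 (2 * PI).

Lemma RtoC_2PI_neq_0 : RtoC (2 * PI) <> 0.
Proof. pose proof PI_RGT_0. intro e. apply RtoC_inj in e. lra. Qed.

Theorem Cauchy_formula (R0 : R) (f : C -> C) (z : C) : (1 < R0)%R -> holo R0 f -> (Cmod z < 1)%R ->
  f z = avg (fun t => f (expi t) * (expi t / (expi t - z))).
Proof.
  intros hR hf hz. pose proof PI_RGT_0.
  pose proof (circle_integral_point z hz R0 f hR hf) as h. rewrite dlog_integral in h by exact hz.
  unfold avg.
  rewrite (CInt_ext _ (fun t => - Ci * (f (expi t) * dlog z t))).
  - rewrite CInt_scal; [| lra |].
    + rewrite h. transitivity (/ RtoC (2 * PI) * RtoC (2 * PI) * (- (Ci * Ci)) * f z); [| ring].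
      rewrite Cinv_l by apply RtoC_2PI_neq_0. replace (Ci * Ci) with (RtoC (-1)) by (apply C_eq; simpl; ring).
      rewrite <- RtoC_opp. replace (- -1)%R with 1%R by ring. ring.
    + apply cont_on_mult; [| intros t _; now apply dlog_cont].
      intros t _. apply clim_near_comp; [| apply ccont_expi].
      apply (holo_clim R0); [exact hf |]. rewrite Cmod_expi. lra.
  - lra.
  - intros t _. unfold dlog. pose proof (expi_minus_neq_0 z t hz).
    transitivity (- (Ci * Ci) * (f (expi t) * (expi t / (expi t - z)))).
    + replace (Ci * Ci) with (RtoC (-1)) by (apply C_eq; simpl; ring).
      rewrite <- RtoC_opp. replace (- -1)%R with 1%R by ring. ring.
    + field. auto.
Qed.

Notation period_cont f := (cont_on f 0 (2 * PI)).

Lemma two_PI_pos : (0 <= 2 * PI)%R.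
Proof. pose proof PI_RGT_0. lra. Qed.

Lemma avg_plus (f g : R -> C) : period_cont f -> period_cont g ->
  avg (fun t => f t + g t) = avg f + avg g.
Proof. intros hf hg. unfold avg. rewrite CInt_plus; auto using two_PI_pos. ring. Qed.

Lemma avg_minus (f g : R -> C) : period_cont f -> period_cont g ->
  avg (fun t => f t - g t) = avg f - avg g.
Proof. intros hf hg. unfold avg. rewrite CInt_minus; auto using two_PI_pos. ring. Qed.

Lemma avg_scal (c : C) (f : R -> C) : period_cont f -> avg (fun t => c * f t) = c * avg f.
Proof. intros hf. unfold avg. rewrite CInt_scal; auto using two_PI_pos. ring. Qed.

Lemma avg_ext (f g : R -> C) : (forall t, f t = g t) -> avg f = avg g.
Proof. intros h. unfold avg. f_equal. apply CInt_ext; auto using two_PI_pos. Qed.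

Lemma avg_conj (f : R -> C) : period_cont f -> avg (fun t => Cconj (f t)) = Cconj (avg f).
Proof.
  intros hf. unfold avg. rewrite CInt_conj by auto using two_PI_pos.
  rewrite Cmult_conj. f_equal. rewrite <- RtoC_inv by (pose proof PI_RGT_0; lra).
  apply C_eq; simpl; ring.
Qed.

Lemma avg_const (c : C) : avg (fun _ => c) = c.
Proof.
  unfold avg. rewrite CInt_const, Rminus_0_r, Cmult_assoc, Cinv_l by apply RtoC_2PI_neq_0. ring.
Qed.

Lemma Re_avg (f : R -> C) : Re (avg f) = (/ (2 * PI) * RInt (fun t => Re (f t)) 0 (2 * PI))%R.
Proof.
  unfold avg. rewrite <- RtoC_inv, Re_RtoC_mult by (pose proof PI_RGT_0; lra). reflexivity.
Qed.

Lemma Re_avg_le (f g : R -> C) : period_cont f -> period_cont g ->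
  (forall t, (Re (f t) <= Re (g t))%R) -> (Re (avg f) <= Re (avg g))%R.
Proof.
  intros hf hg h. rewrite !Re_avg. pose proof PI_RGT_0.
  apply Rmult_le_compat_l; [left; apply Rinv_0_lt_compat; lra |].
  apply RInt_le; [lra | now apply (cont_on_ex f 0 (2 * PI) ltac:(lra)) |
    now apply (cont_on_ex g 0 (2 * PI) ltac:(lra)) |]. intros; apply h.
Qed.

Lemma circle_cont (f : C -> C) (a b : R) : (forall z, Cmod z = 1%R -> clim (near z) f (f z)) ->
  cont_on (fun t => f (expi t)) a b.
Proof.
  intros h t _. apply clim_near_comp; [| apply ccont_expi]. apply h, Cmod_expi.
Qed.

Lemma holo_circle_cont (R0 : R) (f : C -> C) (a b : R) : (1 < R0)%R -> holo R0 f ->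
  cont_on (fun t => f (expi t)) a b.
Proof. intros h hf. apply circle_cont. intros z hz. apply (holo_clim R0); [exact hf | lra]. Qed.

Lemma holo_weaken (R0 R1 : R) (f : C -> C) : (R1 <= R0)%R -> holo R0 f -> holo R1 f.
Proof. intros h hf z hz. apply hf. lra. Qed.

Lemma holo_mult (R0 : R) (f g : C -> C) : holo R0 f -> holo R0 g -> holo R0 (fun z => f z * g z).
Proof.
  intros hf hg z hz. destruct (hf z hz) as [a ha], (hg z hz) as [b hb].
  eexists. apply cder_mult; eauto.
Qed.

Lemma holo_minus (R0 : R) (f g : C -> C) : holo R0 f -> holo R0 g -> holo R0 (fun z => f z - g z).
Proof.
  intros hf hg z hz. destruct (hf z hz) as [a ha], (hg z hz) as [b hb].
  eexists. apply cder_minus; eauto.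
Qed.

Lemma holo_div (R0 : R) (f g : C -> C) : holo R0 f -> holo R0 g ->
  (forall z, (Cmod z < R0)%R -> g z <> 0) -> holo R0 (fun z => f z / g z).
Proof.
  intros hf hg hn z hz. destruct (hf z hz) as [a ha], (hg z hz) as [b hb].
  eexists. apply cder_div; eauto.
Qed.

Lemma holo_const (R0 : R) (c : C) : holo R0 (fun _ => c).
Proof. intros z _. exists 0. apply cder_const. Qed.

Lemma holo_id (R0 : R) : holo R0 (fun z => z).
Proof. intros z _. exists 1. apply cder_id. Qed.

Lemma holo_dilate (R0 s : R) (f : C -> C) (c : C) : (0 <= s)%R -> Cmod c = s ->
  holo (s * R0) f -> holo R0 (fun z => f (c * z)).
Proof.
  intros hs hc hf z hz. destruct (Req_dec s 0) as [e | e].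
  - assert (c = 0) by (apply Cmod_eq_0; lra). subst c.
    exists 0. apply cder_ext with (fun _ => f 0); [intro w; f_equal; ring | apply cder_const].
  - destruct (hf (c * z)) as [l hl].
    + rewrite Cmod_mult, hc. apply Rmult_lt_compat_l; lra.
    + eexists. apply cder_comp; [exact hl |]. apply cder_scal, cder_id.
Qed.

Lemma Cauchy_mean (R0 : R) (f : C -> C) : (1 < R0)%R -> holo R0 f ->
  avg (fun t => f (expi t)) = f 0.
Proof.
  intros h hf. rewrite (Cauchy_formula R0 f 0 h hf) by (rewrite Cmod_0; lra).
  apply avg_ext. intro t. pose proof (expi_neq_0 t).
  replace (expi t - 0) with (expi t) by ring. field. auto.
Qed.

(** For y = conj z the kernel is the conjugate of e^(it) / (e^(it) - z). Its pole lies outside the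
    closed disk, so this is the mean value property of f(w) / (1 - y w). *)
Lemma Cauchy_conj_kernel (R0 : R) (f : C -> C) (y : C) : (1 < R0)%R -> holo R0 f -> (Cmod y < 1)%R ->
  avg (fun t => f (expi t) / (1 - y * expi t)) = f 0.
Proof.
  intros h hf hy.
  (* The radius 2 / (1 + |y|) exceeds 1, and its product with |y| is below 1. *)
  assert (hn : forall z, (Cmod z < 2 / (1 + Cmod y))%R -> 1 - y * z <> 0).
  { intros z hz. apply Re_pos_neq_0, Re_1_minus_pos. rewrite Cmod_mult.
    pose proof (Cmod_ge_0 y). pose proof (Cmod_ge_0 z).
    apply Rle_lt_trans with (Cmod y * (2 / (1 + Cmod y)))%R; [nra |].
    apply Rmult_lt_reg_r with (1 + Cmod y)%R; [lra |]. field_simplify; lra. }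
  rewrite (Cauchy_mean (Rmin R0 (2 / (1 + Cmod y))) (fun z => f z / (1 - y * z))).
  - replace (1 - y * 0) with (RtoC 1) by ring. field.
  - apply Rmin_glb_lt; [exact h |]. pose proof (Cmod_ge_0 y).
    apply Rmult_lt_reg_r with (1 + Cmod y)%R; [lra |]. field_simplify; lra.
  - apply holo_div.
    + eapply holo_weaken; [apply Rmin_l | exact hf].
    + apply holo_minus; [apply holo_const |]. apply holo_mult; [apply holo_const | apply holo_id].
    + intros z hz. apply hn. eapply Rlt_le_trans; [exact hz | apply Rmin_r].
Qed.

Lemma cont_div (f g : R -> C) (a b : R) : cont_on f a b -> cont_on g a b ->
  (forall t, g t <> 0) -> cont_on (fun t => f t / g t) a b.
Proof. intros hf hg hn t ht. apply clim_mult; [now apply hf |]. apply clim_inv; [apply hn | now apply hg]. Qed.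

Lemma expi_cont (a b : R) : cont_on expi a b.
Proof. intros t _. apply ccont_expi. Qed.

Lemma one_minus_expi_neq_0 (y : C) (t : R) : (Cmod y < 1)%R -> 1 - y * expi t <> 0.
Proof. intro h. apply Re_pos_neq_0, Re_1_minus_pos. rewrite Cmod_mult, Cmod_expi. lra. Qed.

Definition poisson (z : C) (t : R) : R := ((1 - Cmod z ^ 2) / Cmod (expi t - z) ^ 2)%R.

Lemma poisson_kernel (z : C) (t : R) : (Cmod z < 1)%R ->
  RtoC (poisson z t) = expi t / (expi t - z) + / (1 - Cconj z * expi t) - 1.
Proof.
  intro hz. pose proof (expi_minus_neq_0 z t hz) as h1. pose proof (expi_neq_0 t) as h0.
  assert (h2 : 1 - Cconj z * expi t <> 0) by (apply one_minus_expi_neq_0; now rewrite Cmod_conj).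
  unfold poisson.
  assert (hm : (0 < Cmod (expi t - z))%R) by now apply Cmod_gt_0.
  assert (e1 : RtoC (Cmod (expi t - z) ^ 2) = (expi t - z) * (1 - Cconj z * expi t) / expi t).
  { replace (Cmod (expi t - z) ^ 2)%R with (Cmod (expi t - z) * Cmod (expi t - z))%R by ring.
    rewrite <- Cconj_mult_self, Cminus_conj, <- expi_opp, <- expi_inv. field. auto. }
  assert (e2 : RtoC (1 - Cmod z ^ 2) = 1 - z * Cconj z).
  { rewrite RtoC_minus. replace (Cmod z ^ 2)%R with (Cmod z * Cmod z)%R by ring. now rewrite Cconj_mult_self. }
  rewrite RtoC_div by (pose proof (pow_lt _ 2 hm); lra).
  rewrite e1, e2. field. auto.
Qed.

Lemma poisson_cont (z : C) : (Cmod z < 1)%R -> period_cont (fun t => RtoC (poisson z t)).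
Proof.
  intros hz t ht.
  apply clim_ext with (fun t => expi t / (expi t - z) + / (1 - Cconj z * expi t) - 1).
  - intro s. now rewrite poisson_kernel.
  - rewrite poisson_kernel by exact hz.
    apply clim_minus; [| apply clim_const]. apply clim_plus.
    + apply clim_mult; [apply ccont_expi |]. apply clim_inv; [now apply expi_minus_neq_0 |].
      apply clim_minus; [apply ccont_expi | apply clim_const].
    + apply clim_inv; [apply one_minus_expi_neq_0; now rewrite Cmod_conj |].
      apply clim_minus; [apply clim_const |]. apply clim_mult; [apply clim_const | apply ccont_expi].
Qed.

(** The three terms of [poisson_kernel] contribute f z, f 0 and - f 0. *)
Lemma Poisson_formula (R0 : R) (f : C -> C) (z : C) : (1 < R0)%R -> holo R0 f -> (Cmod z < 1)%R ->
  f z = avg (fun t => RtoC (poisson z t) * f (expi t)).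
Proof.
  intros h hf hz. assert (hz' : (Cmod (Cconj z) < 1)%R) by now rewrite Cmod_conj.
  assert (cf : period_cont (fun t => f (expi t))) by now apply (holo_circle_cont R0).
  assert (c1 : period_cont (fun t => f (expi t) * (expi t / (expi t - z)))).
  { apply cont_on_mult; [exact cf |]. apply cont_div; [apply expi_cont | |].
    - apply cont_on_minus; [apply expi_cont | apply cont_on_const].
    - intro t. now apply expi_minus_neq_0. }
  assert (c2 : period_cont (fun t => f (expi t) / (1 - Cconj z * expi t))).
  { apply cont_div; [exact cf | |].
    - apply cont_on_minus; [apply cont_on_const |]. apply cont_on_mult; [apply cont_on_const | apply expi_cont].
    - intro t. now apply one_minus_expi_neq_0. }
  rewrite (avg_ext _ (fun t => f (expi t) * (expi t / (expi t - z)) + f (expi t) / (1 - Cconj z * expi t) - f (expi t))).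
  - rewrite avg_minus, avg_plus by (auto; now apply cont_on_plus).
    rewrite (Cauchy_conj_kernel R0), (Cauchy_mean R0), <- (Cauchy_formula R0) by auto. ring.
  - intro t. rewrite poisson_kernel by exact hz. unfold Cdiv. ring.
Qed.

(** The factor is a lower bound of the Poisson kernel, from |e^(it) - z| <= 1 + |z|. It also serves
    as a strict minimum principle for the real part. *)
Lemma Harnack (R0 : R) (f : C -> C) (z : C) : (1 < R0)%R -> holo R0 f -> (Cmod z < 1)%R ->
  (forall t, (0 <= Re (f (expi t)))%R) ->
  (0 <= Re (f 0))%R /\ ((1 - Cmod z) / (1 + Cmod z) * Re (f 0) <= Re (f z))%R.
Proof.
  intros h hf hz hp.
  assert (cf : period_cont (fun t => f (expi t))) by now apply (holo_circle_cont R0).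
  split.
  - rewrite <- (Cauchy_mean R0 f h hf). change 0%R with (Re 0). rewrite <- (avg_const 0).
    apply Re_avg_le; [apply cont_on_const | exact cf | exact hp].
  - rewrite (Poisson_formula R0 f z h hf hz), <- (Cauchy_mean R0 f h hf), <- Re_RtoC_mult, <- avg_scal by exact cf.
    apply Re_avg_le.
    + apply cont_on_scal; exact cf.
    + apply cont_on_mult; [now apply poisson_cont | exact cf].
    + intro t. rewrite !Re_RtoC_mult. apply Rmult_le_compat_r; [apply hp |].
      unfold poisson. pose proof (Cmod_ge_0 z). pose proof (expi_minus_mod z t).
      assert (Cmod (expi t - z) <= 1 + Cmod z)%R.
      { unfold Cminus. eapply Rle_trans; [apply Cmod_triangle |]. rewrite Cmod_opp, Cmod_expi. lra. }
      set (m := Cmod (expi t - z)) in *. set (r := Cmod z) in *.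
      apply Rmult_le_reg_r with ((1 + r) * m ^ 2)%R; [nra |].
      replace ((1 - r) / (1 + r) * ((1 + r) * m ^ 2))%R with ((1 - r) * m ^ 2)%R by (field; lra).
      replace ((1 - r ^ 2) / m ^ 2 * ((1 + r) * m ^ 2))%R with ((1 - r) * (1 + r) ^ 2)%R by (field; lra).
      apply Rmult_le_compat_l; [lra |]. apply pow_incr. lra.
Qed.

(** Harnack for M - k f, where the unimodular k makes k f z equal to |f z|. *)
Lemma max_modulus (R0 : R) (f : C -> C) (z : C) (M : R) : (1 < R0)%R -> holo R0 f -> (Cmod z < 1)%R ->
  (forall t, (Cmod (f (expi t)) <= M)%R) -> (Cmod (f z) <= M)%R.
Proof.
  intros h hf hz hM.
  destruct (unimodular_rotation (f z)) as [k [hk hI]].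
  destruct (Harnack R0 (fun w => RtoC M - k * f w) z h) as [p1 p2].
  - apply holo_minus; [apply holo_const |]. apply holo_mult; [apply holo_const | exact hf].
  - exact hz.
  - intro t. rewrite Re_minus. simpl (Re (RtoC M)).
    pose proof (Re_le_mod (k * f (expi t))) as hr. rewrite Cmod_mult, hk, Rmult_1_l in hr.
    apply Rabs_le_between in hr. specialize (hM t). lra.
  - rewrite hI in p2. change ((1 - Cmod z) / (1 + Cmod z) * Re (RtoC M - k * f 0) <= M - Cmod (f z))%R in p2.
    assert (0 <= (1 - Cmod z) / (1 + Cmod z) * Re (RtoC M - k * f 0))%R.
    { apply Rmult_le_pos; [| exact p1]. pose proof (Cmod_ge_0 z). apply Rlt_le, Rdiv_lt_0_compat; lra. }
    lra.
Qed.

Lemma ccont_Cmod (f : R -> C) (t : R) : ccont f t -> continuous (fun s => Cmod (f s)) t.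
Proof.
  intro h. apply filterlim_locally. intro e. generalize (h e (cond_pos e)). apply filter_imp.
  intros s hs. change (Rabs (Cmod (f s) - Cmod (f t)) < e)%R.
  pose proof (Cmod_minus_triangle (f s) (f t)). pose proof (Cmod_minus_triangle (f t) (f s)).
  rewrite Cmod_minus_sym in H0. apply Rabs_def1; lra.
Qed.

Lemma avg_mod_le (f : R -> C) (g : R -> R) : period_cont f -> ex_RInt g 0 (2 * PI) ->
  (forall t, (Cmod (f t) <= g t)%R) -> (Cmod (avg f) <= / (2 * PI) * RInt g 0 (2 * PI))%R.
Proof.
  intros hf hg h. pose proof PI_RGT_0. unfold avg.
  rewrite Cmod_mult, Cmod_inv, Cmod_RtoC_nonneg by (lra || apply RtoC_2PI_neq_0).
  apply Rmult_le_compat_l; [left; apply Rinv_0_lt_compat; lra |].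
  apply CInt_mod_le; auto; lra.
Qed.

(** Differentiation under the integral sign: a quadratic remainder with an integrable coefficient
    [b] makes the error of the average quadratic too. *)
Lemma cder_avg (k : C -> R -> C) (k' : R -> C) (b : R -> R) (z : C) (d : R) : (0 < d)%R ->
  (forall w, (Cmod (w - z) < d)%R -> period_cont (k w)) -> period_cont k' ->
  ex_RInt b 0 (2 * PI) ->
  (forall w t, (Cmod (w - z) < d)%R ->
    (Cmod (k w t - k z t - k' t * (w - z)) <= b t * Cmod (w - z) ^ 2)%R) ->
  cder (fun w => avg (k w)) z (avg k').
Proof.
  intros hd hk hk' hb h. apply cder_of_eps. intros e he.
  set (B := (/ (2 * PI) * RInt b 0 (2 * PI))%R).
  assert (hz : (Cmod (z - z) < d)%R) by (now rewrite Cminus_self, Cmod_0).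
  pose proof PI_RGT_0.
  set (d' := Rmin d (e / (Rabs B + 1))).
  exists d'. split.
  { apply Rmin_pos; [exact hd |]. apply Rdiv_lt_0_compat; [exact he |]. pose proof (Rabs_pos B). lra. }
  intros w hw.
  assert (h1 : (Cmod (w - z) < d)%R) by (eapply Rlt_le_trans; [exact hw | apply Rmin_l]).
  assert (h2 : (Cmod (w - z) <= e / (Rabs B + 1))%R) by (left; eapply Rlt_le_trans; [exact hw | apply Rmin_r]).
  set (m := Cmod (w - z)) in *.
  assert (hm : (0 <= m)%R) by apply Cmod_ge_0.
  replace (avg (k w) - avg (k z) - avg k' * (w - z)) with (avg (fun t => k w t - k z t - k' t * (w - z))).
  - apply Rle_trans with (B * m ^ 2)%R.
    + assert (eB : (B * m ^ 2 = / (2 * PI) * RInt (fun t => (m ^ 2) * b t) 0 (2 * PI))%R).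
      { pose proof (is_RInt_unique _ _ _ _ (is_RInt_scal (V := R_NormedModule) b 0 (2 * PI) (m ^ 2) _
          (RInt_correct (V := R_CompleteNormedModule) b 0 (2 * PI) hb))) as hs.
        unfold scal in hs. simpl in hs. unfold mult in hs. simpl in hs. simpl. rewrite hs. unfold B. ring. }
      rewrite eB. apply avg_mod_le.
      * apply cont_on_minus; [now apply cont_on_minus; apply hk |].
        apply cont_on_mult; [exact hk' | apply cont_on_const].
      * apply (ex_RInt_scal (V := R_NormedModule) b 0 (2 * PI) (m ^ 2) hb).
      * intro t. rewrite Rmult_comm. now apply h.
    + assert (B * m <= e)%R.
      { apply Rle_trans with (Rabs B * (e / (Rabs B + 1)))%R.
        - apply Rle_trans with (Rabs B * m)%R.
          + apply Rmult_le_compat_r; [exact hm | apply Rle_abs].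
          + apply Rmult_le_compat_l; [apply Rabs_pos | exact h2].
        - pose proof (Rabs_pos B). apply Rmult_le_reg_r with (Rabs B + 1)%R; [lra |].
          field_simplify; lra || nra. }
      replace (B * m ^ 2)%R with (B * m * m)%R by ring. now apply Rmult_le_compat_r.
  - rewrite (avg_ext _ (fun t => k w t - k z t - (w - z) * k' t)) by (intro; ring).
    rewrite !avg_minus, avg_scal; auto; [ring | apply cont_on_minus; auto |].
    apply cont_on_mult; [apply cont_on_const | exact hk'].
Qed.

(** * Cauchy transforms: derivatives and division by z *)

Section CauchyTransform.

Variable u : R -> C.
Hypothesis hu : period_cont u.

Lemma kernel_cont (w : C) (n : nat) : (Cmod w < 1)%R -> period_cont (fun t => u t / (expi t - w) ^ n).
Proof.
  intro hw. apply cont_div; [exact hu | |].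
  - induction n; simpl; [apply cont_on_const |].
    apply cont_on_mult; [| exact IHn]. apply cont_on_minus; [apply expi_cont | apply cont_on_const].
  - intro t. induction n; simpl; [apply C1_nz |]. apply Cmult_neq_0; [now apply expi_minus_neq_0 | exact IHn].
Qed.

Lemma u_mod_int (c : R) : ex_RInt (fun t => (c * Cmod (u t))%R) 0 (2 * PI).
Proof.
  apply (ex_RInt_scal (V := R_NormedModule) (fun t => Cmod (u t))).
  apply (ex_RInt_continuous (V := R_CompleteNormedModule)). intros t ht.
  rewrite Rmin_left, Rmax_right in ht by apply two_PI_pos.
  apply ccont_Cmod. now apply hu.
Qed.

Lemma close_in_disk (z w : C) (t : R) : (Cmod (w - z) < (1 - Cmod z) / 2)%R ->
  (Cmod w < 1)%R /\ ((1 - Cmod z) / 2 <= Cmod (expi t - w))%R.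
Proof.
  intro h. pose proof (Cmod_minus_triangle w z). pose proof (Cmod_ge_0 (w - z)).
  pose proof (expi_minus_mod w t). split; lra.
Qed.

Lemma Cauchy_transform_cder (z : C) : (Cmod z < 1)%R ->
  cder (fun w => avg (fun t => u t / (expi t - w) ^ 1)) z (avg (fun t => u t / (expi t - z) ^ 2)).
Proof.
  intro hz. set (d := ((1 - Cmod z) / 2)%R). assert (hd : (0 < d)%R) by (unfold d; lra).
  apply cder_avg with (fun t => / (d ^ 3) * Cmod (u t))%R d; auto.
  - intros w hw. apply kernel_cont. now apply (close_in_disk z w 0).
  - now apply kernel_cont.
  - apply u_mod_int.
  - intros w t hw. destruct (close_in_disk z w t hw) as [h1 h2]. fold d in h2.
    pose proof (expi_minus_mod z t) as h3.
    pose proof (expi_minus_neq_0 z t hz). pose proof (expi_minus_neq_0 w t h1).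
    replace (u t / (expi t - w) ^ 1 - u t / (expi t - z) ^ 1 - u t / (expi t - z) ^ 2 * (w - z))
      with (u t * ((w - z) * (w - z)) / ((expi t - z) * (expi t - z) * (expi t - w))) by (simpl; field; auto).
    rewrite Cmod_div, !Cmod_mult by (repeat apply Cmult_neq_0; auto).
    set (m := Cmod (w - z)) in *. set (a := Cmod (expi t - z)) in *. set (b := Cmod (expi t - w)) in *.
    unfold Rdiv. replace (/ d ^ 3 * Cmod (u t) * m ^ 2)%R with (Cmod (u t) * (m * m) * / d ^ 3)%R by ring.
    apply Rmult_le_compat_l.
    + apply Rmult_le_pos; [apply Cmod_ge_0 | pose proof (Cmod_ge_0 (w - z)); unfold m; nra].
    + assert (d <= a)%R by (unfold d in *; lra).
      apply Rinv_le_contravar; [apply pow_lt; exact hd |].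
      replace (d ^ 3)%R with (d * d * d)%R by ring.
      apply Rmult_le_compat; nra.
Qed.

Lemma Cauchy_transform_cder2 (z : C) : (Cmod z < 1)%R ->
  cder (fun w => avg (fun t => u t / (expi t - w) ^ 2)) z (avg (fun t => 2 * u t / (expi t - z) ^ 3)).
Proof.
  intro hz. set (d := ((1 - Cmod z) / 2)%R). assert (hd : (0 < d)%R) by (unfold d; lra).
  apply cder_avg with (fun t => 8 / (d ^ 5) * Cmod (u t))%R d; auto.
  - intros w hw. apply kernel_cont. now apply (close_in_disk z w 0).
  - intros t ht. apply clim_ext with (fun t => 2 * (u t / (expi t - z) ^ 3)); [intro; unfold Cdiv; ring |].
    replace (2 * u t / (expi t - z) ^ 3) with (2 * (u t / (expi t - z) ^ 3)) by (unfold Cdiv; ring).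
    apply clim_mult; [apply clim_const | now apply kernel_cont].
  - apply u_mod_int.
  - intros w t hw. destruct (close_in_disk z w t hw) as [h1 h2]. fold d in h2.
    pose proof (expi_minus_mod z t) as h3.
    pose proof (expi_minus_neq_0 z t hz). pose proof (expi_minus_neq_0 w t h1).
    replace (u t / (expi t - w) ^ 2 - u t / (expi t - z) ^ 2 - 2 * u t / (expi t - z) ^ 3 * (w - z))
      with (u t * ((w - z) * (w - z)) * ((expi t - z) + 2 * (expi t - w)) / ((expi t - z) * (expi t - z) * (expi t - z) * ((expi t - w) * (expi t - w)))) by (simpl; field; auto).
    rewrite Cmod_div, !Cmod_mult by (repeat apply Cmult_neq_0; auto).
    assert (hb : (Cmod (expi t - z + 2 * (expi t - w)) <= 8)%R).
    { assert (hq : forall v, (Cmod v < 1)%R -> (Cmod (expi t - v) <= 2)%R).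
      { intros v hv. unfold Cminus. eapply Rle_trans; [apply Cmod_triangle |]. rewrite Cmod_opp, Cmod_expi. lra. }
      eapply Rle_trans; [apply Cmod_triangle |]. rewrite Cmod_mult, Cmod_RtoC_nonneg by lra.
      pose proof (hq z hz). pose proof (hq w h1). lra. }
    set (q := Cmod (expi t - z + 2 * (expi t - w))) in *.
    set (m := Cmod (w - z)) in *. set (a := Cmod (expi t - z)) in *. set (b := Cmod (expi t - w)) in *.
    unfold Rdiv. replace (8 * / d ^ 5 * Cmod (u t) * m ^ 2)%R with (Cmod (u t) * (m * m) * 8 * / d ^ 5)%R by ring.
    assert (0 <= Cmod (u t) * (m * m))%R.
    { apply Rmult_le_pos; [apply Cmod_ge_0 | pose proof (Cmod_ge_0 (w - z)); unfold m; nra]. }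
    assert (0 <= q)%R by apply Cmod_ge_0.
    assert (d <= a)%R by (unfold d in *; lra).
    assert (hp : (d ^ 5 <= a * a * a * (b * b))%R).
    { replace (d ^ 5)%R with (d * d * d * (d * d))%R by ring.
      assert (d * d <= a * a)%R by nra. assert (d * d <= b * b)%R by nra.
      assert (d * d * d <= a * a * a)%R by nra. apply Rmult_le_compat; nra. }
    assert (0 < d ^ 5)%R by now apply pow_lt.
    apply Rmult_le_compat; [nra | left; apply Rinv_0_lt_compat; lra | nra |].
    now apply Rinv_le_contravar.
Qed.

End CauchyTransform.

Lemma near_disk (z : C) (r : R) (P : C -> Prop) : (Cmod z < r)%R ->
  (forall w, (Cmod w < r)%R -> P w) -> near z P.
Proof.
  intros h hP. exists (r - Cmod z)%R. split; [lra |]. intros w hw. apply hP.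
  pose proof (Cmod_minus_triangle w z). lra.
Qed.

Lemma holo_C_derive (R0 : R) (f : C -> C) (z : C) : holo R0 f -> (Cmod z < R0)%R -> cder f z (C_derive f z).
Proof. intros hf hz. destruct (hf z hz) as [l hl]. now rewrite (cder_C_derive f z l hl). Qed.

(** By the Cauchy formula f is the Cauchy transform of f(e^(it)) e^(it), so near z its derivative is
    the transform with squared kernel, which is differentiable again. *)
Lemma C_derive_holo_1 (R0 : R) (f : C -> C) (z : C) : (1 < R0)%R -> holo R0 f -> (Cmod z < 1)%R ->
  exists l, cder (C_derive f) z l.
Proof.
  intros h hf hz. set (u := fun t => f (expi t) * expi t).
  assert (hu : period_cont u) by (apply cont_on_mult; [now apply (holo_circle_cont R0) | apply expi_cont]).
  eexists. eapply cder_ext_loc; [| exact (Cauchy_transform_cder2 u hu z hz)].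
  apply (near_disk z 1); [exact hz |]. intros w hw. symmetry. apply cder_C_derive.
  eapply cder_ext_loc; [| exact (Cauchy_transform_cder u hu w hw)].
  apply (near_disk w 1); [exact hw |]. intros v hv.
  rewrite (Cauchy_formula R0 f v) by auto. apply avg_ext. intro t.
  pose proof (expi_minus_neq_0 v t hv). unfold u. simpl. field. auto.
Qed.

(* [z] times the Cauchy transform recovers [f], because [f] has mean value 0. *)
Lemma holo_divide_id_1 (R0 : R) (f : C -> C) : (1 < R0)%R -> holo R0 f -> f 0 = 0 ->
  exists h, holo 1 h /\ forall z, (Cmod z < 1)%R -> f z = z * h z.
Proof.
  intros h hf h0. set (u := fun t => f (expi t)).
  assert (hu : period_cont u) by now apply (holo_circle_cont R0).
  exists (fun w => avg (fun t => u t / (expi t - w) ^ 1)). split.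
  - intros z hz. eexists. now apply Cauchy_transform_cder.
  - intros z hz. rewrite (Cauchy_formula R0 f z) by auto.
    rewrite <- avg_scal by now apply kernel_cont.
    assert (e : avg u = 0) by (unfold u; rewrite (Cauchy_mean R0); auto).
    transitivity (avg (fun t => f (expi t) * (expi t / (expi t - z))) - avg u); [rewrite e; ring |].
    rewrite <- avg_minus; [| | exact hu].
    + apply avg_ext. intro t. pose proof (expi_minus_neq_0 z t hz). unfold u. simpl. field. auto.
    + apply cont_on_mult; [exact hu |]. apply cont_div; [apply expi_cont | |].
      * apply cont_on_minus; [apply expi_cont | apply cont_on_const].
      * intro t. now apply expi_minus_neq_0.
Qed.

(** The interval of positivity is taken to the right of t0, so t0 may be the left endpoint; this
    fits the range 0 <= t < 2 PI of [unit_expi]. *)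
Lemma RInt_pos (f : R -> R) (a b t0 : R) : (a <= t0 < b)%R -> (forall t, (a <= t <= b)%R -> continuous f t) ->
  (forall t, (a <= t <= b)%R -> (0 <= f t)%R) -> (0 < f t0)%R -> (0 < RInt f a b)%R.
Proof.
  intros ht hc hp h0.
  assert (h0' : (0 < f t0 / 2)%R) by lra.
  assert (ht0 : (a <= t0 <= b)%R) by lra.
  destruct (proj1 (filterlim_locally _ _) (hc t0 ht0) (mkposreal _ h0')) as [d hd].
  set (e := Rmin (d / 2) (b - t0)).
  assert (he : (0 < e)%R) by (apply Rmin_pos; [pose proof (cond_pos d) |]; lra).
  assert (he1 : (e <= d / 2)%R) by apply Rmin_l. assert (he2 : (e <= b - t0)%R) by apply Rmin_r.
  assert (hex : forall x y, (a <= x)%R -> (x <= y)%R -> (y <= b)%R -> ex_RInt f x y).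
  { intros x y h1 h2 h3. apply (ex_RInt_continuous (V := R_CompleteNormedModule)).
    intros t htt. rewrite Rmin_left, Rmax_right in htt by exact h2. apply hc. lra. }
  assert (i1 : (0 <= RInt f a t0)%R) by (apply RInt_ge_0; [lra | apply hex; lra |]; intros; apply hp; lra).
  assert (i3 : (0 <= RInt f (t0 + e) b)%R) by (apply RInt_ge_0; [lra | apply hex; lra |]; intros; apply hp; lra).
  assert (i2 : (e * (f t0 / 2) <= RInt f t0 (t0 + e))%R).
  { replace (e * (f t0 / 2))%R with (RInt (fun _ => f t0 / 2)%R t0 (t0 + e)).
    - apply RInt_le; [lra | apply ex_RInt_const | apply hex; lra |]. intros t htt.
      pose proof (cond_pos d).
      assert (hb : ball t0 d t) by (change (Rabs (t - t0) < d)%R; rewrite Rabs_pos_eq; lra).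
      specialize (hd t hb). change (Rabs (f t - f t0) < f t0 / 2)%R in hd. apply Rabs_def2 in hd. lra.
    - rewrite RInt_const. unfold scal. simpl. unfold mult. simpl. ring. }
  rewrite <- (RInt_Chasles (V := R_CompleteNormedModule) f a t0 b) by (apply hex; lra).
  rewrite <- (RInt_Chasles (V := R_CompleteNormedModule) f t0 (t0 + e) b) by (apply hex; lra).
  unfold plus. simpl. nra.
Qed.

Lemma cont_on_bounded (f : R -> C) (a b : R) : (a <= b)%R -> cont_on f a b ->
  exists M, (0 <= M)%R /\ forall t, (a <= t <= b)%R -> (Cmod (f t) <= M)%R.
Proof.
  intros hab hf. destruct (continuity_ab_maj (fun t => Cmod (f t)) a b hab) as [m [hm _]].
  - intros t ht. apply continuity_pt_filterlim. now apply ccont_Cmod, hf.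
  - exists (Cmod (f m)). split; [apply Cmod_ge_0 | exact hm].
Qed.

(** * Interchange of the radial and the circular integral *)

Section Duality.

Variable q : R.
Hypothesis hq : (0 < q < 1)%R.

(** The functional P -> integral of G(t) P(qt), evaluated at the kernel z -> 1 / (1 - y z). *)
Definition kint (G : R -> C) (y : C) : C := CInt (fun t => G t / (1 - y * RtoC (q * t))) 0 1.

Lemma denom_bound (y : C) (t : R) : (Cmod y <= 1)%R -> (0 <= t <= 1)%R ->
  (1 - q <= Cmod (1 - y * RtoC (q * t)))%R.
Proof.
  intros hy ht. pose proof (Cmod_minus_triangle 1 (y * RtoC (q * t))) as h.
  rewrite Cmod_1, Cmod_mult, Cmod_RtoC_nonneg in h by nra.
  pose proof (Cmod_ge_0 y).
  assert (Cmod y * (q * t) <= 1 * (q * 1))%R by (apply Rmult_le_compat; nra). lra.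
Qed.

Lemma denom_neq_0 (y : C) (t : R) : (Cmod y <= 1)%R -> (0 <= t <= 1)%R -> 1 - y * RtoC (q * t) <> 0.
Proof. intros hy ht e. pose proof (denom_bound y t hy ht). rewrite e, Cmod_0 in H. lra. Qed.

Lemma qt_cont (t : R) : ccont (fun t => RtoC (q * t)) t.
Proof.
  apply continuous_RtoC. apply (continuous_scal_r (V := R_NormedModule) q (fun t => t)), continuous_id.
Qed.

Lemma denom_cont (y : C) (t : R) : ccont (fun t => 1 - y * RtoC (q * t)) t.
Proof. apply clim_minus; [apply clim_const |]. apply clim_mult; [apply clim_const | apply qt_cont]. Qed.

Lemma kint_cont (G : R -> C) (y : C) : (Cmod y <= 1)%R -> cont_on G 0 1 ->
  cont_on (fun t => G t / (1 - y * RtoC (q * t))) 0 1.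
Proof.
  intros hy hG t ht. apply clim_mult; [now apply hG |]. apply clim_inv; [now apply denom_neq_0 |].
  apply denom_cont.
Qed.

Lemma kint_lip (G : R -> C) : cont_on G 0 1 -> exists K, (0 < K)%R /\ forall y z,
  (Cmod y <= 1)%R -> (Cmod z <= 1)%R -> (Cmod (kint G y - kint G z) <= K * Cmod (y - z))%R.
Proof.
  intros hG. destruct (cont_on_bounded G 0 1 ltac:(lra) hG) as [M [hM hb]].
  exists ((M + 1) / (1 - q) ^ 2)%R. split.
  { apply Rdiv_lt_0_compat; [lra |]. apply pow_lt. lra. }
  intros y z hy hz. unfold kint.
  rewrite <- CInt_minus by (try lra; now apply kint_cont).
  rewrite <- (Rmult_1_l (_ * _)). replace 1%R with (1 - 0)%R at 2 by ring.
  apply CInt_mod_le_const; [lra | apply cont_on_minus; now apply kint_cont |].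
  intros t ht. pose proof (denom_neq_0 y t hy ht). pose proof (denom_neq_0 z t hz ht).
  pose proof (denom_bound y t hy ht) as b1. pose proof (denom_bound z t hz ht) as b2.
  replace (G t / (1 - y * RtoC (q * t)) - G t / (1 - z * RtoC (q * t))) with
    (G t * RtoC (q * t) * (y - z) / ((1 - y * RtoC (q * t)) * (1 - z * RtoC (q * t)))) by (field; auto).
  rewrite Cmod_div, !Cmod_mult, Cmod_RtoC_nonneg by (try nra; now apply Cmult_neq_0).
  set (a := Cmod (1 - y * RtoC (q * t))) in *. set (b := Cmod (1 - z * RtoC (q * t))) in *.
  pose proof (Cmod_ge_0 (y - z)). pose proof (Cmod_ge_0 (G t)). specialize (hb t ht).
  unfold Rdiv. replace ((M + 1) * / (1 - q) ^ 2 * Cmod (y - z))%R with ((M + 1) * 1 * Cmod (y - z) * / (1 - q) ^ 2)%R by ring.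
  assert (hqt : (0 <= q * t <= 1)%R) by nra.
  assert (0 < (1 - q) ^ 2)%R by (apply pow_lt; lra).
  apply Rmult_le_compat.
  - repeat apply Rmult_le_pos; lra.
  - left. apply Rinv_0_lt_compat. nra.
  - apply Rmult_le_compat_r; [lra |]. apply Rmult_le_compat; lra.
  - apply Rinv_le_contravar; [assumption |]. simpl. nra.
Qed.

Lemma Cmod_conj_expi (t : R) : Cmod (Cconj (expi t)) = 1%R.
Proof. now rewrite Cmod_conj, Cmod_expi. Qed.

Lemma kint_circle_cont (G : R -> C) (t : R) : cont_on G 0 1 -> ccont (fun s => kint G (Cconj (expi s))) t.
Proof.
  intros hG e he. destruct (kint_lip G hG) as [K [hK hl]].
  assert (he' : (0 < e / K)%R) by now apply Rdiv_lt_0_compat.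
  generalize (clim_conj _ _ (ccont_expi t) _ he'). apply filter_imp. intros s hs.
  eapply Rle_lt_trans; [apply hl; rewrite Cmod_conj_expi; lra |].
  apply Rmult_lt_reg_r with (/ K)%R; [now apply Rinv_0_lt_compat |].
  rewrite (Rmult_comm K), Rmult_assoc, Rinv_r, Rmult_1_r by lra. exact hs.
Qed.

(** The Cauchy integral of the boundary data v at the point qt, since 1 - conj(e^(is)) qt = (e^(is)
    - qt) / e^(is). *)
Definition kavg (v : R -> C) (t : R) : C := avg (fun s => v s / (1 - Cconj (expi s) * RtoC (q * t))).

Lemma kavg_integrand_cont (v : R -> C) (t : R) : period_cont v -> (0 <= t <= 1)%R ->
  period_cont (fun s => v s / (1 - Cconj (expi s) * RtoC (q * t))).
Proof.
  intros hv ht s hs. apply clim_mult; [now apply hv |]. apply clim_inv.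
  - apply denom_neq_0; [rewrite Cmod_conj_expi; lra | exact ht].
  - apply clim_minus; [apply clim_const |]. apply clim_mult; [| apply clim_const].
    apply clim_conj. apply ccont_expi.
Qed.

Lemma qt_disk (t : R) : (0 <= t <= 1)%R -> (Cmod (RtoC (q * t)) < 1)%R.
Proof. intro h. rewrite Cmod_RtoC_nonneg; nra. Qed.

Lemma conj_kernel (s t : R) : (Cmod (RtoC (q * t)) < 1)%R ->
  / (1 - Cconj (expi s) * RtoC (q * t)) = expi s / (expi s - RtoC (q * t)).
Proof.
  intro hc.
  pose proof (expi_minus_neq_0 _ s hc). pose proof (expi_neq_0 s).
  rewrite <- expi_opp, <- expi_inv.
  replace (1 - / expi s * RtoC (q * t)) with ((expi s - RtoC (q * t)) / expi s) by (field; auto).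
  field. auto.
Qed.

Lemma kavg_transform (v : R -> C) (t : R) : (Cmod (RtoC (q * t)) < 1)%R ->
  kavg v t = avg (fun s => v s * expi s / (expi s - RtoC (q * t)) ^ 1).
Proof.
  intro hc. apply avg_ext. intro s. unfold Cdiv at 1. rewrite conj_kernel by exact hc.
  pose proof (expi_minus_neq_0 _ s hc). simpl. field. auto.
Qed.

Lemma kavg_cont (v : R -> C) : period_cont v -> cont_on (kavg v) 0 1.
Proof.
  intros hv t ht.
  set (u := fun s => v s * expi s).
  assert (hu : period_cont u) by (apply cont_on_mult; [exact hv | apply expi_cont]).
  assert (hcont : ccont (fun t => avg (fun s => u s / (expi s - RtoC (q * t)) ^ 1)) t).
  { apply (clim_near_comp (fun w => avg (fun s => u s / (expi s - w) ^ 1)) (fun t => RtoC (q * t))); [| apply qt_cont].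
    eapply cder_near. apply Cauchy_transform_cder; [exact hu | now apply qt_disk]. }
  unfold ccont. rewrite (kavg_transform v t) by now apply qt_disk.
  eapply clim_ext_loc; [| exact hcont].
  assert (hd : (0 < 1 - q)%R) by lra.
  exists (mkposreal _ hd). intros s hs. change (Rabs (s - t) < 1 - q)%R in hs.
  symmetry. apply kavg_transform. rewrite Cmod_R. apply Rabs_def2 in hs. apply Rabs_def1; nra.
Qed.

(** The difference of the two iterated integrals of G(t) v(s) / (1 - e^(-is) qt). *)
Definition swap_defect (G v : R -> C) : C :=
  CInt (fun t => G t * kavg v t) 0 1 - avg (fun s => v s * kint G (Cconj (expi s))).

(** In 1/(1 - w) = 1 + w/(1 - w) with w = e^(-is) qt, the term 1 gives the same product of integrals
    in either order. The rest is q times the same kernel for t G(t) and e^(-is) v(s). *)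
Lemma swap_defect_shift (G v : R -> C) : cont_on G 0 1 -> period_cont v ->
  swap_defect G v = RtoC q * swap_defect (fun t => G t * RtoC t) (fun s => v s * Cconj (expi s)).
Proof.
  intros hG hv. unfold swap_defect.
  assert (ht : cont_on RtoC 0 1) by (intros t _; apply clim_RtoC).
  assert (hc : period_cont (fun s => Cconj (expi s))) by (apply cont_on_conj, expi_cont).
  assert (hv' : period_cont (fun s => v s * Cconj (expi s))) by now apply cont_on_mult.
  assert (hG' : cont_on (fun t => G t * RtoC t) 0 1) by now apply cont_on_mult.
  assert (e1 : forall t, (0 <= t <= 1)%R -> kavg v t = avg v + RtoC q * RtoC t * kavg (fun s => v s * Cconj (expi s)) t).
  { intros t h. unfold kavg. pose proof (kavg_integrand_cont _ t hv' h) as c3.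
    rewrite <- avg_scal by exact c3.
    rewrite <- avg_plus by (exact hv || (apply cont_on_scal; exact c3)).
    apply avg_ext. intro s. rewrite RtoC_mult.
    assert (h1 : (Cmod (Cconj (expi s)) <= 1)%R) by (rewrite Cmod_conj_expi; lra).
    pose proof (denom_neq_0 _ t h1 h) as h2. rewrite RtoC_mult in h2. field. exact h2. }
  assert (e2 : forall y, (Cmod y <= 1)%R -> kint G y = CInt G 0 1 + RtoC q * y * kint (fun t => G t * RtoC t) y).
  { intros y hy. unfold kint. pose proof (kint_cont _ y hy hG') as c3.
    rewrite <- CInt_scal by (lra || exact c3).
    rewrite <- CInt_plus by (lra || exact hG || (apply cont_on_scal; exact c3)).
    apply CInt_ext; [lra |]. intros t h. pose proof (denom_neq_0 y t hy h) as h2. rewrite RtoC_mult in *. field. exact h2. }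
  rewrite (CInt_ext (fun t => G t * kavg v t) (fun t => avg v * G t + RtoC q * (G t * RtoC t * kavg (fun s => v s * Cconj (expi s)) t)))
    by (try lra; intros t h; rewrite e1 by exact h; ring).
  rewrite (avg_ext (fun s => v s * kint G (Cconj (expi s))) (fun s => CInt G 0 1 * v s + RtoC q * (v s * Cconj (expi s) * kint (fun t => G t * RtoC t) (Cconj (expi s)))))
    by (intro s; rewrite e2 by (rewrite Cmod_conj_expi; lra); ring).
  assert (c1 : cont_on (fun t => G t * RtoC t * kavg (fun s => v s * Cconj (expi s)) t) 0 1)
    by (apply cont_on_mult; [exact hG' | now apply kavg_cont]).
  assert (c2 : period_cont (fun s => v s * Cconj (expi s) * kint (fun t => G t * RtoC t) (Cconj (expi s))))
    by (apply cont_on_mult; [exact hv' | intros s _; now apply kint_circle_cont]).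
  assert (c4 : cont_on (fun t => avg v * G t) 0 1) by now apply cont_on_scal.
  assert (c5 : period_cont (fun s => CInt G 0 1 * v s)) by now apply cont_on_scal.
  rewrite CInt_plus, avg_plus, !CInt_scal, !avg_scal
    by (lra || assumption || (apply cont_on_scal; assumption)).
  ring.
Qed.

(** Each shift gains a factor q and keeps the bounds M and K, because |t| <= 1 and |e^(-is)| = 1.
    The base case bounds each iterated integral by M K / (1 - q). *)
Lemma swap_defect_bound (M K : R) (n : nat) : (0 <= M)%R -> (0 <= K)%R -> forall G v, cont_on G 0 1 -> period_cont v ->
  (forall t, (0 <= t <= 1)%R -> (Cmod (G t) <= M)%R) -> (forall s, (0 <= s <= 2 * PI)%R -> (Cmod (v s) <= K)%R) ->
  (Cmod (swap_defect G v) <= q ^ n * (2 * (M * K / (1 - q))))%R.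
Proof.
  intros hM hK. pose proof PI_RGT_0. induction n; intros G v hG hv bG bv.
  - simpl. rewrite Rmult_1_l. unfold swap_defect.
    assert (b1 : (Cmod (CInt (fun t => G t * kavg v t)%C 0 1) <= (1 - 0) * (M * (K / (1 - q))))%R).
    { apply CInt_mod_le_const; [lra | apply cont_on_mult; [exact hG | now apply kavg_cont] |].
      intros t ht. rewrite Cmod_mult. apply Rmult_le_compat; try apply Cmod_ge_0; [now apply bG |].
      unfold kavg, avg. rewrite Cmod_mult, Cmod_inv, Cmod_RtoC_nonneg by (lra || apply RtoC_2PI_neq_0).
      apply Rmult_le_reg_l with (2 * PI)%R; [lra |]. rewrite <- Rmult_assoc, Rinv_r, Rmult_1_l by lra.
      replace (2 * PI)%R with (2 * PI - 0)%R at 2 by ring.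
      apply CInt_mod_le_const; [lra | now apply kavg_integrand_cont |].
      intros s hs. assert (h1 : (Cmod (Cconj (expi s)) <= 1)%R) by (rewrite Cmod_conj_expi; lra).
      pose proof (denom_neq_0 _ t h1 ht). pose proof (denom_bound _ t h1 ht).
      rewrite Cmod_div by auto. apply Rmult_le_compat; [apply Cmod_ge_0 | left; apply Rinv_0_lt_compat; lra | now apply bv |].
      apply Rinv_le_contravar; lra. }
    assert (b2 : (Cmod (avg (fun s => v s * kint G (Cconj (expi s)))%C) <= K * (M / (1 - q)))%R).
    { unfold avg. rewrite Cmod_mult, Cmod_inv, Cmod_RtoC_nonneg by (lra || apply RtoC_2PI_neq_0).
      apply Rmult_le_reg_l with (2 * PI)%R; [lra |]. rewrite <- Rmult_assoc, Rinv_r, Rmult_1_l by lra.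
      replace (2 * PI)%R with (2 * PI - 0)%R at 2 by ring.
      apply CInt_mod_le_const; [lra | apply cont_on_mult; [exact hv | intros s _; now apply kint_circle_cont] |].
      intros s hs. rewrite Cmod_mult. apply Rmult_le_compat; try apply Cmod_ge_0; [now apply bv |].
      unfold kint. rewrite <- (Rmult_1_l (M / _)). replace 1%R with (1 - 0)%R at 2 by ring.
      assert (h1 : (Cmod (Cconj (expi s)) <= 1)%R) by (rewrite Cmod_conj_expi; lra).
      apply CInt_mod_le_const; [lra | now apply kint_cont |].
      intros t ht. pose proof (denom_neq_0 _ t h1 ht). pose proof (denom_bound _ t h1 ht).
      rewrite Cmod_div by auto. apply Rmult_le_compat; [apply Cmod_ge_0 | left; apply Rinv_0_lt_compat; lra | now apply bG |].
      apply Rinv_le_contravar; lra. }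
    unfold Cminus. eapply Rle_trans; [apply Cmod_triangle |]. rewrite Cmod_opp.
    replace (2 * (M * K / (1 - q)))%R with ((1 - 0) * (M * (K / (1 - q))) + K * (M / (1 - q)))%R by (field; lra).
    now apply Rplus_le_compat.
  - rewrite swap_defect_shift, Cmod_mult, Cmod_RtoC_nonneg by (auto; lra).
    simpl. rewrite Rmult_assoc. apply Rmult_le_compat_l; [lra |].
    apply IHn.
    + apply cont_on_mult; [exact hG | intros t _; apply clim_RtoC].
    + apply cont_on_mult; [exact hv | apply cont_on_conj, expi_cont].
    + intros t ht. rewrite Cmod_mult, Cmod_RtoC_nonneg by lra. specialize (bG t ht).
      pose proof (Cmod_ge_0 (G t)). nra.
    + intros s hs. rewrite Cmod_mult, Cmod_conj_expi, Rmult_1_r. now apply bv.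
Qed.

Lemma swap_integrals (G v : R -> C) : cont_on G 0 1 -> period_cont v ->
  CInt (fun t => G t * kavg v t) 0 1 = avg (fun s => v s * kint G (Cconj (expi s))).
Proof.
  intros hG hv.
  destruct (cont_on_bounded G 0 1 ltac:(lra) hG) as [M [hM bG]].
  destruct (cont_on_bounded v 0 (2 * PI) two_PI_pos hv) as [K [hK bv]].
  assert (h0 : Cmod (swap_defect G v) = 0%R).
  { apply Rle_antisym; [| apply Cmod_ge_0]. apply Rnot_lt_le. intro hp.
    set (B := (2 * (M * K / (1 - q)))%R).
    assert (hB : (0 <= B)%R).
    { unfold B. apply Rmult_le_pos; [lra |]. apply Rmult_le_pos; [nra | left; apply Rinv_0_lt_compat; lra]. }
    assert (he : (0 < Cmod (swap_defect G v) / (B + 1))%R) by (apply Rdiv_lt_0_compat; lra).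
    assert (hq1 : (Rabs q < 1)%R) by (rewrite Rabs_pos_eq; lra).
    destruct (pow_lt_1_zero q hq1 _ he) as [n hn].
    specialize (hn n ltac:(lia)).
    pose proof (swap_defect_bound M K n hM hK G v hG hv bG bv) as hb. fold B in hb.
    assert (hqn : (0 <= q ^ n)%R) by (apply pow_le; lra).
    rewrite Rabs_pos_eq in hn by exact hqn.
    assert (q ^ n * (B + 1) < Cmod (swap_defect G v))%R.
    { apply Rmult_lt_reg_r with (/ (B + 1))%R; [apply Rinv_0_lt_compat; lra |].
      rewrite Rmult_assoc, Rinv_r, Rmult_1_r by lra. exact hn. }
    nra. }
  apply Cmod_eq_0 in h0. unfold swap_defect in h0.
  set (A := CInt _ 0 1) in *. set (A' := avg _) in *.
  replace A with (A - A' + A') by ring. rewrite h0. ring.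
Qed.

End Duality.

Lemma sign_on_interval (w : R -> R) (a b c : R) : (forall t, continuous w t) ->
  (forall t, (a < t < b)%R -> w t <> 0%R) -> (a < c < b)%R -> (0 < w c)%R ->
  forall t, (a < t < b)%R -> (0 < w t)%R.
Proof.
  intros hc hn hcc h0 t ht. destruct (Rlt_le_dec 0 (w t)) as [h | h]; [exact h |].
  assert (hb : (w t < 0)%R) by (pose proof (hn t ht); lra). exfalso.
  assert (hcont : Ranalysis1.continuity w) by (intro s; apply continuity_pt_filterlim, hc).
  destruct (Rtotal_order c t) as [hab | [-> | hab]]; [| lra |].
  - destruct (Rsqrt_def.IVT (fun s => - w s)%R c t) as [z [hz1 hz]]; try lra.
    + intro s. apply Ranalysis1.continuity_pt_opp, hcont.
    + apply (hn z); lra.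
  - destruct (Rsqrt_def.IVT w t c hcont hab hb h0) as [z [hz1 hz]]. apply (hn z); lra.
Qed.

Lemma IVT_sign (w : R -> R) : (forall t, continuous w t) -> (forall t, w t <> 0%R) ->
  forall a b, (0 < w a)%R -> (0 < w b)%R.
Proof.
  intros hc hn a b ha. pose proof (Rmin_l a b). pose proof (Rmin_r a b). pose proof (Rmax_l a b). pose proof (Rmax_r a b).
  apply (sign_on_interval w (Rmin a b - 1) (Rmax a b + 1) a hc); [intros; apply hn | lra | exact ha | lra].
Qed.

(** * The duality principle *)

Section DualityPrinciple.

Variable q : R.
Hypothesis hq : (0 < q < 1)%R.
Variable G : R -> C.
Hypothesis hG : cont_on G 0 1.
Variable c : C.

Definition pairing (P : C -> C) : C := CInt (fun t => G t * P (RtoC (q * t))) 0 1 - c * P 0.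

(** The value of [pairing] at z -> 1 / (1 - y z). *)
Definition transform (y : C) : C := kint q G y - c.

Hypothesis test : forall x y : C, Cmod x = 1%R -> Cmod y = 1%R ->
  CInt (fun t => G t * ((1 - x * RtoC (q * t)) / (1 - y * RtoC (q * t)))) 0 1 <> c.

Lemma transform_0 : transform 0 = CInt G 0 1 - c.
Proof.
  unfold transform, kint. f_equal. apply CInt_ext; [lra |]. intros t _.
  replace (1 - 0 * RtoC (q * t)) with (RtoC 1) by ring. field.
Qed.

Lemma transform_0_neq_0 : transform 0 <> 0.
Proof.
  intro e. rewrite transform_0 in e. apply (test 1 1 Cmod_1 Cmod_1).
  rewrite (CInt_ext _ G); [replace c with (c + 0) by ring; rewrite <- e; ring | lra |].
  intros t ht. assert (h1 : (Cmod 1 <= 1)%R) by (rewrite Cmod_1; lra).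
  unfold Cdiv. rewrite Cinv_r by now apply (denom_neq_0 q hq 1 t). ring.
Qed.

(** (1 - xyz)/(1 - yz) = x + (1 - x)/(1 - yz), so the left side is [pairing] of this quotient, that
    is, [test] for the unimodular pair xy, y. *)
Lemma transform_test (x y : C) : Cmod x = 1%R -> Cmod y = 1%R ->
  transform y + x * (transform 0 - transform y) <> 0.
Proof.
  intros hx hy e.
  assert (hy1 : (Cmod y <= 1)%R) by lra.
  apply (test (x * y) y); [rewrite Cmod_mult; nra | exact hy |].
  pose proof (kint_cont q hq G y hy1 hG) as ck.
  rewrite (CInt_ext _ (fun t => x * G t + (1 - x) * (G t / (1 - y * RtoC (q * t))))).
  - rewrite CInt_plus, !CInt_scal by (lra || assumption || (apply cont_on_scal; assumption)).
    rewrite transform_0 in e. unfold transform, kint in e.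
    set (A := CInt G 0 1) in *.
    set (B := CInt (fun t => G t / (1 - y * RtoC (q * t))) 0 1) in *.
    replace (x * A + (1 - x) * B) with (B - c + x * (A - c - (B - c)) + c) by ring.
    rewrite e. ring.
  - lra.
  - intros t ht. pose proof (denom_neq_0 q hq y t hy1 ht). field. auto.
Qed.

(** The real density that represents [pairing], divided by [transform 0], as an average over the
    circle. Adding the conjugate of the ratio and subtracting 1 makes the density real without
    changing averages against analytic functions. *)
Definition weight (t : R) : R := (2 * Re (transform (Cconj (expi t)) / transform 0) - 1)%R.

Lemma transform_circle_cont (t : R) : ccont (fun s => transform (Cconj (expi s))) t.
Proof. apply clim_minus; [now apply kint_circle_cont | apply clim_const]. Qed.

Lemma ratio_circle_cont (t : R) : ccont (fun s => transform (Cconj (expi s)) / transform 0) t.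
Proof. apply clim_mult; [apply transform_circle_cont | apply clim_const]. Qed.

Lemma weight_cont (t : R) : continuous weight t.
Proof.
  unfold weight. apply (continuous_minus (V := R_NormedModule)); [| apply continuous_const].
  apply (continuous_scal_r (V := R_NormedModule) 2%R (fun t => Re (transform (Cconj (expi t)) / transform 0))).
  exact (ccont_Re _ _ (ratio_circle_cont t)).
Qed.

(** A zero means that the ratio r has real part 1/2, that is, |r| = |1 - r|; then - r / (1 - r) is
    unimodular and violates [transform_test]. *)
Lemma weight_neq_0 (t : R) : weight t <> 0%R.
Proof.
  intro e. unfold weight in e. set (r := transform (Cconj (expi t)) / transform 0) in *.
  assert (hr : Re r = (1 / 2)%R) by lra.
  assert (h1 : 1 - r <> 0). { apply Re_pos_neq_0. rewrite Re_minus, hr. simpl. lra. }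
  assert (hm : Cmod (1 - r) = Cmod r).
  { assert (Cmod (1 - r) * Cmod (1 - r) = Cmod r * Cmod r)%R.
    { rewrite !Cmod_sqr, Re_minus, Im_minus, hr. simpl. lra. }
    pose proof (Cmod_ge_0 (1 - r)). pose proof (Cmod_ge_0 r). nra. }
  assert (hm0 : (0 < Cmod (1 - r))%R) by now apply Cmod_gt_0.
  pose proof transform_0_neq_0 as h0.
  apply (transform_test (- r / (1 - r)) (Cconj (expi t))).
  - rewrite Cmod_div, Cmod_opp, hm by exact h1. field. lra.
  - apply Cmod_conj_expi.
  - assert (er : transform (Cconj (expi t)) = r * transform 0) by (unfold r; field; exact h0).
    rewrite er. field. exact h1.
Qed.

Lemma weight_ratio (t : R) : RtoC (weight t) =
  transform (Cconj (expi t)) / transform 0 + Cconj (transform (Cconj (expi t)) / transform 0) - 1.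
Proof. unfold weight. apply C_eq; simpl; unfold Re, Im; simpl; ring. Qed.

(** The ratio in the weight yields pairing P / transform 0, its conjugate yields P 0, and the
    constant takes P 0 away again. *)
Lemma pairing_average (R0 : R) (P : C -> C) : (1 < R0)%R -> holo R0 P ->
  pairing P = transform 0 * avg (fun t => RtoC (weight t) * P (expi t)).
Proof.
  intros hR hP. pose proof transform_0_neq_0 as h0.
  assert (cP : period_cont (fun t => P (expi t))) by now apply (holo_circle_cont R0).
  assert (cT : period_cont (fun t => transform (Cconj (expi t)))) by (intros t _; apply transform_circle_cont).
  assert (ck : period_cont (fun s => kint q G (Cconj (expi s)))) by (intros s _; now apply kint_circle_cont).
  assert (swap : forall v, period_cont v -> avg (fun t => v t * transform (Cconj (expi t))) =
     CInt (fun t => G t * kavg q v t) 0 1 - c * avg v).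
  { intros v hv. rewrite (swap_integrals q hq) by auto.
    rewrite <- avg_scal by exact hv. rewrite <- avg_minus.
    - apply avg_ext. intro t. unfold transform. ring.
    - now apply cont_on_mult.
    - apply cont_on_scal; exact hv. }
  assert (e1 : avg (fun t => P (expi t) * transform (Cconj (expi t))) = pairing P).
  { rewrite swap by exact cP. unfold pairing. rewrite (Cauchy_mean R0 P hR hP). f_equal.
    apply CInt_ext; [lra |]. intros t ht. f_equal.
    pose proof (qt_disk q hq t ht) as hqt.
    rewrite (Cauchy_formula R0 P _ hR hP hqt). apply avg_ext. intro s.
    unfold Cdiv at 1. now rewrite (conj_kernel q s t hqt). }
  (* After conjugation the boundary data is conj P, whose Cauchy integral at every point of the disk
     is the constant conj(P 0); only its value at 0 survives. *)
  assert (e2 : avg (fun t => P (expi t) * Cconj (transform (Cconj (expi t)))) = P 0 * Cconj (transform 0)).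
  { rewrite (avg_ext _ (fun t => Cconj (Cconj (P (expi t)) * transform (Cconj (expi t)))))
      by (intro t; rewrite Cmult_conj, Cconj_conj; reflexivity).
    assert (cc : period_cont (fun t => Cconj (P (expi t)))) by now apply cont_on_conj.
    rewrite avg_conj by now apply cont_on_mult.
    rewrite swap by exact cc. rewrite avg_conj, (Cauchy_mean R0 P hR hP) by exact cP.
    rewrite (CInt_ext _ (fun t => Cconj (P 0) * G t)).
    - rewrite CInt_scal by (lra || exact hG). rewrite transform_0.
      rewrite <- (Cconj_conj (P 0)) at 3. rewrite <- Cmult_conj. f_equal. ring.
    - lra.
    - intros t ht. rewrite Cmult_comm. f_equal. unfold kavg.
      pose proof (qt_disk q hq t ht) as hqt.
      rewrite <- (Cauchy_conj_kernel R0 P (RtoC (q * t)) hR hP hqt), <- avg_conj.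
      + apply avg_ext. intro s. pose proof (one_minus_expi_neq_0 _ s hqt) as hn.
        unfold Cdiv. rewrite Cmult_conj, Cinv_conj, Cminus_conj, Cmult_conj by exact hn.
        rewrite (Cmult_comm (Cconj (RtoC _))).
        now rewrite !Cconj_RtoC.
      + apply cont_div; [exact cP | |].
        * apply cont_on_minus; [apply cont_on_const |]. apply cont_on_mult; [apply cont_on_const | apply expi_cont].
        * intro s. now apply one_minus_expi_neq_0. }
  rewrite (avg_ext _ (fun t => / transform 0 * (P (expi t) * transform (Cconj (expi t)))
      + / Cconj (transform 0) * (P (expi t) * Cconj (transform (Cconj (expi t)))) - P (expi t))).
  - assert (h0' : Cconj (transform 0) <> 0).
    { intro e. apply h0. rewrite <- (Cconj_conj (transform 0)), e. apply C_eq; simpl; ring. }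
    assert (c1 : period_cont (fun t => P (expi t) * transform (Cconj (expi t)))) by now apply cont_on_mult.
    assert (c2 : period_cont (fun t => P (expi t) * Cconj (transform (Cconj (expi t)))))
      by (apply cont_on_mult; [exact cP | now apply cont_on_conj]).
    assert (c3 : period_cont (fun t => / transform 0 * (P (expi t) * transform (Cconj (expi t)))))
      by now apply cont_on_scal.
    assert (c4 : period_cont (fun t => / Cconj (transform 0) * (P (expi t) * Cconj (transform (Cconj (expi t))))))
      by now apply cont_on_scal.
    rewrite avg_minus, avg_plus, !avg_scal by (assumption || now apply cont_on_plus).
    rewrite e1, e2, (Cauchy_mean R0 P hR hP). field. auto.
  - intro t. rewrite weight_ratio. unfold Cdiv. rewrite Cmult_conj, Cinv_conj by exact h0. ring.
Qed.

(** A continuous function without zeros has one sign, and its mean is 1, as [pairing_average] shows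
    for the constant function 1. *)
Lemma weight_pos (t : R) : (0 < weight t)%R.
Proof.
  destruct (classic (exists s, (0 < weight s)%R)) as [[s hs] | hn].
  - exact (IVT_sign weight weight_cont weight_neq_0 s t hs).
  - exfalso.
    assert (hR : (1 < 2)%R) by lra.
    pose proof (pairing_average 2 (fun _ => 1) hR (holo_const 2 1)) as e.
    assert (ep : pairing (fun _ => 1) = transform 0).
    { rewrite transform_0. unfold pairing. rewrite (CInt_ext _ G) by (try lra; intros; ring). ring. }
    rewrite ep in e.
    assert (ea : avg (fun t => RtoC (weight t) * 1) = 1).
    { pose proof transform_0_neq_0 as h0.
      set (A := avg _) in *. replace A with (transform 0 * A / transform 0) by (field; exact h0).
      rewrite <- e. field. exact h0. }
    assert (hle : (Re (avg (fun t => RtoC (weight t) * 1)%C) <= Re (avg (fun _ => 0)))%R).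
    { apply Re_avg_le.
      - apply cont_on_mult; [| apply cont_on_const]. intros s _. apply continuous_RtoC, weight_cont.
      - apply cont_on_const.
      - intro s. rewrite Re_RtoC_mult. simpl. apply Rnot_lt_le. intro h. apply hn. exists s. lra. }
    rewrite ea, avg_const in hle. simpl in hle. lra.
Qed.

(** A positive density averages k P to a number of positive real part. Strictness is asked at one
    point only, since the P of the convex curve has zeros on the circle. *)
Theorem duality_principle (R0 : R) (P : C -> C) (k : C) (t0 : R) : (1 < R0)%R -> holo R0 P ->
  (forall t, (0 <= Re (k * P (expi t)))%R) -> (0 < Re (k * P (expi t0)))%R -> pairing P <> 0.
Proof.
  intros hR hP hk h0 e. pose proof transform_0_neq_0 as hT.
  rewrite (pairing_average R0 P hR hP) in e.
  assert (cP : period_cont (fun t => P (expi t))) by now apply (holo_circle_cont R0).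
  assert (cw : forall a b, cont_on (fun t => RtoC (weight t)) a b) by (intros a b s _; apply continuous_RtoC, weight_cont).
  assert (ea : avg (fun t => RtoC (weight t) * P (expi t)) = 0).
  { set (A := avg _) in *. replace A with (transform 0 * A / transform 0) by (field; exact hT). rewrite e. field. exact hT. }
  assert (er : Re (avg (fun t => RtoC (weight t) * (k * P (expi t)))%C) = 0%R).
  { rewrite (avg_ext _ (fun t => k * (RtoC (weight t) * P (expi t)))) by (intro; ring).
    rewrite avg_scal, ea by now apply cont_on_mult. replace (k * 0) with (RtoC 0) by ring. reflexivity. }
  rewrite Re_avg in er. pose proof PI_RGT_0.
  destruct (unit_expi (expi t0) (Cmod_expi t0)) as [s [hs es]]. rewrite es in h0.
  assert (hpos : (0 < RInt (fun t => Re (RtoC (weight t) * (k * P (expi t)))%C) 0 (2 * PI))%R).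
  { apply RInt_pos with s; [exact hs | | |].
    - intros t ht. apply ccont_Re.
      apply (cont_on_mult (fun t => RtoC (weight t)) (fun t => k * P (expi t)) 0 (2 * PI)); [apply cw | | exact ht].
      apply cont_on_scal; exact cP.
    - intros t _. rewrite Re_RtoC_mult. pose proof (weight_pos t). pose proof (hk t). nra.
    - rewrite Re_RtoC_mult. pose proof (weight_pos s). nra. }
  assert (0 < / (2 * PI))%R by (apply Rinv_0_lt_compat; lra). nra.
Qed.

End DualityPrinciple.

(** * The convex kernel curve *)

Lemma derive_pos_increasing (f df : R -> R) : (forall t, is_derive f t (df t)) -> (forall t, (0 < df t)%R) ->
  forall a b, (a < b)%R -> (f a < f b)%R.
Proof.
  intros hf hp a b hab.
  destruct (MVT_cor2 f df a b hab) as [c [e _]].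
  - intros c _. now apply is_derive_Reals.
  - pose proof (hp c). nra.
Qed.

(* A closed curve whose tangent direction turns monotonically, once per period,
   lies strictly to the left of each of its tangents. *)
Lemma turning_curve_support (h T : R -> C) (rho alpha dalpha : R -> R) (k : C) :
  (forall t, rder h t (T t)) -> (forall t, T t = k * RtoC (rho t) * expi (alpha t)) ->
  k <> 0 -> (forall t, (0 < rho t)%R) ->
  (forall t, is_derive alpha t (dalpha t)) -> (forall t, (0 < dalpha t)%R) ->
  (forall t, alpha (t + 2 * PI) = alpha t + 2 * PI)%R -> (forall t, h (t + 2 * PI)%R = h t) ->
  forall a b, (a < b < a + 2 * PI)%R -> (0 < Im ((h b - h a) / T a))%R.
Proof.
  intros hh hT hk hr ha hda pa ph a b hab.
  assert (inc := derive_pos_increasing alpha dalpha ha hda).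
  assert (hTa : T a <> 0).
  { rewrite hT. apply Cmult_neq_0; [apply Cmult_neq_0; [exact hk |] | apply expi_neq_0].
    intro e. apply RtoC_inj in e. pose proof (hr a). lra. }
  set (K := fun t => Im ((h t - h a) / T a)).
  set (dK := fun t => (rho t / rho a * sin (alpha t - alpha a))%R).
  assert (hK : forall t, derivable_pt_lim K t (dK t)).
  { intro t. apply is_derive_Reals.
    assert (hd : rder (fun t => (h t - h a) / T a) t (T t / T a)).
    { eapply rder_unique_at.
      - apply rder_div; [exact hTa | | apply rder_const].
        apply rder_minus; [apply hh | apply rder_const].
      - simpl. field. exact hTa. }
    destruct (rder_is_derive _ _ _ hd) as [_ h2].
    replace (dK t) with (Im (T t / T a)); [exact h2 |].
    replace (T t / T a) with (RtoC (rho t / rho a) * expi (alpha t - alpha a)).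
    - rewrite Im_RtoC_mult. reflexivity.
    - unfold Rminus. rewrite (expi_plus (alpha t)), <- expi_inv.
      pose proof (hr a) as ra. rewrite RtoC_div by lra. rewrite !hT.
      field. repeat split; [apply expi_neq_0 | intro e; apply RtoC_inj in e; lra | exact hk]. }
  assert (Ka : K a = 0%R) by (unfold K, Cdiv; rewrite Cminus_self, Cmult_0_l; reflexivity).
  assert (Kb : K (a + 2 * PI)%R = 0%R) by (unfold K, Cdiv; rewrite ph, Cminus_self, Cmult_0_l; reflexivity).
  pose proof PI_RGT_0.
  assert (hpos : forall t, (0 < rho t / rho a)%R) by (intro t; apply Rdiv_lt_0_compat; apply hr).
  change (0 < K b)%R.
  (* The height K over the tangent at a has slope of the sign of sin(alpha t - alpha a). If the
     tangent has turned by at most PI at b, K increases on [a, b]; otherwise it decreases on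
     [b, a + 2 PI] to its final value 0. *)
  destruct (Rle_lt_dec (alpha b) (alpha a + PI)) as [hb | hb].
  - destruct (MVT_cor2 K dK a b) as [c [e hc]]; [lra | intros c _; apply hK |].
    assert (0 < dK c)%R.
    { apply Rmult_lt_0_compat; [apply hpos |]. apply sin_gt_0.
      - pose proof (inc a c). lra.
      - pose proof (inc c b). lra. }
    nra.
  - destruct (MVT_cor2 K dK b (a + 2 * PI)) as [c [e hc]]; [lra | intros c _; apply hK |].
    assert (dK c < 0)%R.
    { assert (sin (alpha c - alpha a) < 0)%R.
      { apply sin_lt_0.
        - pose proof (inc b c). lra.
        - pose proof (inc c (a + 2 * PI)%R). rewrite pa in H0. lra. }
      unfold dK. pose proof (hpos c). nra. }
    nra.
Qed.

Lemma unit_inv (y : C) : Cmod y = 1%R -> / y = Cconj y.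
Proof. intro h. destruct (unit_expi y h) as [t [_ ->]]. now rewrite expi_inv, expi_opp. Qed.

Lemma unit_neq_0 (y : C) : Cmod y = 1%R -> y <> 0.
Proof. intros h e. rewrite e, Cmod_0 in h. lra. Qed.

Lemma Cconj_Cinv (y : C) : Cmod y = 1%R -> Cconj y = / y.
Proof. intro. symmetry. now apply unit_inv. Qed.

Lemma conj_eq_real (k : C) : Cconj k = k -> k = RtoC (Re k).
Proof. intro h. destruct k as [x y]. injection h as h. apply C_eq; simpl; [reflexivity | lra]. Qed.

Lemma Cdiv_conj (a b : C) : b <> 0 -> Cconj (a / b) = Cconj a / Cconj b.
Proof. intro h. unfold Cdiv. now rewrite Cmult_conj, Cinv_conj. Qed.

Lemma Cminus_neq_0 (a b : C) : a <> b -> a - b <> 0.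
Proof. intros h e. apply h. replace a with (a - b + b) by ring. rewrite e. ring. Qed.

Lemma Cinv_neq_0 (a : C) : a <> 0 -> / a <> 0.
Proof.
  intros h e. apply C1_nz. rewrite <- (Cinv_r a h), e. ring.
Qed.

Section ThreePoints.

Variable q : R.
Hypothesis hq : (0 < q < 1)%R.
Variable phi : C.
Hypothesis excluded : forall s : C, (Cmod (s - 1) <= q)%R ->
  (Cmod (1 - s) < Cmod (2 * phi * s ^ 2 - 1 - s))%R.

Lemma phi_neq_1 : phi - 1 <> 0.
Proof.
  intro e. assert (e1 : phi = 1) by (replace phi with (phi - 1 + 1) by ring; rewrite e; ring).
  pose proof (excluded 1) as h. rewrite e1 in h.
  replace (2 * 1 * 1 ^ 2 - 1 - 1) with (RtoC 0) in h by ring.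
  rewrite Cminus_self, Cmod_0 in h. lra.
Qed.

(** Its inverse is the zero of H': [dHc_factor] writes H' as (phi - 1)(1 - [vphi] y)/(1 - qy). *)
Definition vphi : C := phi * RtoC q / (phi - 1).

(** Otherwise s = 1 / phi, which corresponds to the zero of H', would satisfy |s - 1| <= q; but
    there 2 phi s^2 - 1 - s = -(1 - s), so [excluded] fails. *)
Lemma vphi_mod : (Cmod vphi < 1)%R.
Proof.
  pose proof phi_neq_1 as h1. assert (hm : (0 < Cmod (phi - 1))%R) by now apply Cmod_gt_0.
  unfold vphi. rewrite Cmod_div, Cmod_mult, Cmod_RtoC_nonneg by (lra || auto).
  apply Rmult_lt_reg_r with (Cmod (phi - 1)); [exact hm |].
  unfold Rdiv. rewrite Rmult_assoc, Rinv_l, Rmult_1_r, Rmult_1_l by lra.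
  destruct (classic (phi = 0)) as [e | hp].
  { rewrite e, Cmod_0 at 1. lra. }
  apply Rnot_le_lt. intro hle.
  assert (hpm : (0 < Cmod phi)%R) by now apply Cmod_gt_0.
  assert (hs : (Cmod (/ phi - 1) <= q)%R).
  { replace (/ phi - 1) with (- (phi - 1) / phi) by (field; auto).
    rewrite Cmod_div, Cmod_opp by auto. apply Rmult_le_reg_r with (Cmod phi); [exact hpm |].
    unfold Rdiv. rewrite Rmult_assoc, Rinv_l, Rmult_1_r by lra. lra. }
  pose proof (excluded _ hs) as h.
  replace (2 * phi * (/ phi) ^ 2 - 1 - / phi) with (- (1 - / phi)) in h by (field; auto).
  rewrite Cmod_opp in h. lra.
Qed.

Definition Hc (y : C) : C := phi * y + Clog (1 - RtoC q * y) / RtoC q.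
Definition dHc (y : C) : C := phi - / (1 - RtoC q * y).

Lemma q_neq_0 : RtoC q <> 0.
Proof. intro e. apply RtoC_inj in e. lra. Qed.

Lemma one_minus_q_pos (y : C) : Cmod y = 1%R -> (0 < Re (1 - RtoC q * y))%R.
Proof. intro h. apply Re_1_minus_pos. rewrite Cmod_mult, h, Cmod_RtoC_nonneg; lra. Qed.

Lemma one_minus_v_pos (y : C) : Cmod y = 1%R -> (0 < Re (1 - vphi * y))%R.
Proof. intro h. apply Re_1_minus_pos. rewrite Cmod_mult, h. pose proof vphi_mod. lra. Qed.

Lemma dHc_factor (y : C) : Cmod y = 1%R -> dHc y = (phi - 1) * (1 - vphi * y) / (1 - RtoC q * y).
Proof.
  intro h. pose proof phi_neq_1. pose proof (Re_pos_neq_0 _ (one_minus_q_pos y h)).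
  unfold dHc, vphi. field. auto.
Qed.

Lemma dHc_neq_0 (y : C) : Cmod y = 1%R -> dHc y <> 0.
Proof.
  intro h. rewrite dHc_factor by exact h. pose proof phi_neq_1.
  pose proof (Re_pos_neq_0 _ (one_minus_q_pos y h)). pose proof (Re_pos_neq_0 _ (one_minus_v_pos y h)).
  unfold Cdiv. repeat apply Cmult_neq_0; auto. now apply Cinv_neq_0.
Qed.

Lemma rder_circle (c : C) (t : R) : rder (fun t => 1 - c * expi t) t (- (c * (Ci * expi t))).
Proof.
  eapply rder_unique_at.
  - apply rder_minus; [apply rder_const |]. apply rder_mult; [apply rder_const | apply rder_expi].
  - simpl. ring.
Qed.

(* [1 + y H''(y) / H'(y) = (phi s^2 - 1) / (phi s^2 - s)] with [s = 1 - q y]. *)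
Lemma curvature_pos (y : C) : Cmod y = 1%R ->
  (0 < Re (1 - vphi * y / (1 - vphi * y) + RtoC q * y / (1 - RtoC q * y)))%R.
Proof.
  intro h. pose proof phi_neq_1 as h1.
  pose proof (Re_pos_neq_0 _ (one_minus_q_pos y h)) as h2. pose proof (Re_pos_neq_0 _ (one_minus_v_pos y h)) as h3.
  set (s := 1 - RtoC q * y) in *.
  assert (hs : (Cmod (s - 1) <= q)%R).
  { unfold s. replace (1 - RtoC q * y - 1) with (- (RtoC q * y)) by ring.
    rewrite Cmod_opp, Cmod_mult, h, Cmod_RtoC_nonneg; lra. }
  pose proof (excluded s hs) as hx.
  set (a := phi * s ^ 2 - 1). set (b := phi * s ^ 2 - s).
  assert (hv : 1 - vphi * y = (phi * s - 1) / (phi - 1)) by (unfold vphi, s; field; auto).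
  assert (hb0 : phi * s - 1 <> 0).
  { intro e. apply h3. rewrite hv, e. unfold Cdiv. ring. }
  assert (hb : b <> 0).
  { unfold b. replace (phi * s ^ 2 - s) with (s * (phi * s - 1)) by ring. now apply Cmult_neq_0. }
  replace (1 - vphi * y / (1 - vphi * y) + RtoC q * y / s) with (a / b).
  2:{ replace (vphi * y) with (1 - (1 - vphi * y)) at 1 by ring. rewrite hv.
      replace (RtoC q * y) with (1 - s) by (unfold s; ring).
      unfold a, b. replace (phi * s ^ 2 - s) with (s * (phi * s - 1)) by ring. field. auto. }
  replace (2 * phi * s ^ 2 - 1 - s) with (a + b) in hx by (unfold a, b; ring).
  replace (1 - s) with (- (a - b)) in hx by (unfold a, b; ring). rewrite Cmod_opp in hx.
  assert (hsq : (Cmod (a - b) * Cmod (a - b) < Cmod (a + b) * Cmod (a + b))%R).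
  { pose proof (Cmod_ge_0 (a - b)). nra. }
  rewrite !Cmod_sqr in hsq. pose proof (Cmod_gt_0 b) as hbm. pose proof (Cmod_sqr b) as hbs.
  assert (hbp : (0 < Re b * Re b + Im b * Im b)%R) by (rewrite <- hbs; apply hbm in hb; nra).
  assert (er : Re (a / b) = ((Re a * Re b + Im a * Im b) / (Re b * Re b + Im b * Im b))%R).
  { clearbody a b. destruct a, b. unfold Re, Im in *. simpl in *. field. lra. }
  rewrite er. apply Rdiv_lt_0_compat; [| exact hbp].
  clearbody a b. destruct a, b. unfold Re, Im in *. simpl in *. nra.
Qed.

(** The tangent is i (phi - 1) rho e^(i alpha) with alpha = t + arg(1 - v e^(it)) - arg(1 - q
    e^(it)). Both arguments come from the right half-plane, so they are periodic and alpha gains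
    exactly 2 PI per turn, while [curvature_pos] is alpha' > 0. *)
Lemma Hc_support (y z : C) : Cmod y = 1%R -> Cmod z = 1%R -> y <> z ->
  (0 < Im ((Hc z - Hc y) / (Ci * y * dHc y)))%R.
Proof.
  intros hy hz hyz.
  set (h := fun t => Hc (expi t)).
  set (T := fun t => Ci * expi t * dHc (expi t)).
  set (alpha := fun t => (t + carg (1 - vphi * expi t) - carg (1 - RtoC q * expi t))%R).
  set (dalpha := fun t => Re (1 - vphi * expi t / (1 - vphi * expi t) + RtoC q * expi t / (1 - RtoC q * expi t))).
  set (rho := fun t => (Cmod (1 - vphi * expi t) / Cmod (1 - RtoC q * expi t))%R).
  assert (pv : forall t, (0 < Re (1 - vphi * expi t))%R) by (intro; apply one_minus_v_pos, Cmod_expi).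
  assert (pq : forall t, (0 < Re (1 - RtoC q * expi t))%R) by (intro; apply one_minus_q_pos, Cmod_expi).
  assert (key : forall a b, (a < b < a + 2 * PI)%R -> (0 < Im ((h b - h a) / T a))%R).
  { apply (turning_curve_support h T rho alpha dalpha (Ci * (phi - 1))).
    - intro t. pose proof (Re_pos_neq_0 _ (pq t)). pose proof q_neq_0. unfold h, Hc, T, dHc.
      eapply rder_unique_at.
      + apply rder_plus.
        * apply rder_mult; [apply rder_const | apply rder_expi].
        * apply rder_div; [exact H0 | | apply rder_const].
          apply (rder_Clog (fun t => 1 - RtoC q * expi t)); [apply pq | apply rder_circle].
      + simpl. field. auto.
    - intro t. unfold T, rho, alpha. rewrite dHc_factor by apply Cmod_expi.
      pose proof (Re_pos_neq_0 _ (pq t)) as n1. pose proof (Re_pos_neq_0 _ (pv t)) as n2.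
      rewrite (polar_right (1 - vphi * expi t)) at 1 by apply pv.
      rewrite (polar_right (1 - RtoC q * expi t)) at 1 by apply pq.
      unfold Rminus. rewrite !(expi_plus (t + _)), (expi_plus t), <- (expi_inv (carg (1 - RtoC q * expi t))).
      assert (m1 : (0 < Cmod (1 - RtoC q * expi t))%R) by now apply Cmod_gt_0.
      rewrite RtoC_div by lra.
      field. split; [apply expi_neq_0 |]. intro e. apply RtoC_inj in e. lra.
    - apply Cmult_neq_0; [| apply phi_neq_1]. intro e. apply (f_equal snd) in e. simpl in e. lra.
    - intro t. unfold rho. apply Rdiv_lt_0_compat; apply Cmod_gt_0; apply Re_pos_neq_0; auto.
    - intro t. unfold alpha, dalpha.
      destruct (rder_is_derive _ _ _ (rder_Clog (fun t => 1 - vphi * expi t) t _ (pv t) (rder_circle _ t))) as [_ d1].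
      destruct (rder_is_derive _ _ _ (rder_Clog (fun t => 1 - RtoC q * expi t) t _ (pq t) (rder_circle _ t))) as [_ d2].
      pose proof (is_derive_minus (K := R_AbsRing) (V := R_NormedModule) _ _ _ _ _ (is_derive_plus (K := R_AbsRing) (V := R_NormedModule) _ _ _ _ _ (is_derive_id t) d1) d2) as d3.
      match type of d3 with is_derive _ _ ?l => replace (Re _) with l; [exact d3 |] end.
      unfold minus, plus, opp, one.
      pose proof (Re_pos_neq_0 _ (pq t)) as n1. pose proof (Re_pos_neq_0 _ (pv t)) as n2.
      replace (- (vphi * (Ci * expi t)) / (1 - vphi * expi t)) with (Ci * - (vphi * expi t / (1 - vphi * expi t))) by (field; auto).
      replace (- (RtoC q * (Ci * expi t)) / (1 - RtoC q * expi t)) with (Ci * - (RtoC q * expi t / (1 - RtoC q * expi t))) by (field; auto).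
      generalize (vphi * expi t / (1 - vphi * expi t)) (RtoC q * expi t / (1 - RtoC q * expi t)). intros A B.
      destruct A, B. unfold Re, Im. simpl. ring.
    - intro t. apply curvature_pos, Cmod_expi.
    - intro t. unfold alpha. rewrite expi_2PI. ring.
    - intro t. unfold h. now rewrite expi_2PI. }
  destruct (unit_expi y hy) as [a [ha ea]]. destruct (unit_expi z hz) as [b [hb eb]].
  assert (hab : a <> b) by (intro e; apply hyz; congruence).
  rewrite ea, eb. destruct (Rlt_le_dec a b).
  - apply (key a b). lra.
  - specialize (key a (b + 2 * PI)%R). unfold h in key. rewrite expi_2PI in key. apply key. lra.
Qed.

End ThreePoints.

(** * Three-point integrals avoid phi *)

Section ThreePointIntegral.

Variable q : R.
Hypothesis hq : (0 < q < 1)%R.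
Variable phi : C.
Hypothesis excluded : forall s : C, (Cmod (s - 1) <= q)%R ->
  (Cmod (1 - s) < Cmod (2 * phi * s ^ 2 - 1 - s))%R.

Notation H := (Hc q phi).
Notation dH := (dHc q phi).

Lemma Hc_injective (y z : C) : Cmod y = 1%R -> Cmod z = 1%R -> y <> z -> H y <> H z.
Proof.
  intros hy hz hn e. pose proof (Hc_support q hq phi excluded y z hy hz hn) as h.
  rewrite e, Cminus_self in h. unfold Cdiv in h. rewrite Cmult_0_l in h. simpl in h. lra.
Qed.

(** Divided by the tangent vector at y, both differences have positive imaginary part, and so has
    every nontrivial nonnegative combination. *)
Lemma Hc_not_between (y z w : C) (a b : R) : Cmod y = 1%R -> Cmod z = 1%R -> Cmod w = 1%R ->
  y <> z -> y <> w -> (0 <= a)%R -> (0 <= b)%R -> (0 < a + b)%R ->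
  RtoC a * (H z - H y) + RtoC b * (H w - H y) <> 0.
Proof.
  intros hy hz hw n1 n2 ha hb hab e.
  pose proof (Hc_support q hq phi excluded y z hy hz n1) as h1.
  pose proof (Hc_support q hq phi excluded y w hy hw n2) as h2.
  set (T := Ci * y * dHc q phi y) in *.
  assert (hs : (Im ((RtoC a * (H z - H y) + RtoC b * (H w - H y)) / T) =
     a * Im ((H z - H y) / T) + b * Im ((H w - H y) / T))%R).
  { rewrite <- !Im_RtoC_mult. unfold Cdiv. rewrite Cmult_plus_distr_r, !Cmult_assoc. reflexivity. }
  rewrite e in hs. unfold Cdiv at 1 in hs. rewrite Cmult_0_l in hs. simpl (Im 0) in hs.
  pose proof (Rmult_le_pos _ _ ha (Rlt_le _ _ h1)). pose proof (Rmult_le_pos _ _ hb (Rlt_le _ _ h2)).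
  destruct (Rle_lt_dec a 0) as [h | h].
  - assert (hb0 : (0 < b)%R) by lra. pose proof (Rmult_lt_0_compat _ _ hb0 h2). lra.
  - pose proof (Rmult_lt_0_compat _ _ h h1). lra.
Qed.

(** The position of k relative to [0, 1] decides which of three collinear points lies between the
    other two; that one contradicts [Hc_not_between]. *)
Lemma Hc_not_collinear (y1 y2 y3 : C) (k : R) : Cmod y1 = 1%R -> Cmod y2 = 1%R -> Cmod y3 = 1%R ->
  y1 <> y2 -> y1 <> y3 -> y2 <> y3 -> H y1 - H y3 <> RtoC k * (H y2 - H y3).
Proof.
  intros h1 h2 h3 n12 n13 n23 e.
  destruct (Rlt_le_dec k 0) as [hk | hk]; [| destruct (Rle_lt_dec k 1) as [hk1 | hk1]].
  - apply (Hc_not_between y3 y1 y2 1 (- k)); auto; try lra.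
    rewrite RtoC_opp. rewrite e. ring.
  - apply (Hc_not_between y1 y2 y3 k (1 - k)); auto; try lra.
    rewrite RtoC_minus. transitivity (RtoC k * (H y2 - H y3) - (H y1 - H y3)); [ring |]. rewrite e. ring.
  - apply (Hc_not_between y2 y1 y3 1 (k - 1)); auto; try lra.
    rewrite RtoC_minus. transitivity ((H y1 - H y3) - RtoC k * (H y2 - H y3)); [ring |]. rewrite e. ring.
Qed.

Lemma denom (y : C) (t : R) : Cmod y = 1%R -> (0 <= t <= 1)%R -> 1 - y * RtoC (q * t) <> 0.
Proof. intros h ht. apply (denom_neq_0 q hq); [lra | exact ht]. Qed.

Lemma rder_denom (y : C) (t : R) : rder (fun t => 1 - y * RtoC (q * t)) t (- (y * RtoC q)).
Proof.
  eapply rder_unique_at.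
  - apply rder_minus; [apply rder_const |]. apply rder_mult; [apply rder_const |].
    apply (is_derive_rder (fun t => q * t)%R (fun _ => 0%R) t q 0).
    + auto_derive; [exact I | ring].
    + apply (is_derive_const (V := R_NormedModule)).
  - simpl. change (q, 0%R) with (RtoC q). ring.
Qed.

Lemma log_integral (y : C) : Cmod y = 1%R ->
  CInt (fun t => y / (1 - y * RtoC (q * t))) 0 1 = phi * y - H y.
Proof.
  intro hy. assert (hq0 : RtoC q <> 0) by (intro e; apply RtoC_inj in e; lra).
  rewrite (CInt_derive (fun t => - Clog (1 - y * RtoC (q * t)) / RtoC q)).
  - unfold Hc. rewrite Rmult_1_r, Rmult_0_r.
    replace (1 - y * RtoC 0) with (RtoC 1) by ring.
    assert (e : Clog 1 = 0).
    { unfold Clog, carg. simpl. replace (1 * (1 * 1) + 0 * (0 * 1))%R with 1%R by ring.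
      rewrite ln_1. replace (0 / 1)%R with 0%R by field. rewrite atan_0. apply C_eq; simpl; field. }
    rewrite e, (Cmult_comm y). field. exact hq0.
  - lra.
  - intros t ht. pose proof (denom y t hy ht).
    assert (hp : (0 < Re (1 - y * RtoC (q * t)))%R).
    { apply Re_1_minus_pos. rewrite Cmod_mult, hy, Cmod_RtoC_nonneg; nra. }
    eapply rder_unique_at.
    + apply rder_div; [exact hq0 | | apply rder_const].
      eapply rder_unique_at.
      * apply (gder_opp locally RtoC). apply (rder_Clog (fun t => 1 - y * RtoC (q * t))); [exact hp | apply rder_denom].
      * reflexivity.
    + simpl. field. auto.
  - intros t ht. apply clim_mult; [apply clim_const |]. apply clim_inv; [now apply denom |]. apply denom_cont.
Qed.

Definition three_point (x y1 y2 y3 : C) : C :=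
  CInt (fun t => (1 - x * RtoC (q * t)) /
    ((1 - y1 * RtoC (q * t)) * (1 - y2 * RtoC (q * t)) * (1 - y3 * RtoC (q * t)))) 0 1.

Lemma log_cont (y : C) : Cmod y = 1%R -> cont_on (fun t => y / (1 - y * RtoC (q * t))) 0 1.
Proof.
  intros hy t ht. apply clim_mult; [apply clim_const |]. apply clim_inv; [now apply denom |]. apply denom_cont.
Qed.

Lemma cross_ratio_real (x y1 y2 y3 : C) : Cmod x = 1%R -> Cmod y1 = 1%R -> Cmod y2 = 1%R -> Cmod y3 = 1%R ->
  y1 <> x -> y2 <> y3 ->
  Cconj ((y2 - x) * (y1 - y3) / ((y1 - x) * (y2 - y3))) = (y2 - x) * (y1 - y3) / ((y1 - x) * (y2 - y3)).
Proof.
  intros hx h1 h2 h3 n1 n2.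
  pose proof (Cminus_neq_0 _ _ n1). pose proof (Cminus_neq_0 _ _ n2).
  rewrite Cdiv_conj by now apply Cmult_neq_0.
  rewrite !Cmult_conj, !Cminus_conj, !Cconj_Cinv by assumption.
  pose proof (unit_neq_0 _ hx). pose proof (unit_neq_0 _ h1). pose proof (unit_neq_0 _ h2). pose proof (unit_neq_0 _ h3).
  replace (/ y1 - / x) with (- (y1 - x) / (y1 * x)) by (field; auto).
  replace (/ y2 - / y3) with (- (y2 - y3) / (y2 * y3)) by (field; auto).
  replace (/ y2 - / x) with (- (y2 - x) / (y2 * x)) by (field; auto).
  replace (/ y1 - / y3) with (- (y1 - y3) / (y1 * y3)) by (field; auto).
  field. repeat split; auto.
Qed.

(** The kernel is the sum of B_i y_i / (1 - y_i z), and by divided differences the B_i have sum 0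
    while the B_i y_i have sum 1. Equality with phi is thus B1 (H y1 - H y3) + B2 (H y2 - H y3) = 0
    with a real cross-ratio, which is collinearity; if y1 = x, then B1 = 0 and H y2 = H y3. *)
Lemma three_point_distinct (x y1 y2 y3 : C) : Cmod x = 1%R -> Cmod y1 = 1%R -> Cmod y2 = 1%R -> Cmod y3 = 1%R ->
  y1 <> y2 -> y1 <> y3 -> y2 <> y3 -> three_point x y1 y2 y3 <> phi.
Proof.
  intros hx h1 h2 h3 n12 n13 n23 e.
  pose proof (Cminus_neq_0 _ _ n12) as d12. pose proof (Cminus_neq_0 _ _ n13) as d13. pose proof (Cminus_neq_0 _ _ n23) as d23.
  assert (d21 : y2 - y1 <> 0) by (apply Cminus_neq_0; auto).
  assert (d31 : y3 - y1 <> 0) by (apply Cminus_neq_0; auto).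
  assert (d32 : y3 - y2 <> 0) by (apply Cminus_neq_0; auto).
  set (B1 := (y1 - x) / ((y1 - y2) * (y1 - y3))).
  set (B2 := (y2 - x) / ((y2 - y1) * (y2 - y3))).
  set (B3 := (y3 - x) / ((y3 - y1) * (y3 - y2))).
  assert (eJ : three_point x y1 y2 y3 = B1 * (phi * y1 - H y1) + B2 * (phi * y2 - H y2) + B3 * (phi * y3 - H y3)).
  { rewrite <- !log_integral by assumption.
    pose proof (log_cont y1 h1) as l1. pose proof (log_cont y2 h2) as l2. pose proof (log_cont y3 h3) as l3.
    assert (m1 := cont_on_mult _ _ 0 1 (cont_on_const B1 0 1) l1).
    assert (m2 := cont_on_mult _ _ 0 1 (cont_on_const B2 0 1) l2).
    assert (m3 := cont_on_mult _ _ 0 1 (cont_on_const B3 0 1) l3).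
    rewrite <- !CInt_scal by (lra || assumption).
    rewrite <- !CInt_plus by (lra || assumption || now apply cont_on_plus).
    apply CInt_ext; [lra |]. intros t ht.
    pose proof (denom y1 t h1 ht). pose proof (denom y2 t h2 ht). pose proof (denom y3 t h3 ht).
    unfold B1, B2, B3. field. repeat split; auto. }
  assert (e0 : B1 * (H y1 - H y3) + B2 * (H y2 - H y3) = 0).
  { transitivity (phi - three_point x y1 y2 y3); [| rewrite e; ring].
    rewrite eJ. generalize (H y1) (H y2) (H y3). intros A1 A2 A3. unfold B1, B2, B3. field. repeat split; auto. }
  destruct (classic (y1 = x)) as [ex | nx].
  - assert (eB : B1 = 0) by (unfold B1; rewrite ex, Cminus_self; unfold Cdiv; ring).
    assert (hB : B2 <> 0).
    { unfold B2. apply Cmult_neq_0; [rewrite <- ex; exact d21 |]. now apply Cinv_neq_0, Cmult_neq_0. }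
    apply (Hc_injective y2 y3); auto.
    replace (H y2) with (/ B2 * (B1 * (H y1 - H y3) + B2 * (H y2 - H y3)) + H y3) by (rewrite eB; field; exact hB).
    rewrite e0. ring.
  - pose proof (Cminus_neq_0 _ _ nx) as dx.
    pose proof (conj_eq_real _ (cross_ratio_real x y1 y2 y3 hx h1 h2 h3 nx n23)) as ek.
    apply (Hc_not_collinear y1 y2 y3 (Re ((y2 - x) * (y1 - y3) / ((y1 - x) * (y2 - y3))))); auto.
    rewrite <- ek.
    replace (H y1 - H y3) with (/ B1 * (B1 * (H y1 - H y3) + B2 * (H y2 - H y3)) - B2 / B1 * (H y2 - H y3)).
    + rewrite e0. unfold B1, B2. field. repeat split; auto.
    + assert (hB : B1 <> 0).
      { unfold B1. apply Cmult_neq_0; [exact dx |]. now apply Cinv_neq_0, Cmult_neq_0. }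
      field. exact hB.
Qed.

Lemma double_pole_integral (y : C) : Cmod y = 1%R ->
  CInt (fun t => / ((1 - y * RtoC (q * t)) * (1 - y * RtoC (q * t)))) 0 1 = / (1 - RtoC q * y).
Proof.
  intro hy.
  rewrite (CInt_derive (fun t => RtoC t / (1 - y * RtoC (q * t)))).
  - rewrite Rmult_1_r, Rmult_0_r, (Cmult_comm y (RtoC q)). unfold Cdiv. ring.
  - lra.
  - intros t ht. pose proof (denom y t hy ht). eapply rder_unique_at.
    + apply rder_div; [assumption | apply rder_RtoC | apply rder_denom].
    + cbv beta. rewrite RtoC_mult in *. field. assumption.
  - intros t ht. pose proof (denom y t hy ht). apply clim_inv; [now apply Cmult_neq_0 |].
    apply clim_mult; apply denom_cont.
Qed.

(** With a double pole a chord becomes a tangent: equality is D (H w - H y) = - B H'(y), with (H w -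
    H y) / (i y H'(y)) real. This puts H w on the tangent at y, against [Hc_support]; if w = x, then
    D = 0 and H'(y) = 0. *)
Lemma three_point_double (x y w : C) : Cmod x = 1%R -> Cmod y = 1%R -> Cmod w = 1%R ->
  y <> w -> three_point x y y w <> phi.
Proof.
  intros hx hy hw n e.
  pose proof (Cminus_neq_0 _ _ n) as d. assert (d' : w - y <> 0) by (apply Cminus_neq_0; auto).
  set (B := (y - x) / (y - w)). set (D := (w - x) / ((w - y) * (w - y))).
  assert (eJ : three_point x y y w = B * / (1 - RtoC q * y) + D * (phi * w - H w) - D * (phi * y - H y)).
  { rewrite <- !log_integral, <- double_pole_integral by assumption.
    pose proof (log_cont y hy) as l1. pose proof (log_cont w hw) as l2.
    assert (l3 : cont_on (fun t => / ((1 - y * RtoC (q * t)) * (1 - y * RtoC (q * t)))) 0 1).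
    { intros t ht. pose proof (denom y t hy ht). apply clim_inv; [now apply Cmult_neq_0 |].
      apply clim_mult; apply denom_cont. }
    assert (m1 := cont_on_mult _ _ 0 1 (cont_on_const D 0 1) l1).
    assert (m2 := cont_on_mult _ _ 0 1 (cont_on_const D 0 1) l2).
    assert (m3 := cont_on_mult _ _ 0 1 (cont_on_const B 0 1) l3).
    rewrite <- !CInt_scal by (lra || assumption).
    rewrite <- CInt_plus, <- CInt_minus by (lra || assumption || now apply cont_on_plus).
    apply CInt_ext; [lra |]. intros t ht.
    pose proof (denom y t hy ht). pose proof (denom w t hw ht).
    unfold B, D. field. repeat split; auto. }
  assert (e0 : D * (H w - H y) = - B * dH y).
  { transitivity (three_point x y y w - phi + D * (H w - H y)); [rewrite e; ring |].
    rewrite eJ. unfold dHc. generalize (H w) (H y) (/ (1 - RtoC q * y)). intros A1 A2 A3.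
    unfold B, D. field. repeat split; auto. }
  pose proof (dHc_neq_0 q hq phi excluded y hy) as hd.
  destruct (classic (w = x)) as [ex | nx].
  - assert (eD : D = 0) by (unfold D; rewrite ex, Cminus_self; unfold Cdiv; ring).
    assert (eB : B = 1) by (unfold B; rewrite <- ex; field; exact d).
    apply hd. rewrite eD, eB in e0. replace (dH y) with (- (- (1) * dH y)) by ring. rewrite <- e0. ring.
  - pose proof (Cminus_neq_0 _ _ nx) as dx.
    assert (hD : D <> 0).
    { unfold D. apply Cmult_neq_0; [exact dx |]. now apply Cinv_neq_0, Cmult_neq_0. }
    assert (hi : Ci <> 0) by (intro e1; apply (f_equal snd) in e1; simpl in e1; lra).
    pose proof (unit_neq_0 _ hx) as nzx. pose proof (unit_neq_0 _ hy) as nzy. pose proof (unit_neq_0 _ hw) as nzw.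
    pose proof (Hc_support q hq phi excluded y w hy hw n) as hs.
    set (k := (y - x) * (w - y) / ((w - x) * Ci * y)).
    assert (ek : (H w - H y) / (Ci * y * dH y) = k).
    { replace (H w - H y) with (/ D * (D * (H w - H y))) by (field; exact hD). rewrite e0.
      unfold k, B, D. field. repeat split; auto. }
    rewrite ek in hs.
    assert (ck : Cconj k = k).
    { unfold k. rewrite Cdiv_conj by (repeat apply Cmult_neq_0; auto).
      rewrite !Cmult_conj, !Cminus_conj, !Cconj_Cinv by assumption.
      replace (Cconj Ci) with (- Ci) by (apply C_eq; simpl; ring).
      replace (/ y - / x) with (- (y - x) / (y * x)) by (field; auto).
      replace (/ w - / y) with (- (w - y) / (w * y)) by (field; auto).
      replace (/ w - / x) with (- (w - x) / (w * x)) by (field; auto).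
      field. repeat split; auto. }
    rewrite (conj_eq_real k ck) in hs. simpl in hs. lra.
Qed.

(** The integral is the extremal value (1 - (x + y)q/2)/s^2 with s = 1 - qy, for which 2 phi s^2 - 1
    - s = - qx has modulus q = |1 - s|. *)
Lemma three_point_triple (x y : C) : Cmod x = 1%R -> Cmod y = 1%R -> three_point x y y y <> phi.
Proof.
  intros hx hy e.
  assert (eJ : three_point x y y y = (1 - (x + y) / 2 * RtoC q) / ((1 - RtoC q * y) * (1 - RtoC q * y))).
  { unfold three_point.
    rewrite (CInt_derive (fun t => RtoC t * (1 - (x + y) / 2 * RtoC (q * t)) / ((1 - y * RtoC (q * t)) * (1 - y * RtoC (q * t))))).
    - rewrite Rmult_1_r, Rmult_0_r, (Cmult_comm y (RtoC q)). unfold Cdiv. ring.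
    - lra.
    - intros t ht. pose proof (denom y t hy ht). eapply rder_unique_at.
      + apply rder_div; [now apply Cmult_neq_0 | apply rder_mult; [apply rder_RtoC | apply rder_denom] |
          apply rder_mult; apply rder_denom].
      + cbv beta. rewrite RtoC_mult in *. field. assumption.
    - intros t ht. pose proof (denom y t hy ht). apply clim_mult; [apply denom_cont |].
      apply clim_inv; [repeat apply Cmult_neq_0; assumption |]. repeat apply clim_mult; apply denom_cont. }
  set (s := 1 - RtoC q * y).
  assert (hs0 : s <> 0) by (apply Re_pos_neq_0, (one_minus_q_pos q hq y hy)).
  assert (hs : Cmod (1 - s) = q).
  { unfold s. replace (1 - (1 - RtoC q * y)) with (RtoC q * y) by ring.
    rewrite Cmod_mult, hy, Cmod_RtoC_nonneg; lra. }
  pose proof (excluded s) as h. rewrite Cmod_minus_sym, hs in h. specialize (h (Rle_refl q)).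
  rewrite <- e, eJ in h. fold s in h.
  replace (2 * ((1 - (x + y) / 2 * RtoC q) / (s * s)) * s ^ 2 - 1 - s) with (- (RtoC q * x)) in h.
  - rewrite Cmod_opp, Cmod_mult, hx, Cmod_RtoC_nonneg in h; lra.
  - unfold s in *. field. exact hs0.
Qed.

Lemma three_point_swap12 (x y1 y2 y3 : C) : three_point x y1 y2 y3 = three_point x y2 y1 y3.
Proof.
  unfold three_point. apply CInt_ext; [lra |]. intros t _. f_equal. ring.
Qed.

Lemma three_point_swap23 (x y1 y2 y3 : C) : three_point x y1 y2 y3 = three_point x y1 y3 y2.
Proof.
  unfold three_point. apply CInt_ext; [lra |]. intros t _. f_equal. ring.
Qed.

Theorem three_point_neq (x y1 y2 y3 : C) : Cmod x = 1%R -> Cmod y1 = 1%R -> Cmod y2 = 1%R -> Cmod y3 = 1%R ->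
  three_point x y1 y2 y3 <> phi.
Proof.
  intros hx h1 h2 h3.
  destruct (classic (y1 = y2)) as [<- | n12].
  - destruct (classic (y1 = y3)) as [<- | n13]; [now apply three_point_triple | now apply three_point_double].
  - destruct (classic (y1 = y3)) as [<- | n13].
    + rewrite three_point_swap23. now apply three_point_double.
    + destruct (classic (y2 = y3)) as [<- | n23].
      * rewrite three_point_swap12, three_point_swap23. apply three_point_double; auto.
      * now apply three_point_distinct.
Qed.

End ThreePointIntegral.

(** * Opposite points of a convex curve and the half-plane factorization *)

Lemma expi_range (t a : R) : exists s, (a <= s < a + 2 * PI)%R /\ expi t = expi s.
Proof.
  destruct (unit_expi (expi (t - a)) (Cmod_expi _)) as [s [hs e]].
  exists (a + s)%R. split; [lra |]. rewrite (expi_plus a), <- e, <- expi_plus. f_equal. lra.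
Qed.

Lemma one_minus_expi (a : R) : 1 - expi a = - (2 * Ci * RtoC (sin (a / 2)) * expi (a / 2)).
Proof.
  set (b := (a / 2)%R). replace a with (b + b)%R by (unfold b; lra).
  rewrite expi_plus. pose proof (sin2_cos2 b) as h. unfold Rsqr in h.
  apply C_eq; unfold expi; simpl; nra.
Qed.

Section ConvexCurve.

Variable R0 : R.
Hypothesis hR : (1 < R0)%R.
Variables g d : C -> C.
Hypothesis hg : forall z, (Cmod z < R0)%R -> cder g z (d z).
Hypothesis hd : holo R0 d.
Hypothesis hd0 : forall z, (Cmod z < R0)%R -> d z <> 0.
Hypothesis support : forall z w, Cmod z = 1%R -> Cmod w = 1%R -> z <> w ->
  (0 < Re ((g z - g w) / (z * d z)))%R.

Variable a : R.

(** The outward normal z g'(z) of the curve g(e^(it)); [turn] and [height] are measured against the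
    normal at the fixed parameter a. *)
Definition normal (t : R) : C := expi t * d (expi t).
Definition turn (t : R) : C := normal t / normal a.
Definition height (t : R) : R := Re (g (expi t) / normal a).

Lemma normal_neq_0 (t : R) : normal t <> 0.
Proof. apply Cmult_neq_0; [apply expi_neq_0 |]. apply hd0. rewrite Cmod_expi. exact hR. Qed.

Lemma height_derive (t : R) : is_derive height t (- Im (turn t))%R.
Proof.
  assert (h : rder (fun t => g (expi t) / normal a) t (Ci * turn t)).
  { eapply rder_unique_at.
    - apply rder_div; [apply normal_neq_0 | | apply rder_const].
      apply rder_comp; [apply hg; rewrite Cmod_expi; exact hR | apply rder_expi].
    - unfold turn. change (normal t) with (expi t * d (expi t)). simpl. pose proof (normal_neq_0 a). field. assumption. }
  destruct (rder_is_derive _ _ _ h) as [h1 _].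
  replace (- Im (turn t))%R with (Re (Ci * turn t)); [exact h1 |].
  generalize (turn t). intros [x y]. unfold Re, Im. simpl. ring.
Qed.

Lemma turn_cont (t : R) : continuous (fun t => Im (turn t)) t.
Proof.
  apply ccont_Im. apply clim_mult; [| apply clim_const].
  apply clim_mult; [apply ccont_expi |]. apply clim_near_comp; [| apply ccont_expi].
  apply (holo_clim R0); [exact hd | rewrite Cmod_expi; exact hR].
Qed.

(** Where [turn s] is a real k, the normals at s and a are parallel, so the support property makes s
    strictly highest if k > 0 and strictly lowest if k < 0. *)
Lemma support_height (s t k : R) : expi s <> expi t -> turn s = RtoC k -> (0 < (height s - height t) / k)%R.
Proof.
  intros hn hk. pose proof (support _ _ (Cmod_expi s) (Cmod_expi t) hn) as h.
  assert (en : normal s = RtoC k * normal a).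
  { rewrite <- hk. unfold turn. pose proof (normal_neq_0 a). field. assumption. }
  assert (k0 : RtoC k <> 0).
  { intro e. apply (normal_neq_0 s). rewrite en, e. ring. }
  fold (normal s) in h. rewrite en in h.
  replace ((g (expi s) - g (expi t)) / (RtoC k * normal a)) with (RtoC (/ k) * (g (expi s) / normal a - g (expi t) / normal a)) in h.
  - rewrite Re_RtoC_mult, Re_minus in h. fold (height s) (height t) in h. unfold Rdiv. lra.
  - rewrite RtoC_inv by (intro e; apply k0; now rewrite e). pose proof (normal_neq_0 a). field. auto.
Qed.

Lemma real_of_Im_0 (z : C) : Im z = 0%R -> z = RtoC (Re z).
Proof. intro h. apply C_eq; simpl; [reflexivity | exact h]. Qed.

Lemma turn_a : turn a = RtoC 1.
Proof. unfold turn. pose proof (normal_neq_0 a). unfold Cdiv. now rewrite Cinv_r. Qed.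

Lemma height_a_max (t : R) : expi t <> expi a -> (height t < height a)%R.
Proof.
  intro h. pose proof (support_height a t 1 (not_eq_sym h) turn_a). unfold Rdiv in H. lra.
Qed.

Lemma expi_neq (s t : R) : (s < t < s + 2 * PI)%R -> expi s <> expi t.
Proof.
  intros h e. assert (e1 : expi (t - s) = 1).
  { unfold Rminus. rewrite expi_plus, <- e, <- expi_inv. apply Cinv_r, expi_neq_0. }
  pose proof (one_minus_expi (t - s)) as e2. rewrite e1, Cminus_self in e2.
  assert (hs : (0 < sin ((t - s) / 2))%R) by (apply sin_gt_0; lra).
  assert (hc : Cmod (2 * Ci * RtoC (sin ((t - s) / 2)) * expi ((t - s) / 2)) = 0%R).
  { rewrite <- Cmod_opp, <- e2. apply Cmod_0. }
  rewrite !Cmod_mult, !Cmod_R, Cmod_expi, Cmod_Ci, !Rabs_pos_eq in hc by lra. lra.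
Qed.

(* The tangent at parameter [b] is parallel to the one at [a], so that the
   curve lies in the strip between them and [Im turn] changes sign only at
   [a] and [b]. *)
Lemma opposite_point : exists b, (a < b < a + 2 * PI)%R /\
  (forall t, (a < t < b)%R -> (0 < Im (turn t))%R) /\
  (forall t, (b < t < a + 2 * PI)%R -> (Im (turn t) < 0)%R).
Proof.
  pose proof PI_RGT_0.
  assert (hc : forall t, Ranalysis1.continuity_pt height t).
  { intro t. apply Ranalysis1.derivable_continuous_pt. exists (- Im (turn t))%R. apply is_derive_Reals, height_derive. }
  destruct (continuity_ab_min height a (a + 2 * PI)) as [b [hmin hb]]; [lra | intros; apply hc |].
  assert (hper : height (a + 2 * PI) = height a) by (unfold height; now rewrite expi_2PI).
  assert (hlow : (height b < height a)%R).
  { apply Rle_lt_trans with (height (a + PI)); [apply hmin; lra |].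
    apply height_a_max. apply not_eq_sym, expi_neq. lra. }
  assert (hb' : (a < b < a + 2 * PI)%R).
  { split.
    - destruct (Rtotal_order a b) as [h | [h | h]]; [exact h | rewrite <- h in hlow; lra | lra].
    - destruct (Rtotal_order b (a + 2 * PI)) as [h | [h | h]]; [exact h | rewrite h, hper in hlow; lra | lra]. }
  assert (tb : Im (turn b) = 0%R).
  { assert (pr : derivable_pt_lim height b (- Im (turn b))%R) by apply is_derive_Reals, height_derive.
    pose proof (deriv_minimum height a (a + 2 * PI) b (exist _ _ pr) (proj1 hb') (proj2 hb')) as e.
    change (derive_pt height b (exist _ _ pr)) with (- Im (turn b))%R in e.
    assert (e0 : (- Im (turn b) = 0)%R) by (apply e; intros x h1 h2; apply hmin; lra). lra. }
  (* At another zero of Im turn the point would be a strict maximum of [height], against a, or a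
     strict minimum, against b. *)
  assert (nz : forall t, (a < t < a + 2 * PI)%R -> t <> b -> Im (turn t) <> 0%R).
  { intros t ht hne e. pose proof (real_of_Im_0 _ e) as er.
    set (k := Re (turn t)) in er.
    assert (hk0 : k <> 0%R).
    { intro ek. rewrite ek in er. unfold turn in er. apply (normal_neq_0 t).
      replace (normal t) with (normal t / normal a * normal a) by (field; apply normal_neq_0).
      rewrite er. ring. }
    pose proof (expi_neq a t ht) as na.
    destruct (Rlt_le_dec 0 k) as [hk | hk].
    - pose proof (support_height t a k (not_eq_sym na) er) as hs. pose proof (height_a_max t (not_eq_sym na)).
      assert (0 < / k)%R by now apply Rinv_0_lt_compat. unfold Rdiv in hs. nra.
    - assert (nb : expi t <> expi b).
      { destruct (Rlt_le_dec t b); [apply expi_neq; lra | apply not_eq_sym, expi_neq; lra]. }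
      pose proof (support_height t b k nb er) as hs.
      assert (hmt : (height b <= height t)%R) by (apply hmin; lra).
      assert (hik : (/ k < 0)%R) by (apply Rinv_lt_0_compat; lra). unfold Rdiv in hs. nra. }
  exists b. split; [exact hb' |]. split.
  (* [height] falls from a to b and rises back to a + 2 PI, so the mean value theorem gives one
     point of the right sign on each arc, and the absence of zeros extends the sign. *)
  - destruct (MVT_cor2 height (fun t => - Im (turn t))%R a b) as [c [e hcc]];
      [lra | intros; apply is_derive_Reals, height_derive |].
    apply (sign_on_interval (fun t => Im (turn t)) a b c turn_cont); [intros t ht; apply nz; lra | exact hcc |]. nra.
  - destruct (MVT_cor2 height (fun t => - Im (turn t))%R b (a + 2 * PI)) as [c [e hcc]];
      [lra | intros; apply is_derive_Reals, height_derive |].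
    rewrite hper in e.
    intros t ht. assert (hpos : (0 < - Im (turn t))%R); [| lra].
    apply (sign_on_interval (fun t => - Im (turn t))%R b (a + 2 * PI) c); [| | exact hcc | nra | exact ht].
    + intro s. apply (continuous_opp (V := R_NormedModule)), turn_cont.
    + intros s hs e0. apply (nz s); lra.
Qed.

(* On the circle [(1 - z / z1) (1 - z / z2) / z] has constant argument up to sign,
   and its sign changes cancel those of [Im turn]. *)
Lemma strip_factorization : exists b : R, exists k : C, exists t0 : R,
  let P := fun z => (1 - Cconj (expi a) * z) * (1 - Cconj (expi b) * z) * d z in
  (forall t, (0 <= Re (k * P (expi t)))%R) /\ (0 < Re (k * P (expi t0)))%R.
Proof.
  destruct opposite_point as [b [hb [h1 h2]]].
  (* By [one_minus_expi] the two linear factors contribute e^(i(t-a)/2) and e^(i(t-b)/2). The factor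
     e^(i(a+b)/2) completes these to e^(it), so k P is a real multiple of i [turn t]; at the
     midpoint of (a, b) this multiple and Im turn are nonzero. *)
  exists b, (- Ci * expi ((a + b) / 2) / normal a), ((a + b) / 2)%R. intro P.
  assert (key : forall t, Re (- Ci * expi ((a + b) / 2) / normal a * P (expi t)) =
    (- (4 * (sin ((t - a) / 2) * sin ((t - b) / 2))) * Im (turn t))%R).
  { intro t. unfold P. rewrite <- !expi_opp, (Cmult_comm (expi (- a))), (Cmult_comm (expi (- b))), <- !expi_plus.
    change (t + - a)%R with (t - a)%R. change (t + - b)%R with (t - b)%R.
    rewrite (one_minus_expi (t - a)), (one_minus_expi (t - b)).
    assert (ee : expi ((a + b) / 2) * expi ((t - a) / 2) * expi ((t - b) / 2) = expi t).
    { rewrite <- !expi_plus. f_equal. lra. }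
    replace (- Ci * expi ((a + b) / 2) / normal a * (- (2 * Ci * RtoC (sin ((t - a) / 2)) * expi ((t - a) / 2)) *
      - (2 * Ci * RtoC (sin ((t - b) / 2)) * expi ((t - b) / 2)) * d (expi t)))
      with (RtoC (4 * (sin ((t - a) / 2) * sin ((t - b) / 2))) * (Ci * turn t)).
    - rewrite Re_RtoC_mult. generalize (turn t). intros [x y]. unfold Re, Im. simpl. ring.
    - unfold turn. change (normal t) with (expi t * d (expi t)). rewrite <- ee. rewrite !RtoC_mult.
      assert (ei : Ci * Ci = - (1)) by (apply C_eq; simpl; ring).
      set (A := RtoC (sin ((t - a) / 2))). set (B := RtoC (sin ((t - b) / 2))).
      set (E1 := expi ((a + b) / 2)). set (E2 := expi ((t - a) / 2)). set (E3 := expi ((t - b) / 2)).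
      transitivity (- (Ci * Ci) * (4 * (A * B) * (Ci * (E1 * E2 * E3 * d (E1 * E2 * E3) / normal a)))).
      + rewrite ei. ring.
      + unfold Cdiv. ring. }
  split.
  - intro t. destruct (expi_range t a) as [s [hs es]]. rewrite es, key.
    destruct (Req_dec s a) as [-> | na].
    { unfold Rminus at 1. rewrite Rplus_opp_r. replace (0 / 2)%R with 0%R by field. rewrite sin_0. lra. }
    destruct (Rtotal_order s b) as [h | [-> | h]].
    + assert (0 < sin ((s - a) / 2))%R by (apply sin_gt_0; lra).
      assert (sin ((s - b) / 2) < 0)%R by (apply sin_lt_0_var; lra).
      assert (0 < Im (turn s))%R by (apply h1; lra).
      assert (sin ((s - a) / 2) * sin ((s - b) / 2) < 0)%R by nra. nra.
    + unfold Rminus at 2. rewrite Rplus_opp_r. replace (0 / 2)%R with 0%R by field. rewrite sin_0. lra.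
    + assert (0 < sin ((s - a) / 2))%R by (apply sin_gt_0; lra).
      assert (0 < sin ((s - b) / 2))%R by (apply sin_gt_0; lra).
      assert (Im (turn s) < 0)%R by (apply h2; lra).
      assert (0 < sin ((s - a) / 2) * sin ((s - b) / 2))%R by nra. nra.
  - rewrite key. set (s := ((a + b) / 2)%R).
    assert (0 < sin ((s - a) / 2))%R by (apply sin_gt_0; unfold s; lra).
    assert (sin ((s - b) / 2) < 0)%R by (apply sin_lt_0_var; unfold s; lra).
    assert (0 < Im (turn s))%R by (apply h1; unfold s; lra).
    assert (sin ((s - a) / 2) * sin ((s - b) / 2) < 0)%R by nra. nra.
Qed.

End ConvexCurve.

(** * The two applications of duality *)

Lemma holo_radius_cont (R0 q : R) (f : C -> C) : (1 < R0)%R -> (0 < q < 1)%R -> holo R0 f ->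
  cont_on (fun t => f (RtoC (q * t))) 0 1.
Proof.
  intros hR hq hf t ht. apply clim_near_comp; [| apply qt_cont].
  apply (holo_clim R0); [exact hf |]. rewrite Cmod_RtoC_nonneg; nra.
Qed.

Theorem region_on_circle (R0 : R) (g d p : C -> C) (k : C) (q : R) : (1 < R0)%R -> (0 < q < 1)%R ->
  (forall z, (Cmod z < R0)%R -> cder g z (d z)) -> holo R0 d ->
  (forall z, (Cmod z < R0)%R -> d z <> 0) ->
  (forall z w, Cmod z = 1%R -> Cmod w = 1%R -> z <> w -> (0 < Re ((g z - g w) / (z * d z)))%R) ->
  d 0 = 1 -> holo R0 p -> p 0 = 1 -> (forall z, (Cmod z < R0)%R -> (0 < Re (k * p z))%R) ->
  let phi := CInt (fun t => d (RtoC (q * t)) * p (RtoC (q * t))) 0 1 in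
  exists s : C, (Cmod (s - 1) <= q)%R /\ (Cmod (2 * phi * s ^ 2 - 1 - s)%C <= Cmod (1 - s))%R.
Proof.
  intros hR hq hg hd hd0 support d1 hp p1 kp phi.
  apply NNPP. intro hn.
  assert (excluded : forall s : C, (Cmod (s - 1) <= q)%R -> (Cmod (1 - s) < Cmod (2 * phi * s ^ 2 - 1 - s))%R).
  { intros s hs. apply Rnot_le_lt. intro h. apply hn. exists s. split; assumption. }
  assert (cd : cont_on (fun t => d (RtoC (q * t))) 0 1) by now apply (holo_radius_cont R0).
  assert (ht1 : forall t, Cmod (expi t) = 1%R) by apply Cmod_expi.
  apply (duality_principle q hq (fun t => d (RtoC (q * t))) cd phi) with (R0 := R0) (P := p) (k := k) (t0 := 0%R); auto.
  - intros x y hx hy.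
    destruct (unit_expi (Cconj x)) as [a [_ ea]]; [now rewrite Cmod_conj |].
    assert (ex : x = Cconj (expi a)) by (rewrite <- ea; now rewrite Cconj_conj).
    destruct (strip_factorization R0 hR g d hg hd hd0 support a) as [b [m [t0 hP]]].
    rewrite <- ex in hP. set (beta := Cconj (expi b)) in *.
    assert (hb : Cmod beta = 1%R) by (unfold beta; now rewrite Cmod_conj).
    set (P := fun z => (1 - x * z) * (1 - beta * z) * d z) in *.
    destruct hP as [h1 h2].
    (* G(t) P(qt) is d (1 - xz)/(1 - yz) at z = qt, because the factor 1 - beta z of P cancels. The
       test quotients of this inner duality add a pole y' to y and beta, which gives the three-point
       integrals. *)
    set (G := fun t => / ((1 - y * RtoC (q * t)) * (1 - beta * RtoC (q * t)))).
    assert (dn : forall c t, Cmod c = 1%R -> (0 <= t <= 1)%R -> 1 - c * RtoC (q * t) <> 0).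
    { intros c t hc ht. apply (denom_neq_0 q hq); [lra | exact ht]. }
    assert (cG : cont_on G 0 1).
    { intros t ht. apply clim_inv; [apply Cmult_neq_0; now apply dn |]. apply clim_mult; apply denom_cont. }
    assert (hol : holo R0 P).
    { apply holo_mult; [| exact hd].
      apply holo_mult; (apply holo_minus; [apply holo_const |]; apply holo_mult; [apply holo_const | apply holo_id]). }
    assert (nz : pairing q G phi P <> 0).
    { apply (duality_principle q hq G cG phi) with (R0 := R0) (k := m) (t0 := t0); auto.
      intros x' y' hx' hy'. pose proof (three_point_neq q hq phi excluded x' y beta y' hx' hy hb hy') as h3.
      unfold three_point in h3. intro e. apply h3. rewrite <- e. apply CInt_ext; [lra |].
      intros t ht. pose proof (dn y t hy ht). pose proof (dn beta t hb ht). pose proof (dn y' t hy' ht).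
      unfold G. field. auto. }
    intro e. apply nz. unfold pairing.
    assert (eP : P 0 = 1) by (unfold P; rewrite d1; ring).
    rewrite eP, <- e at 1. rewrite e.
    rewrite (CInt_ext _ (fun t => d (RtoC (q * t)) * ((1 - x * RtoC (q * t)) / (1 - y * RtoC (q * t))))).
    + rewrite e. ring.
    + lra.
    + intros t ht. pose proof (dn y t hy ht). pose proof (dn beta t hb ht). unfold G, P. field. auto.
  - intro t. left. apply kp. rewrite ht1. exact hR.
  - apply kp. rewrite ht1. exact hR.
  (* The contradiction: since p 0 = 1, the definition of phi makes the pairing of p vanish. *)
  - unfold pairing. rewrite p1. fold phi. ring.
Qed.

(** * Minima on compact sets and inverses of univalent functions *)

(** If the infimum m were not attained, each point would have a square neighbourhood on which u
    exceeds m by the size of the square at all points of K. Choice turns these sizes into a gauge,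
    which [compactness_value_2d] bounds below. *)
Lemma compact_min (K : C -> Prop) (u : C -> R) (r : R) :
  (forall z, ~ K z -> near z (fun w => ~ K w)) ->
  (forall z e, K z -> (0 < e)%R -> near z (fun w => K w -> (u z - e < u w)%R)) ->
  (forall z, (0 <= u z)%R) -> (forall z, K z -> (Cmod z <= r)%R) -> (exists z, K z) ->
  exists z, K z /\ forall w, K w -> (u z <= u w)%R.
Proof.
  intros hK hu h0 hr [z0 hz0].
  destruct (completeness (fun y => exists z, K z /\ y = (- u z)%R)) as [m' [hm1 hm2]].
  { exists 0%R. intros y [z [_ ->]]. pose proof (h0 z). lra. }
  { exists (- u z0)%R, z0. auto. }
  set (m := (- m')%R).
  assert (inf1 : forall z, K z -> (m <= u z)%R).
  { intros z hz. assert (- u z <= m')%R by (apply hm1; now exists z). unfold m. lra. }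
  assert (inf2 : forall e, (0 < e)%R -> exists z, K z /\ (u z < m + e)%R).
  { intros e he. apply NNPP. intro hn. assert (m' <= m' - e)%R; [| lra].
    apply hm2. intros y [z [hz ->]]. destruct (Rlt_le_dec (u z) (m + e)) as [h | h].
    - exfalso. apply hn. now exists z.
    - unfold m in h. lra. }
  apply NNPP. intro hn.
  assert (loc : forall a b : R, exists del : posreal, forall w : C,
    (Rabs (Re w - a) < del)%R -> (Rabs (Im w - b) < del)%R -> K w -> (m + del <= u w)%R).
  { intros a b. set (z := (a, b) : C).
    assert (tr : forall (e : R) w, (Rabs (Re w - a) < e / 2)%R -> (Rabs (Im w - b) < e / 2)%R -> (Cmod (w - z) < e)%R).
    { intros e w h1 h2. pose proof (Cmod_sqr (w - z)) as hs. pose proof (Cmod_ge_0 (w - z)).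
      rewrite Re_minus, Im_minus in hs. unfold z in hs at 3 4 5 6. simpl in hs.
      apply Rabs_def2 in h1. apply Rabs_def2 in h2. unfold Re, Im in *. nra. }
    destruct (classic (K z)) as [hz | hz].
    - assert (hlt : (m < u z)%R).
      { apply Rnot_le_lt. intro hle. apply hn. exists z. split; [exact hz |].
        intros w hw. pose proof (inf1 w hw). lra. }
      set (e := ((u z - m) / 2)%R). assert (he : (0 < e)%R) by (unfold e; lra).
      destruct (hu z e hz he) as [del [hdel hh]].
      assert (hp : (0 < Rmin (del / 2) e)%R) by (apply Rmin_pos; lra).
      exists (mkposreal _ hp). simpl. intros w h1 h2 hw0.
      assert (hw : (u z - e < u w)%R).
      { apply hh; [| exact hw0]. apply tr; (eapply Rlt_le_trans; [eassumption | apply Rmin_l]). }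
      pose proof (Rmin_r (del / 2) e). unfold e in *. lra.
    - destruct (hK z hz) as [del [hdel hh]].
      assert (hp : (0 < del / 2)%R) by lra.
      exists (mkposreal _ hp). simpl. intros w h1 h2 hw. exfalso. apply (hh w); [now apply tr | exact hw]. }
  set (delta := fun a b => proj1_sig (constructive_indefinite_description _ (loc a b))).
  assert (hdelta : forall a b (w : C), (Rabs (Re w - a) < delta a b)%R -> (Rabs (Im w - b) < delta a b)%R ->
    K w -> (m + delta a b <= u w)%R).
  { intros a b. exact (proj2_sig (constructive_indefinite_description _ (loc a b))). }
  destruct (compactness_value_2d (- r) r (- r) r delta) as [d hd].
  destruct (inf2 d (cond_pos d)) as [z [hz hlt]].
  pose proof (hr z hz) as hzr.
  assert (b1 : (- r <= Re z <= r)%R) by (apply Rabs_le_between; eapply Rle_trans; [apply Re_le_mod | exact hzr]).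
  assert (b2 : (- r <= Im z <= r)%R) by (apply Rabs_le_between; eapply Rle_trans; [apply Im_le_mod | exact hzr]).
  apply (hd (Re z) (Im z) b1 b2). intros [a [b (_ & _ & h1 & h2 & h3)]].
  pose proof (hdelta a b z h1 h2 hz). lra.
Qed.

Lemma Cmod_lsc (f : C -> C) (z : C) (e : R) : clim (near z) f (f z) -> (0 < e)%R ->
  near z (fun w => (Cmod (f z) - e < Cmod (f w))%R).
Proof.
  intros h he. generalize (h e he). apply filter_imp. intros w hw.
  pose proof (Cmod_minus_triangle (f z) (f w)). rewrite Cmod_minus_sym in H. lra.
Qed.

(** A short step along the Newton direction -(g v - w)/l shrinks the residual by about the factor 1
    - t. Hence an interior minimum of |g - w| can only be a zero. *)
Lemma descend (g : C -> C) (v w l : C) (r : R) : cder g v l -> l <> 0 -> g v <> w -> (0 < r)%R ->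
  exists v', (Cmod (v' - v) < r)%R /\ (Cmod (g v' - w) < Cmod (g v - w))%R.
Proof.
  intros hg hl hn hr. set (c := g v - w). assert (hc : c <> 0) by now apply Cminus_neq_0.
  assert (hcm : (0 < Cmod c)%R) by now apply Cmod_gt_0.
  assert (hlm : (0 < Cmod l)%R) by now apply Cmod_gt_0.
  assert (he : (0 < Cmod l / 2)%R) by lra.
  destruct (eps_of_cder g v l hg _ he) as [del [hdel hh]].
  set (K := (Cmod c / Cmod l)%R). assert (hK : (0 < K)%R) by now apply Rdiv_lt_0_compat.
  set (t := Rmin 1 (Rmin (r / (2 * K)) (del / (2 * K)))).
  assert (ht : (0 < t)%R) by (repeat apply Rmin_pos; try lra; apply Rdiv_lt_0_compat; lra).
  assert (t1 : (t <= 1)%R) by apply Rmin_l.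
  assert (t2 : (t * K < r)%R).
  { apply Rle_lt_trans with (r / (2 * K) * K)%R.
    - apply Rmult_le_compat_r; [lra |]. eapply Rle_trans; [apply Rmin_r | apply Rmin_l].
    - replace (r / (2 * K) * K)%R with (r / 2)%R by (field; lra). lra. }
  assert (t3 : (t * K < del)%R).
  { apply Rle_lt_trans with (del / (2 * K) * K)%R.
    - apply Rmult_le_compat_r; [lra |]. eapply Rle_trans; [apply Rmin_r | apply Rmin_r].
    - replace (del / (2 * K) * K)%R with (del / 2)%R by (field; lra). lra. }
  set (h := - (RtoC t * (c / l))).
  assert (hm : Cmod h = (t * K)%R).
  { unfold h. rewrite Cmod_opp, Cmod_mult, Cmod_RtoC_nonneg, Cmod_div by (lra || auto). reflexivity. }
  exists (v + h). replace (v + h - v) with h by ring. split; [rewrite hm; exact t2 |].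
  specialize (hh (v + h)). cbv beta in hh. replace (v + h - v) with h in hh by ring. rewrite hm in hh. specialize (hh t3).
  replace (g (v + h) - w) with ((g (v + h) - g v - l * h) + RtoC (1 - t) * c).
  - eapply Rle_lt_trans; [apply Cmod_triangle |]. rewrite (Cmod_mult (RtoC _)), Cmod_RtoC_nonneg by lra.
    fold c. assert (Cmod l / 2 * (t * K) = t * Cmod c / 2)%R by (unfold K; field; lra). nra.
  - rewrite RtoC_minus. unfold h, c. field. exact hl.
Qed.

Section Inverse.

Variables g d : C -> C.
Hypothesis hg : forall z, (Cmod z < 1)%R -> cder g z (d z).
Hypothesis hd : forall z, (Cmod z < 1)%R -> d z <> 0.
Hypothesis inj : forall z w, (Cmod z < 1)%R -> (Cmod w < 1)%R -> g z = g w -> z = w.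

(** Let m be the distance of g z0 from the image of a small circle about z0. If g z is within m/2 of
    g z0, then |g - g z| has its minimum over the closed disk in the interior, where [descend]
    forces the value 0; injectivity identifies the minimizer with z. *)
Lemma inverse_cont (z0 : C) (e : R) : (Cmod z0 < 1)%R -> (0 < e)%R -> exists del, (0 < del)%R /\
  forall z, (Cmod z < 1)%R -> (Cmod (g z - g z0) < del)%R -> (Cmod (z - z0) < e)%R.
Proof.
  intros hz0 he0.
  set (e' := Rmin e ((1 - Cmod z0) / 2)).
  assert (he : (0 < e')%R) by (apply Rmin_pos; lra).
  assert (he1 : (e' <= e)%R) by apply Rmin_l.
  assert (he2 : (e' <= (1 - Cmod z0) / 2)%R) by apply Rmin_r.
  assert (ind : forall v, (Cmod (v - z0) <= e')%R -> (Cmod v < 1)%R).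
  { intros v hv. pose proof (Cmod_minus_triangle v z0). lra. }
  pose proof PI_RGT_0.
  assert (cm : forall t, Cmod (z0 + RtoC e' * expi t - z0) = e').
  { intro t. replace (z0 + RtoC e' * expi t - z0) with (RtoC e' * expi t) by ring.
    rewrite Cmod_mult, Cmod_expi, Cmod_RtoC_nonneg; lra. }
  destruct (continuity_ab_min (fun t => Cmod (g (z0 + RtoC e' * expi t) - g z0)) 0 (2 * PI)) as [t0 [hmin _]]; [lra | |].
  { intros t _. apply continuity_pt_filterlim. apply ccont_Cmod. apply clim_minus; [| apply clim_const].
    apply (clim_near_comp g (fun t => z0 + RtoC e' * expi t)).
    - eapply cder_near. apply hg, ind. rewrite cm. lra.
    - apply clim_plus; [apply clim_const |]. apply clim_mult; [apply clim_const | apply ccont_expi]. }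
  set (m := Cmod (g (z0 + RtoC e' * expi t0) - g z0)) in *.
  assert (hm : (0 < m)%R).
  { apply Cmod_gt_0, Cminus_neq_0. intro e0. apply inj in e0; [| apply ind; rewrite cm; lra | exact hz0].
    pose proof (cm t0) as c0. rewrite e0, Cminus_self, Cmod_0 in c0. lra. }
  exists (m / 2)%R. split; [lra |]. intros z hz hgz.
  destruct (compact_min (fun v => (Cmod (v - z0) <= e')%R) (fun v => Cmod (g v - g z)) 1) as [v [hv hvm]].
  - intros v hv. exists (Cmod (v - z0) - e')%R. split; [lra |]. intros w hw.
    pose proof (Cmod_minus_triangle (v - z0) (w - z0)) as ht. replace (v - z0 - (w - z0)) with (- (w - v)) in ht by ring.
    rewrite Cmod_opp in ht. lra.
  - intros v e0 hv h0. generalize (Cmod_lsc (fun v => g v - g z) v e0). intro hl.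
    assert (hc : near v (fun w => (Cmod (g v - g z) - e0 < Cmod (g w - g z))%R)).
    { apply hl; [| exact h0]. apply clim_minus; [| apply clim_const]. eapply cder_near. now apply hg, ind. }
    revert hc. apply filter_imp. auto.
  - intro v. apply Cmod_ge_0.
  - intros v hv. left. now apply ind.
  - exists z0. rewrite Cminus_self, Cmod_0. lra.
  - assert (hv0 : (Cmod (g v - g z) < m / 2)%R).
    { eapply Rle_lt_trans; [apply (hvm z0) |]; [rewrite Cminus_self, Cmod_0; lra |]. now rewrite Cmod_minus_sym. }
    assert (hint : (Cmod (v - z0) < e')%R).
    { destruct hv as [hv | hv]; [exact hv |]. exfalso.
      destruct (unit_expi ((v - z0) / RtoC e')) as [t [ht et]].
      { assert (RtoC e' <> 0) by (intro e0; apply RtoC_inj in e0; lra).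
        rewrite Cmod_div, hv, Cmod_RtoC_nonneg by (auto; lra). field. lra. }
      assert (ev : v = z0 + RtoC e' * expi t).
      { rewrite <- et. field. intro e0. apply RtoC_inj in e0. lra. }
      assert (hmt : (m <= Cmod (g v - g z0))%R) by (rewrite ev; apply hmin; lra).
      pose proof (Cmod_triangle (g v - g z) (g z - g z0)) as ht2.
      replace (g v - g z + (g z - g z0)) with (g v - g z0) in ht2 by ring. lra. }
    destruct (classic (g v = g z)) as [eg | ng].
    + apply inj in eg; [| now apply ind | exact hz]. rewrite <- eg. lra.
    + exfalso. destruct (descend g v (g z) (d v) (e' - Cmod (v - z0)) (hg v (ind v hv)) (hd v (ind v hv)) ng) as [v' [h1 h2]]; [lra |].
      assert (hv' : (Cmod (v' - z0) <= e')%R).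
      { pose proof (Cmod_triangle (v' - v) (v - z0)) as h3. replace (v' - v + (v - z0)) with (v' - z0) in h3 by ring. lra. }
      pose proof (hvm v' hv'). lra.
Qed.

Lemma cder_of_quotient (f E : C -> C) (z l : C) : near z (fun w => f w = f z + E w * (w - z)) ->
  clim (near z) E l -> cder f z l.
Proof.
  intros h cE. apply cder_ext_loc with (fun w => f z + E w * (w - z)).
  - revert h. apply filter_imp. intros w e. now symmetry.
  - exists E. split; [intro w; ring | exact cE].
Qed.

(** Here [om] is the inverse of g composed with G, given through g (om w) = G w so that no inverse
    function on the image is named. Its difference quotient is that of G divided by that of g along
    [om]. *)
Lemma inverse_branch_cder (G om : C -> C) (z l : C) : (Cmod z < 1)%R -> cder G z l ->
  (forall w, (Cmod w < 1)%R -> (Cmod (om w) < 1)%R /\ g (om w) = G w) ->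
  cder om z (l / d (om z)).
Proof.
  intros hz hG hom. destruct (hom z hz) as [hoz egz].
  assert (cG := cder_near G z l hG).
  assert (com : clim (near z) om (om z)).
  { intros e he. destruct (inverse_cont (om z) e hoz he) as [del [hdel hh]].
    assert (nd : near z (fun w => (Cmod w < 1)%R)) by now apply (near_disk z 1).
    generalize (filter_and _ _ nd (cG del hdel)). apply filter_imp. intros w [hw1 hw2].
    destruct (hom w hw1) as [h1 h2]. apply hh; [exact h1 |]. now rewrite h2, egz. }
  destruct hG as [E [hE cE]]. destruct (hg (om z) hoz) as [F [hF cF]].
  pose proof (hd (om z) hoz) as hl.
  assert (cFo : clim (near z) (fun w => F (om w)) (d (om z))) by now apply clim_comp with (om z).
  apply cder_of_quotient with (fun w => E w / F (om w)).
  - assert (hlm : (0 < Cmod (d (om z)))%R) by now apply Cmod_gt_0.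
    assert (nd : near z (fun w => (Cmod w < 1)%R)) by now apply (near_disk z 1).
    generalize (filter_and _ _ nd (cFo _ hlm)). apply filter_imp. intros w [hw1 hw2].
    assert (hF0 : F (om w) <> 0).
    { intro e. rewrite e in hw2. replace (0 - d (om z)) with (- d (om z)) in hw2 by ring. rewrite Cmod_opp in hw2. lra. }
    destruct (hom w hw1) as [_ h2]. pose proof (hF (om w)) as h3. rewrite h2, egz, (hE w) in h3.
    assert (h4 : F (om w) * (om w - om z) = E w * (w - z)).
    { transitivity (G z + F (om w) * (om w - om z) - G z); [ring |]. rewrite <- h3. ring. }
    replace (E w / F (om w) * (w - z)) with (E w * (w - z) / F (om w)) by (field; exact hF0).
    rewrite <- h4. field. exact hF0.
  - apply clim_mult; [exact cE |]. now apply clim_inv.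
Qed.

End Inverse.

(** * Schwarz's lemma and derivatives on the open disk *)

Lemma holo_dilate_real (s : R) (f : C -> C) : (0 < s < 1)%R -> holo 1 f -> holo (/ s) (fun z => f (RtoC s * z)).
Proof.
  intros hs hf. apply (holo_dilate (/ s) s); [lra | rewrite Cmod_RtoC_nonneg; lra |].
  now rewrite Rinv_r by lra.
Qed.

Lemma inv_gt_1 (s : R) : (0 < s < 1)%R -> (1 < / s)%R.
Proof. intro h. rewrite <- Rinv_1. apply Rinv_lt_contravar; lra. Qed.

Lemma holo_divide_id (f : C -> C) : holo 1 f -> f 0 = 0 ->
  exists h, holo 1 h /\ forall z, (Cmod z < 1)%R -> f z = z * h z.
Proof.
  intros hf f0. assert (hs : (0 < / 2 < 1)%R) by lra.
  destruct (holo_divide_id_1 (/ / 2) (fun z => f (RtoC (/ 2) * z))) as [k [hk ek]].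
  - now apply inv_gt_1.
  - now apply holo_dilate_real.
  - now rewrite Cmult_0_r.
  (* The quotient for the half-scale dilate extends past the unit circle; f w = 2 w k(2 w) near 0
     shows that the missing value is 2 k 0. *)
  - exists (fun z : C => if excluded_middle_informative (z = RtoC 0) then 2 * k 0 else f z / z).
    split.
    + intros z hz. destruct (classic (z = 0)) as [-> | nz].
      * destruct (hk (2 * 0)) as [l hl]; [rewrite Cmult_0_r, Cmod_0; lra |].
        exists (2 * (l * (2 * 1))). apply cder_ext_loc with (fun w => 2 * k (2 * w)).
        -- exists (/ 2)%R. split; [lra |]. intros w hw. replace (w - 0) with w in hw by ring.
           destruct (excluded_middle_informative (w = RtoC 0)) as [-> | nw]; [now rewrite Cmult_0_r |].
           assert (h2 : (Cmod (2 * w) < 1)%R) by (rewrite Cmod_mult, Cmod_RtoC_nonneg; lra).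
           specialize (ek _ h2).
           assert (e2 : RtoC (/ 2) * (2 * w) = w) by (rewrite RtoC_inv by lra; field).
           rewrite e2 in ek. rewrite ek. field. exact nw.
        -- apply cder_scal. apply (cder_comp k (fun w => 2 * w)); [exact hl |]. apply cder_scal, cder_id.
      * destruct (hf z hz) as [l hl].
        eexists. apply cder_ext_loc with (fun w => f w / w).
        -- exists (Cmod z). split; [now apply Cmod_gt_0 |]. intros w hw.
           destruct (excluded_middle_informative (w = RtoC 0)) as [-> | nw]; [| reflexivity].
           exfalso. rewrite Cmod_minus_sym in hw. replace (z - 0) with z in hw by ring. lra.
        -- apply cder_div; [exact nz | exact hl | apply cder_id].
    + intros z hz. destruct (excluded_middle_informative (z = RtoC 0)) as [-> | nz].
      * rewrite f0. ring.
      * field. exact nz.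
Qed.

Lemma Schwarz_lemma (f : C -> C) (z : C) : holo 1 f -> f 0 = 0 -> (forall w, (Cmod w < 1)%R -> (Cmod (f w) < 1)%R) ->
  (Cmod z < 1)%R -> (Cmod (f z) <= Cmod z)%R.
Proof.
  intros hf f0 hb hz. destruct (holo_divide_id f hf f0) as [h [hh eh]].
  rewrite eh, Cmod_mult by exact hz. rewrite <- (Rmult_1_r (Cmod z)) at 2.
  apply Rmult_le_compat_l; [apply Cmod_ge_0 |].
  apply Rnot_lt_le. intro hgt. set (m := Cmod (h z)) in *.
  assert (him : (0 < / m < 1)%R) by (split; [apply Rinv_0_lt_compat; lra | rewrite <- Rinv_1; apply Rinv_lt_contravar; lra]).
  pose proof (Cmod_ge_0 z).
  (* A radius s above |z| and above 1/m: the maximum principle on |w| = s gives m <= 1/s < m. *)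
  set (s := ((1 + Rmax (Cmod z) (/ m)) / 2)%R).
  assert (hmax : (Rmax (Cmod z) (/ m) < 1)%R) by (apply Rmax_lub_lt; lra).
  pose proof (Rmax_l (Cmod z) (/ m)). pose proof (Rmax_r (Cmod z) (/ m)).
  assert (hs : (0 < s < 1)%R) by (unfold s; lra).
  assert (hzs : (Cmod z < s)%R) by (unfold s; lra).
  assert (hms : (/ m < s)%R) by (unfold s; lra).
  assert (s0 : RtoC s <> 0) by (apply RtoC_neq_0; lra).
  assert (hle : (m <= / s)%R).
  { unfold m. replace z with (RtoC s * (z / RtoC s)) by (field; exact s0).
    apply (max_modulus (/ s) (fun w => h (RtoC s * w)) (z / RtoC s)); [now apply inv_gt_1 | now apply holo_dilate_real | |].
    - rewrite Cmod_div, Cmod_RtoC_nonneg by (lra || auto). apply Rmult_lt_reg_r with s; [lra |].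
      unfold Rdiv. rewrite Rmult_assoc, Rinv_l by lra. lra.
    - intro t. assert (hm : Cmod (RtoC s * expi t) = s) by (rewrite Cmod_mult, Cmod_expi, Cmod_RtoC_nonneg; lra).
      assert (hl : (Cmod (RtoC s * expi t) < 1)%R) by lra.
      pose proof (hb _ hl) as hb'. rewrite eh, Cmod_mult, hm in hb' by exact hl.
      apply Rmult_le_reg_l with s; [lra |]. rewrite Rinv_r by lra. lra. }
  assert (/ s < m)%R; [| lra]. rewrite <- (Rinv_inv m). apply Rinv_lt_contravar; [| exact hms].
  apply Rmult_lt_0_compat; lra.
Qed.

Lemma C_derive_holo (f : C -> C) : holo 1 f -> holo 1 (C_derive f).
Proof.
  intros hf z hz. pose proof (Cmod_ge_0 z).
  set (s := ((1 + Cmod z) / 2)%R). assert (hs : (0 < s < 1)%R) by (unfold s; lra).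
  assert (hzs : (Cmod z < s)%R) by (unfold s; lra).
  assert (s0 : RtoC s <> 0) by (apply RtoC_neq_0; lra).
  assert (hdiv : forall w, (Cmod w < s)%R -> (Cmod (w / RtoC s) < 1)%R).
  { intros w hw. rewrite Cmod_div, Cmod_RtoC_nonneg by (lra || auto).
    apply Rmult_lt_reg_r with s; [lra |]. unfold Rdiv. rewrite Rmult_assoc, Rinv_l; lra. }
  destruct (C_derive_holo_1 (/ s) (fun w => f (RtoC s * w)) (z / RtoC s)) as [l hl];
    [now apply inv_gt_1 | now apply holo_dilate_real | now apply hdiv |].
  exists (/ RtoC s * (l * (/ RtoC s * 1))).
  apply cder_ext_loc with (fun w => / RtoC s * C_derive (fun w => f (RtoC s * w)) (/ RtoC s * w)).
  - apply (near_disk z s); [exact hzs |]. intros w hw.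
    assert (hw1 : (Cmod w < 1)%R) by lra.
    rewrite (cder_C_derive (fun w => f (RtoC s * w)) _ (C_derive f w * (RtoC s * 1))).
    + field. exact s0.
    + apply cder_comp; [| apply cder_scal, cder_id].
      replace (RtoC s * (/ RtoC s * w)) with w by (field; exact s0). now apply (holo_C_derive 1).
  - apply cder_scal.
    apply (cder_comp (C_derive (fun w => f (RtoC s * w))) (fun w => / RtoC s * w)); [| apply cder_scal, cder_id].
    replace (/ RtoC s * z) with (z / RtoC s) by (field; exact s0). exact hl.
Qed.

(** * The strict support property of convex functions *)

Section ConvexSupport.

Variable g : C -> C.
Let d := C_derive g.
Hypothesis hg : holo 1 g.
Hypothesis hd : forall z, (Cmod z < 1)%R -> d z <> 0.
Hypothesis inj : forall z w, (Cmod z < 1)%R -> (Cmod w < 1)%R -> g z = g w -> z = w.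
Hypothesis conv : convex_set (image g unit_disk).
Hypothesis g0 : g 0 = 0.
Hypothesis d0 : d 0 = 1.

Lemma convex_cder (z : C) : (Cmod z < 1)%R -> cder g z (d z).
Proof. intro hz. now apply (holo_C_derive 1). Qed.

(** The inverse of g, applied to the convex combination of g(z) and g(xz), is an analytic self-map
    of the disk fixing 0; Schwarz's lemma applies to it. *)
Lemma convex_combination_in_disk (x z : C) (t : R) : Cmod x = 1%R -> (Cmod z < 1)%R -> (0 <= t <= 1)%R ->
  exists w, (Cmod w <= Cmod z)%R /\ g w = RtoC (1 - t) * g z + RtoC t * g (x * z).
Proof.
  intros hx hz ht.
  assert (hxd : forall z, (Cmod z < 1)%R -> (Cmod (x * z) < 1)%R) by (intros; rewrite Cmod_mult, hx; lra).
  (* The membership hypothesis stands under the existential, so that choice gives a function on all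
     of C. *)
  assert (ex : forall z, exists w, (Cmod z < 1)%R -> (Cmod w < 1)%R /\ g w = RtoC (1 - t) * g z + RtoC t * g (x * z)).
  { intro v. destruct (classic (Cmod v < 1)%R) as [hv | hv]; [| exists 0; intro; contradiction].
    destruct (conv (g v) (g (x * v)) t) as [w [hw ew]]; auto.
    - exists v. auto.
    - exists (x * v). split; [now apply hxd | reflexivity].
    - exists w. intros _. split; [exact hw | now symmetry]. }
  set (om := fun z => proj1_sig (constructive_indefinite_description _ (ex z))).
  assert (hom : forall z, (Cmod z < 1)%R -> (Cmod (om z) < 1)%R /\ g (om z) = RtoC (1 - t) * g z + RtoC t * g (x * z)).
  { intro v. exact (proj2_sig (constructive_indefinite_description _ (ex v))). }
  exists (om z). split; [| now apply hom].
  apply Schwarz_lemma; [| | intros w hw; now apply hom | exact hz].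
  - intros v hv. eexists.
    apply (inverse_branch_cder g d convex_cder hd inj (fun z => RtoC (1 - t) * g z + RtoC t * g (x * z))); [exact hv | | exact hom].
    apply cder_plus; apply cder_scal; [now apply convex_cder |].
    apply (cder_comp g (fun z => x * z)); [now apply convex_cder, hxd | apply cder_scal, cder_id].
  - assert (h0 : (Cmod 0 < 1)%R) by (rewrite Cmod_0; lra).
    apply inj; [now apply hom | exact h0 |]. rewrite (proj2 (hom 0 h0)), Cmult_0_r, !g0. ring.
Qed.

Lemma Re_div_sign (a z : C) : z <> 0 -> Re (a / z) = (/ (Cmod z * Cmod z) * Re (a * Cconj z))%R.
Proof.
  intro h. assert (hm : (0 < Cmod z)%R) by now apply Cmod_gt_0.
  rewrite <- Re_RtoC_mult, RtoC_inv, <- Cconj_mult_self by nra. f_equal.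
  assert (Cconj z <> 0) by (intro e; apply h; rewrite <- (Cconj_conj z), e; apply C_eq; simpl; ring).
  field. auto.
Qed.

(** For small t the point w of [convex_combination_in_disk] is z + t c / g'(z) up to o(t), with c =
    g(xz) - g(z). It cannot leave the disk of radius |z|, so its first-order move is not outward. *)
Lemma convex_support_weak (x z : C) : Cmod x = 1%R -> (Cmod z < 1)%R -> z <> 0 ->
  (0 <= Re ((g z - g (x * z)) / (z * d z)))%R.
Proof.
  intros hx hz nz. set (c := g (x * z) - g z). pose proof (hd z hz) as hdz.
  assert (hmz : (0 < Cmod z)%R) by now apply Cmod_gt_0.
  replace ((g z - g (x * z)) / (z * d z)) with (- (c / d z) / z) by (unfold c; field; auto).
  rewrite Re_div_sign by exact nz.
  apply Rmult_le_pos; [left; apply Rinv_0_lt_compat; nra |].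
  replace (- (c / d z) * Cconj z) with (- (c / d z * Cconj z)) by ring.
  change (0 <= - Re (c / d z * Cconj z))%R.
  apply Rnot_lt_le. intro hneg. set (e := Re (c / d z * Cconj z)) in *.
  assert (he : (0 < e)%R) by lra.
  destruct (convex_cder z hz) as [E [hE cE]].
  assert (cl : clim (near z) (fun w => c / E w * Cconj z) (c / d z * Cconj z)).
  { apply clim_mult; [| apply clim_const]. apply clim_mult; [apply clim_const |]. now apply clim_inv. }
  assert (hdm : (0 < Cmod (d z))%R) by now apply Cmod_gt_0.
  destruct (filter_and _ _ (cl e he) (cE _ hdm)) as [del [hdel hn]].
  destruct (inverse_cont g d convex_cder hd inj z del hz hdel) as [del2 [hdel2 hi]].
  pose proof (Cmod_ge_0 c) as hc0.
  set (t := Rmin 1 (del2 / (2 * (Cmod c + 1)))).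
  assert (ht : (0 < t)%R) by (apply Rmin_pos; [lra |]; apply Rdiv_lt_0_compat; lra).
  assert (ht1 : (t <= 1)%R) by apply Rmin_l.
  assert (ht2 : (t * Cmod c < del2)%R).
  { apply Rle_lt_trans with (del2 / (2 * (Cmod c + 1)) * (Cmod c + 1))%R.
    - apply Rmult_le_compat; try lra. apply Rmin_r.
    - replace (del2 / (2 * (Cmod c + 1)) * (Cmod c + 1))%R with (del2 / 2)%R by (field; lra). lra. }
  destruct (convex_combination_in_disk x z t hx hz) as [w [hw ew]]; [lra |].
  assert (egw : g w - g z = RtoC t * c) by (rewrite ew, RtoC_minus; unfold c; ring).
  assert (hwz : (Cmod (w - z) < del)%R).
  { apply hi; [lra |]. rewrite egw, Cmod_mult, Cmod_RtoC_nonneg by lra. exact ht2. }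
  destruct (hn w hwz) as [h1 h2]. cbv beta in h1, h2.
  assert (hE0 : E w <> 0).
  { intro e0. rewrite e0 in h2. replace (0 - d z) with (- d z) in h2 by ring. rewrite Cmod_opp in h2. lra. }
  assert (ewz : w - z = RtoC t * (c / E w)).
  { replace (RtoC t * (c / E w)) with (RtoC t * c / E w) by (field; exact hE0). rewrite <- egw, (hE w). field. exact hE0. }
  assert (hpos : (0 < Re (c / E w * Cconj z))%R).
  { pose proof (Re_le_mod (c / E w * Cconj z - c / d z * Cconj z)) as hr. rewrite Re_minus in hr. fold e in hr.
    apply Rabs_le_between in hr. lra. }
  assert (hpos2 : (0 < Re ((w - z) * Cconj z))%R).
  { rewrite ewz, <- Cmult_assoc, Re_RtoC_mult. now apply Rmult_lt_0_compat. }
  assert (hsq : (Cmod w * Cmod w <= Cmod z * Cmod z)%R) by (pose proof (Cmod_ge_0 w); nra).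
  rewrite !Cmod_sqr in hsq. clear - hsq hpos2.
  destruct w as [a b], z as [a' b']. unfold Re, Im in *. simpl in *.
  pose proof (Rle_0_sqr (a - a')). pose proof (Rle_0_sqr (b - b')). unfold Rsqr in *. lra.
Qed.

(** As a function of z the quotient extends analytically to 0 with value 1 - x, whose real part is
    positive. Its real part is nonnegative elsewhere, and Harnack's inequality makes it strictly
    positive. *)
Lemma convex_support (x z : C) : Cmod x = 1%R -> x <> 1 -> (Cmod z < 1)%R -> z <> 0 ->
  (0 < Re ((g z - g (x * z)) / (z * d z)))%R.
Proof.
  intros hx nx hz nz.
  assert (hxd : forall z, (Cmod z < 1)%R -> (Cmod (x * z) < 1)%R) by (intros; rewrite Cmod_mult, hx; lra).
  assert (der : forall z, (Cmod z < 1)%R -> cder (fun z => g z - g (x * z)) z (d z - d (x * z) * (x * 1))).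
  { intros v hv. apply cder_minus; [now apply convex_cder |].
    apply (cder_comp g (fun z => x * z)); [now apply convex_cder, hxd | apply cder_scal, cder_id]. }
  destruct (holo_divide_id (fun z => g z - g (x * z))) as [h [hh eh]].
  - intros v hv. eexists. now apply der.
  - rewrite Cmult_0_r. ring.
  - assert (h0 : (Cmod 0 < 1)%R) by (rewrite Cmod_0; lra).
    assert (eh0 : h 0 = 1 - x).
    { destruct (hh 0 h0) as [l hl].
      assert (e1 : C_derive (fun z => g z - g (x * z)) 0 = 1 * h 0 + 0 * l).
      { apply cder_C_derive. apply cder_ext_loc with (fun z => z * h z).
        - apply (near_disk 0 1); [exact h0 |]. intros w hw. now rewrite eh.
        - apply cder_mult; [apply cder_id | exact hl]. }
      rewrite (cder_C_derive _ _ _ (der 0 h0)), Cmult_0_r, d0 in e1.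
      transitivity (1 * h 0 + 0 * l); [ring |]. rewrite <- e1. ring. }
    set (B := fun z => h z / d z).
    assert (hB : holo 1 B) by (apply holo_div; [exact hh | now apply C_derive_holo | exact hd]).
    assert (eB : forall v, (Cmod v < 1)%R -> v <> 0 -> (g v - g (x * v)) / (v * d v) = B v).
    { intros v hv nv. rewrite eh by exact hv. unfold B. pose proof (hd v hv). field. auto. }
    rewrite eB by auto.
    assert (hmz : (0 < Cmod z)%R) by now apply Cmod_gt_0.
    set (s := ((1 + Cmod z) / 2)%R). assert (hs : (0 < s < 1)%R) by (unfold s; lra).
    assert (hzs : (Cmod z < s)%R) by (unfold s; lra).
    assert (s0 : RtoC s <> 0) by (apply RtoC_neq_0; lra).
    assert (hz1 : (Cmod (z / RtoC s) < 1)%R).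
    { rewrite Cmod_div, Cmod_RtoC_nonneg by (lra || auto).
      apply Rmult_lt_reg_r with s; [lra |]. unfold Rdiv. rewrite Rmult_assoc, Rinv_l; lra. }
    destruct (Harnack (/ s) (fun w => B (RtoC s * w)) (z / RtoC s)) as [_ p];
      [now apply inv_gt_1 | now apply holo_dilate_real | exact hz1 | |].
    + intro t. assert (hm : Cmod (RtoC s * expi t) = s) by (rewrite Cmod_mult, Cmod_expi, Cmod_RtoC_nonneg; lra).
      assert (n0 : RtoC s * expi t <> 0) by (apply Cmult_neq_0; [exact s0 | apply expi_neq_0]).
      rewrite <- eB by (auto; lra). apply convex_support_weak; auto. lra.
    + rewrite Cmult_0_r in p. replace (RtoC s * (z / RtoC s)) with z in p by (field; exact s0).
      eapply Rlt_le_trans; [| exact p]. apply Rmult_lt_0_compat.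
      * pose proof (Cmod_ge_0 (z / RtoC s)). apply Rdiv_lt_0_compat; lra.
      * unfold B. rewrite eh0, d0. replace ((1 - x) / 1) with (1 - x) by field.
        rewrite Re_minus. simpl (Re 1).
        pose proof (Cmod_sqr x) as hq. rewrite hx in hq.
        apply Rnot_le_lt. intro hle. apply nx.
        assert (Re x = 1%R) by nra. assert (Im x = 0%R) by nra. apply C_eq; simpl; assumption.
Qed.

End ConvexSupport.

(** * From the class to the region *)

Lemma analytic_holo (f : C -> C) : analytic_on_disk f <-> holo 1 f.
Proof.
  split; intros h z hz; destruct (h z hz) as [l hl]; exists l; now apply cder_is_derive.
Qed.

(** Dilation by s = r/q makes g and f'/g' analytic beyond the closed disk, and s(qt) = rt keeps the
    integral equal to f(r)/r; the price is q in place of r. *)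
Lemma close_to_convex_region (f : C -> C) (r q : R) : close_to_convex f -> (0 < r)%R -> (r < q < 1)%R ->
  exists s : C, (Cmod (s - 1) <= q)%R /\
    (Cmod (2 * (f (RtoC r) / RtoC r) * s ^ 2 - 1 - s)%C <= Cmod (1 - s))%R.
Proof.
  intros [hf [[f0 f1] [g [lam [[hg [[g0 g1] [inj conv]]] [_ hp]]]]]] hr hq.
  apply analytic_holo in hf. apply analytic_holo in hg.
  set (d := C_derive g) in *. set (p := fun z => C_derive f z / d z).
  assert (hd : forall z, (Cmod z < 1)%R -> d z <> 0).
  (* Division is total with value 0 at the denominator 0, so a zero of g' would contradict the
     strict positivity in [hp]. *)
  { intros z hz e. specialize (hp z hz). rewrite e in hp.
    replace (C_derive f z / 0) with (RtoC 0) in hp.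
    - rewrite Cmult_0_r in hp. simpl in hp. lra.
    - unfold Cdiv. apply C_eq; simpl; unfold Rdiv; ring. }
  assert (d1 : d 0 = 1) by (replace (d 0) with (d 0 - 1 + 1) by ring; rewrite g1; ring).
  assert (df1 : C_derive f 0 = 1) by (replace (C_derive f 0) with (C_derive f 0 - 1 + 1) by ring; rewrite f1; ring).
  assert (hhd : holo 1 d) by now apply C_derive_holo.
  assert (hhp : holo 1 p) by (apply holo_div; [now apply C_derive_holo | exact hhd | exact hd]).
  set (s := (r / q)%R).
  assert (hs : (0 < s < 1)%R).
  { unfold s. split; [apply Rdiv_lt_0_compat; lra |]. apply Rmult_lt_reg_r with q; [lra |].
    unfold Rdiv. rewrite Rmult_assoc, Rinv_l; lra. }
  assert (s0 : RtoC s <> 0) by (apply RtoC_neq_0; lra).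
  assert (sd : forall z, (Cmod z < / s)%R -> (Cmod (RtoC s * z) < 1)%R).
  { intros z hz. rewrite Cmod_mult, Cmod_RtoC_nonneg by lra.
    rewrite <- (Rinv_r s) by lra. apply Rmult_lt_compat_l; lra. }
  assert (hq1 : (0 < q < 1)%R) by lra.
  destruct (region_on_circle (/ s) (fun z => / RtoC s * g (RtoC s * z)) (fun z => d (RtoC s * z)) (fun z => p (RtoC s * z)) (expi lam) q) as [v hv].
  - now apply inv_gt_1.
  - exact hq1.
  - intros z hz. eapply cder_unique_at.
    + apply cder_scal. apply (cder_comp g (fun z => RtoC s * z)); [now apply (holo_C_derive 1), sd | apply cder_scal, cder_id].
    + fold d. field. exact s0.
  - now apply holo_dilate_real.
  - intros z hz. now apply hd, sd.
  - intros z w hz hw n.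
    assert (z0 : z <> 0) by now apply unit_neq_0.
    assert (hsz : (Cmod (RtoC s * z) < 1)%R) by (rewrite Cmod_mult, hz, Cmod_RtoC_nonneg; lra).
    replace ((/ RtoC s * g (RtoC s * z) - / RtoC s * g (RtoC s * w)) / (z * d (RtoC s * z)))
      with ((g (RtoC s * z) - g (w / z * (RtoC s * z))) / (RtoC s * z * d (RtoC s * z))).
    + apply (convex_support g); auto.
      * rewrite Cmod_div, hz, hw by auto. field.
      * intro e. apply n. replace w with (w / z * z) by (field; exact z0). rewrite e. ring.
      * now apply Cmult_neq_0.
    + replace (w / z * (RtoC s * z)) with (RtoC s * w) by (field; exact z0). pose proof (hd _ hsz). field. auto.
  - now rewrite Cmult_0_r.
  - now apply holo_dilate_real.
  - rewrite Cmult_0_r. unfold p. rewrite d1, df1. field.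
  - intros z hz. exact (hp _ (sd z hz)).
  - exists v.
    assert (r0 : RtoC r <> 0) by (apply RtoC_neq_0; lra).
    assert (e : CInt (fun t => d (RtoC s * RtoC (q * t)) * p (RtoC s * RtoC (q * t))) 0 1 = f (RtoC r) / RtoC r).
    { assert (hrt : forall t, (0 <= t <= 1)%R -> (Cmod (RtoC (r * t)) < 1)%R) by (intros; rewrite Cmod_RtoC_nonneg; nra).
      rewrite (CInt_ext _ (fun t => C_derive f (RtoC (r * t)))).
      - rewrite (CInt_derive (fun t => / RtoC r * f (RtoC (r * t)))).
        + rewrite Rmult_1_r, Rmult_0_r, f0. field. exact r0.
        + lra.
        + intros t ht. eapply rder_unique_at.
          * apply rder_mult; [apply rder_const |].
            apply (rder_comp f (fun t => RtoC (r * t))); [apply (holo_C_derive 1); [exact hf | now apply hrt] |].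
            apply (is_derive_rder (fun t => r * t)%R (fun _ => 0%R) t r 0).
            -- auto_derive; [exact I | ring].
            -- apply (is_derive_const (V := R_NormedModule)).
          * simpl. change (r, 0%R) with (RtoC r). field. exact r0.
        + intros t ht. apply (clim_near_comp (C_derive f) (fun t => RtoC (r * t))).
          * apply (holo_clim 1); [now apply C_derive_holo | now apply hrt].
          * apply qt_cont.
      - lra.
      - intros t ht. assert (et : RtoC s * RtoC (q * t) = RtoC (r * t)).
        { rewrite <- RtoC_mult. f_equal. unfold s. field. lra. }
        rewrite et. unfold p. pose proof (hd _ (hrt t ht)). field. assumption. }
    rewrite e in hv. exact hv.
Qed.

(** * Parametrization of the region *)

Lemma negative_first_order (T c2 c3 c4 : R) : (T < 0)%R -> exists e0, (0 < e0)%R /\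
  forall e, (0 < e < e0)%R -> (e * T + e * e * (c2 + e * c3 + e * e * c4) < 0)%R.
Proof.
  intro hT. set (M := (Rabs c2 + Rabs c3 + Rabs c4 + 1)%R).
  pose proof (Rabs_pos c2). pose proof (Rabs_pos c3). pose proof (Rabs_pos c4).
  assert (hM : (0 < M)%R) by (unfold M; lra).
  assert (hd : (0 < - T / M)%R) by (apply Rdiv_lt_0_compat; lra).
  exists (Rmin 1 (- T / M)). split; [apply Rmin_pos; lra |]. intros e he.
  assert (e1 : (e < 1)%R) by (eapply Rlt_le_trans; [apply he | apply Rmin_l]).
  assert (e2 : (e < - T / M)%R) by (eapply Rlt_le_trans; [apply he | apply Rmin_r]).
  assert (e3 : (e * M < - T)%R).
  { apply Rmult_lt_reg_r with (/ M)%R; [now apply Rinv_0_lt_compat |].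
    rewrite Rmult_assoc, Rinv_r by lra. unfold Rdiv in e2. lra. }
  assert (hb : (c2 + e * c3 + e * e * c4 <= M)%R).
  { pose proof (Rle_abs c2). pose proof (Rle_abs c3). pose proof (Rle_abs c4).
    assert (e * c3 <= Rabs c3)%R by nra.
    assert (e * e <= 1)%R by nra. assert (e * e * c4 <= Rabs c4)%R by nra. unfold M. lra. }
  assert (0 < e * e)%R by nra.
  apply Rle_lt_trans with (e * T + e * e * M)%R; [nra |].
  replace (e * T + e * e * M)%R with (e * (T + e * M))%R by ring. nra.
Qed.

Section Region.

Variable phi : C.

(** This is 2 phi s^2 - 1 - s at s = 1 + z, so the region is |[wfun] z| <= |z|. *)
Definition wfun (z : C) : C := 2 * phi * (1 + z) ^ 2 - 2 - z.

(* If both first-order variations along [z (1 + e dl)] were negative, the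
   constraint [|w| <= |z|] would persist at a smaller modulus. *)
Lemma shrink (z dl : C) : z <> 0 -> Cmod (wfun z) = Cmod z -> (Re dl < 0)%R ->
  (Re ((Cconj (wfun z) * (4 * phi * (1 + z) - 1) * z - RtoC (Cmod z * Cmod z)) * dl) < 0)%R ->
  exists z', (Cmod z' < Cmod z)%R /\ (Cmod (wfun z') <= Cmod z')%R.
Proof.
  intros hz hw h1 h2.
  assert (hm : (0 < Cmod z)%R) by now apply Cmod_gt_0.
  set (w := wfun z) in *. set (a := (4 * phi * (1 + z) - 1) * z * dl). set (b := 2 * phi * (z * z) * (dl * dl)).
  assert (ew : forall e, wfun (z * (1 + RtoC e * dl)) = w + RtoC e * a + RtoC (e * e) * b).
  { intro e. rewrite RtoC_mult. unfold w, wfun, a, b. ring. }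
  assert (ez : forall e, (Cmod (z * (1 + RtoC e * dl)) * Cmod (z * (1 + RtoC e * dl)) =
     Cmod z * Cmod z * (1 + 2 * e * Re dl + e * e * (Re dl * Re dl + Im dl * Im dl)))%R).
  { intro e. rewrite !Cmod_mult.
    replace (Cmod z * Cmod (1 + RtoC e * dl) * (Cmod z * Cmod (1 + RtoC e * dl)))%R
      with (Cmod z * Cmod z * (Cmod (1 + RtoC e * dl) * Cmod (1 + RtoC e * dl)))%R by ring.
    rewrite (Cmod_sqr (1 + _)). f_equal. destruct dl. unfold Re, Im. simpl. ring. }
  set (dd := (Re dl * Re dl + Im dl * Im dl)%R) in *.
  set (mm := (Cmod z * Cmod z)%R) in *. assert (hmm : (0 < mm)%R) by (unfold mm; nra).
  assert (ewz : (Re w * Re w + Im w * Im w = mm)%R) by (rewrite <- Cmod_sqr, hw; reflexivity).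
  assert (eT : Re ((Cconj w * (4 * phi * (1 + z) - 1) * z - RtoC mm) * dl) = (Re w * Re a + Im w * Im a - mm * Re dl)%R).
  { replace ((Cconj w * (4 * phi * (1 + z) - 1) * z - RtoC mm) * dl) with (Cconj w * a - RtoC mm * dl) by (unfold a; ring).
    rewrite Re_minus, Re_RtoC_mult. clearbody w a. destruct w, a. unfold Re, Im. simpl. ring. }
  rewrite eT in h2. set (T := (Re w * Re a + Im w * Im a - mm * Re dl)%R) in *.
  destruct (negative_first_order (2 * Re dl) dd 0 0) as [x1 [hx1 k1]]; [lra |].
  destruct (negative_first_order (2 * T) (Re a * Re a + Im a * Im a + 2 * (Re w * Re b + Im w * Im b) - mm * dd)
    (2 * (Re a * Re b + Im a * Im b)) (Re b * Re b + Im b * Im b)) as [x2 [hx2 k2]]; [lra |].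
  set (e := (Rmin x1 x2 / 2)%R).
  assert (hx : (0 < Rmin x1 x2)%R) by now apply Rmin_pos.
  pose proof (Rmin_l x1 x2). pose proof (Rmin_r x1 x2).
  specialize (k1 e ltac:(unfold e; lra)). specialize (k2 e ltac:(unfold e; lra)).
  exists (z * (1 + RtoC e * dl)). specialize (ew e). specialize (ez e).
  set (z' := z * (1 + RtoC e * dl)) in *.
  pose proof (Cmod_ge_0 z'). pose proof (Cmod_ge_0 (wfun z')).
  split.
  - assert (Cmod z' * Cmod z' < Cmod z * Cmod z)%R; [| nra]. rewrite ez. fold mm.
    assert (2 * e * Re dl + e * e * dd < 0)%R by lra. nra.
  - assert (Cmod (wfun z') * Cmod (wfun z') < Cmod z' * Cmod z')%R; [| nra].
    rewrite ez, Cmod_sqr, ew.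
    assert (r1 : Re (w + RtoC e * a + RtoC (e * e) * b) = (Re w + e * Re a + e * e * Re b)%R).
    { change (Re w + Re (RtoC e * a) + Re (RtoC (e * e) * b) = Re w + e * Re a + e * e * Re b)%R. now rewrite !Re_RtoC_mult. }
    assert (r2 : Im (w + RtoC e * a + RtoC (e * e) * b) = (Im w + e * Im a + e * e * Im b)%R).
    { change (Im w + Im (RtoC e * a) + Im (RtoC (e * e) * b) = Im w + e * Im a + e * e * Im b)%R. now rewrite !Im_RtoC_mult. }
    rewrite r1, r2. rewrite <- ewz in k2 |- *. unfold T in k2. rewrite <- ewz in k2.
    clear - k2. nra.
Qed.

Lemma first_order_condition (A : C) : (forall dl, (Re dl < 0)%R -> ~ (Re (A * dl) < 0)%R) ->
  Im A = 0%R /\ (Re A <= 0)%R.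
Proof.
  intro h.
  assert (hi : Im A = 0%R).
  (* For dl = -1 + iy this y gives Re (A dl) = - Re A - |Re A| - 1 < 0. *)
  { apply NNPP. intro n. set (y := ((Rabs (Re A) + 1) / Im A)%R).
    apply (h ((-1)%R, y)); [simpl; lra |].
    assert (e : Re (A * ((-1)%R, y)) = (- Re A - (Rabs (Re A) + 1))%R).
    { transitivity (- Re A - Im A * y)%R; [destruct A; unfold Re, Im; simpl; ring |].
      unfold y. field. exact n. }
    rewrite e. pose proof (Rle_abs (- Re A)). rewrite Rabs_Ropp in H. lra. }
  split; [exact hi |]. apply Rnot_lt_le. intro hp.
  apply (h (RtoC (-1))); [simpl; lra |].
  rewrite Cmult_comm, Re_RtoC_mult. lra.
Qed.

Definition denF (z : C) : C := (3 + Cconj z) * (1 + z).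

Lemma Re_pos_shift (c : R) (z : C) : (Cmod z < c)%R -> RtoC c + z <> 0.
Proof.
  intros h. apply Re_pos_neq_0. pose proof (Re_le_mod z) as hr. apply Rabs_le_between in hr.
  change (0 < c + Re z)%R. lra.
Qed.

(* Two unimodular solutions: the envelope point [w = - z conj D / D] and [w = z];
   the latter is excluded by the sign of the multiplier. *)
Lemma envelope_point (z w : C) : (0 < Cmod z < 1)%R -> Cmod w = Cmod z ->
  Im (Cconj w * ((3 + z + 2 * w) / (1 + z)) * z) = 0%R ->
  (Re (Cconj w * ((3 + z + 2 * w) / (1 + z)) * z) <= Cmod z * Cmod z)%R ->
  w = - z * Cconj (denF z) / denF z.
Proof.
  intros hz hw him hre.
  set (m := (Cmod z * Cmod z)%R) in *. assert (hm : (0 < m)%R) by (unfold m; nra).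
  assert (z0 : z <> 0) by (intro e; rewrite e, Cmod_0 in hz; lra).
  assert (n1 : 1 + z <> 0) by (apply Re_pos_shift; lra).
  assert (n2 : 1 + Cconj z <> 0) by (apply Re_pos_shift; rewrite Cmod_conj; lra).
  assert (n3 : 3 + z <> 0) by (apply Re_pos_shift; lra).
  assert (n4 : 3 + Cconj z <> 0) by (apply Re_pos_shift; rewrite Cmod_conj; lra).
  (* Since |w| = |z|, X and X0 have equal modulus, and the vanishing imaginary part says Im X = Im
     X0. Hence Re X is Re X0, the envelope point, or - Re X0. *)
  set (X := - (Cconj w * z / RtoC m) * ((3 + z) / (1 + z))).
  set (X0 := (3 + Cconj z) / (1 + Cconj z)).
  assert (m0 : RtoC m <> 0) by (apply RtoC_neq_0; lra).
  assert (ww : Cconj w * w = RtoC m) by (rewrite Cmult_comm, Cconj_mult_self, hw; reflexivity).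
  assert (eB : Cconj w * ((3 + z + 2 * w) / (1 + z)) * z = RtoC m * (2 * z / (1 + z) - X)).
  { unfold X. replace (Cconj w * ((3 + z + 2 * w) / (1 + z)) * z) with ((Cconj w * (3 + z) + 2 * (Cconj w * w)) / (1 + z) * z) by (field; auto).
    rewrite ww. field. auto. }
  rewrite eB, Im_RtoC_mult in him. rewrite eB, Re_RtoC_mult in hre.
  assert (e2 : 2 * z / (1 + z) = RtoC 3 - Cconj X0).
  { unfold X0. rewrite Cdiv_conj by exact n2. rewrite !Cplus_conj, Cconj_conj.
    rewrite !Cconj_RtoC.
    replace (RtoC 3) with (1 + 2) by (rewrite <- RtoC_plus; f_equal; ring). field. exact n1. }
  rewrite e2 in him, hre.
  assert (hI : Im X = Im X0).
  { apply Rmult_integral in him. destruct him as [him | him]; [lra |].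
    rewrite !Im_minus in him. change (Im (Cconj X0)) with (- Im X0)%R in him.
    change (Im (RtoC 3)) with 0%R in him. lra. }
  assert (hM : (Re X * Re X + Im X * Im X = Re X0 * Re X0 + Im X0 * Im X0)%R).
  { rewrite <- !Cmod_sqr. f_equal.
    - unfold X, X0. rewrite Cmod_mult, Cmod_opp, !Cmod_div, Cmod_mult, Cmod_conj, hw, Cmod_RtoC_nonneg by (auto; lra).
      fold m. rewrite <- (Cmod_conj (3 + z)), <- (Cmod_conj (1 + z)), !Cplus_conj.
      rewrite !Cconj_RtoC. unfold Rdiv at 1. rewrite Rinv_r by lra. ring.
    - unfold X, X0. rewrite Cmod_mult, Cmod_opp, !Cmod_div, Cmod_mult, Cmod_conj, hw, Cmod_RtoC_nonneg by (auto; lra).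
      fold m. rewrite <- (Cmod_conj (3 + z)), <- (Cmod_conj (1 + z)), !Cplus_conj.
      rewrite !Cconj_RtoC. unfold Rdiv at 1. rewrite Rinv_r by lra. ring. }
  assert (hcase : Re X = Re X0 \/ Re X = (- Re X0)%R).
  { assert ((Re X - Re X0) * (Re X + Re X0) = 0)%R by (rewrite hI in hM; lra).
    apply Rmult_integral in H. destruct H; [left | right]; lra. }
  destruct hcase as [hc | hc].
  - assert (eX : X = X0) by now apply C_eq.
    assert (ec : Cconj w = - Cconj z * denF z / Cconj (denF z)).
    { unfold denF. rewrite Cmult_conj, !Cplus_conj, Cconj_conj.
      rewrite !Cconj_RtoC.
      replace (Cconj w) with (- (X * ((1 + z) / (3 + z)) * (RtoC m / z))) by (unfold X; field; auto).
      rewrite eX. unfold X0. replace (RtoC m) with (z * Cconj z) by apply Cconj_mult_self. field. auto. }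
    rewrite <- (Cconj_conj w), ec.
    assert (nD : Cconj (denF z) <> 0).
    { unfold denF. rewrite Cmult_conj, !Cplus_conj, Cconj_conj.
      rewrite !Cconj_RtoC. now apply Cmult_neq_0. }
    rewrite Cdiv_conj, Cmult_conj, Copp_conj, !Cconj_conj by exact nD. reflexivity.
  (* Here the real part is 3 |z|^2, above its bound |z|^2. *)
  - exfalso. rewrite Re_minus, Re_minus, hc in hre. simpl (Re (RtoC 3)) in hre.
    replace (Re (Cconj X0)) with (Re X0) in hre by (destruct X0; reflexivity). nra.
Qed.

(** Multiplication by D = [denF z] gives phi (1 + z)^2 D = E, the denominator of F. If phi were 0,
    then z - z conj D / D would be -2, although its modulus is at most 2|z| < 2. *)
Lemma F_param (z : C) : (Cmod z < 1)%R -> 2 * phi * (1 + z) ^ 2 = 2 + z - z * Cconj (denF z) / denF z ->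
  Cinv phi = F z /\ phi <> 0.
Proof.
  intros hz e.
  assert (n1 : 1 + z <> 0) by (apply Re_pos_shift; lra).
  assert (n4 : 3 + Cconj z <> 0) by (apply Re_pos_shift; rewrite Cmod_conj; lra).
  assert (nD : denF z <> 0) by now apply Cmult_neq_0.
  assert (eD : Cconj (denF z) = denF z - 2 * z + 2 * Cconj z).
  { unfold denF. rewrite Cmult_conj, !Cplus_conj, Cconj_conj.
    rewrite !Cconj_RtoC.
    replace (RtoC 3) with (1 + 2) by (rewrite <- RtoC_plus; f_equal; ring). ring. }
  set (E := 3 + 3 * z + Cconj z + z ^ 2).
  assert (e1 : phi * ((1 + z) ^ 2 * denF z) = E).
  { replace (phi * ((1 + z) ^ 2 * denF z)) with (/ 2 * (2 * phi * (1 + z) ^ 2) * denF z) by (field; apply RtoC_neq_0; lra).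
    rewrite e, eD.
    replace (/ 2 * (2 + z - z * (denF z - 2 * z + 2 * Cconj z) / denF z) * denF z)
      with (denF z + z ^ 2 - z * Cconj z) by (field; auto).
    unfold E, denF. replace (RtoC 3) with (1 + 2) by (rewrite <- RtoC_plus; f_equal; ring). ring. }
  assert (nE : phi <> 0).
  { intro e0. rewrite e0 in e. replace (2 * 0 * (1 + z) ^ 2) with (RtoC 0) in e by ring.
    assert (hm : (Cmod (z - z * Cconj (denF z) / denF z) < 2)%R).
    { unfold Cminus. eapply Rle_lt_trans; [apply Cmod_triangle |].
      rewrite Cmod_opp, Cmod_div, Cmod_mult, Cmod_conj by exact nD.
      assert (0 < Cmod (denF z))%R by now apply Cmod_gt_0.
      replace (Cmod z * Cmod (denF z) / Cmod (denF z))%R with (Cmod z) by (field; lra). lra. }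
    apply (Re_pos_shift 2 _ hm). rewrite e. unfold Cdiv. ring. }
  split; [| exact nE].
  unfold F. fold E. rewrite <- e1. unfold denF. field. auto.
Qed.

End Region.

(** The minimization runs over a fixed disk |z| <= r2 with r < r2 < 1, where the region is compact.
    Every q in (r, r2] supplies a competitor of modulus at most q, so the minimizer has modulus at
    most r. *)
Theorem region_in_image (phi : C) (r : R) : (0 < r < 1)%R ->
  (forall q, (r < q < 1)%R -> exists s : C, (Cmod (s - 1) <= q)%R /\ (Cmod (2 * phi * s ^ 2 - 1 - s)%C <= Cmod (1 - s))%R) ->
  phi <> 0 /\ exists z, (Cmod z <= r)%R /\ Cinv phi = F z.
Proof.
  intros hr h. set (r2 := ((1 + r) / 2)%R).
  set (K := fun z => (Cmod z <= r2)%R /\ (Cmod (wfun phi z) <= Cmod z)%R).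
  assert (hK : forall q, (r < q <= r2)%R -> exists z, K z /\ (Cmod z <= q)%R).
  { intros q hq. destruct (h q) as [s [h1 h2]]; [unfold r2 in hq; lra |].
    exists (s - 1). split; [split |]; [lra | | exact h1].
    unfold wfun. replace (1 + (s - 1)) with s by ring.
    replace (2 * phi * s ^ 2 - 2 - (s - 1)) with (2 * phi * s ^ 2 - 1 - s).
    - rewrite (Cmod_minus_sym s 1). exact h2.
    - replace (RtoC 2) with (1 + 1) by (rewrite <- RtoC_plus; f_equal; ring). ring. }
  assert (cw : forall z, clim (near z) (wfun phi) (wfun phi z)).
  { intro z. unfold wfun. apply clim_minus; [| apply clim_id]. apply clim_minus; [| apply clim_const].
    apply clim_mult; [apply clim_const |]. simpl.
    repeat apply clim_mult; try apply clim_const; apply clim_plus; apply clim_const || apply clim_id. }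
  destruct (compact_min K Cmod r2) as [z [[hz1 hz2] hmin]].
  - intros z hz. destruct (Rle_lt_dec (Cmod z) r2) as [h1 | h1].
    + assert (h2 : (Cmod z < Cmod (wfun phi z))%R) by (apply Rnot_le_lt; intro; apply hz; split; assumption).
      set (e := ((Cmod (wfun phi z) - Cmod z) / 2)%R). assert (he : (0 < e)%R) by (unfold e; lra).
      generalize (filter_and _ _ (Cmod_lsc _ z e (cw z) he) (clim_id z e he)). apply filter_imp.
      intros w [a b] [_ c]. pose proof (Cmod_minus_triangle w z). unfold e in *. lra.
    + exists (Cmod z - r2)%R. split; [lra |]. intros w hw [a _].
      pose proof (Cmod_minus_triangle z w). rewrite Cmod_minus_sym in H. lra.
  - intros z e _ he. generalize (Cmod_lsc (fun z => z) z e (clim_id z) he). apply filter_imp. auto.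
  - apply Cmod_ge_0.
  - intros z hz. apply hz.
  - destruct (hK r2) as [z [hz _]]; [unfold r2; lra |]. now exists z.
  - assert (hzr : (Cmod z <= r)%R).
    { apply Rnot_lt_le. intro hlt. set (q := ((r + Cmod z) / 2)%R).
      destruct (hK q) as [v [hv1 hv2]]; [unfold q; lra |].
      pose proof (hmin v hv1). unfold q in hv2. lra. }
    assert (small : forall z', (Cmod z' < Cmod z)%R -> (Cmod (wfun phi z') <= Cmod z')%R -> False).
    { intros z' h1 h2. assert (hk : K z') by (split; lra). pose proof (hmin z' hk). lra. }
    assert (n1 : 1 + z <> 0) by (apply Re_pos_shift; lra).
    assert (ew : wfun phi z = - z * Cconj (denF z) / denF z).
    { destruct (classic (z = 0)) as [-> | nz].
      - assert (e0 : Cmod (wfun phi 0) = 0%R) by (rewrite Cmod_0 in hz2; pose proof (Cmod_ge_0 (wfun phi 0)); lra).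
        apply Cmod_eq_0 in e0. rewrite e0. unfold Cdiv. ring.
      - assert (hmz : (0 < Cmod z)%R) by now apply Cmod_gt_0.
        assert (em : Cmod (wfun phi z) = Cmod z).
        (* A strict inequality would survive a short radial move to (1 - t) z, against
           minimality. *)
        { destruct hz2 as [hlt |]; [| assumption]. exfalso.
          set (e := ((Cmod z - Cmod (wfun phi z)) / 2)%R). assert (he : (0 < e)%R) by (unfold e; lra).
          destruct (cw z e he) as [del [hdel hh]].
          set (t := Rmin (/ 2) (Rmin (e / (2 * Cmod z)) (del / (2 * Cmod z)))).
          assert (ht : (0 < t)%R) by (repeat apply Rmin_pos; try lra; apply Rdiv_lt_0_compat; lra).
          assert (t1 : (t <= / 2)%R) by apply Rmin_l.
          assert (t2 : (t * Cmod z <= e / 2)%R).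
          { apply Rle_trans with (e / (2 * Cmod z) * Cmod z)%R.
            - apply Rmult_le_compat_r; [lra |]. eapply Rle_trans; [apply Rmin_r | apply Rmin_l].
            - right. field. lra. }
          assert (t3 : (t * Cmod z <= del / 2)%R).
          { apply Rle_trans with (del / (2 * Cmod z) * Cmod z)%R.
            - apply Rmult_le_compat_r; [lra |]. eapply Rle_trans; [apply Rmin_r | apply Rmin_r].
            - right. field. lra. }
          assert (m1 : Cmod (RtoC (1 - t) * z) = ((1 - t) * Cmod z)%R) by (rewrite Cmod_mult, Cmod_RtoC_nonneg; lra).
          apply (small (RtoC (1 - t) * z)); rewrite m1; [nra |].
          specialize (hh (RtoC (1 - t) * z)).
          replace (RtoC (1 - t) * z - z) with (- (RtoC t * z)) in hh by (rewrite RtoC_minus; ring).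
          rewrite Cmod_opp, Cmod_mult, Cmod_RtoC_nonneg in hh by lra. specialize (hh ltac:(lra)).
          pose proof (Cmod_minus_triangle (wfun phi (RtoC (1 - t) * z)) (wfun phi z)). unfold e in *. lra. }
        (* Eliminates phi in favour of w, which is how [envelope_point] reads the Lagrange
           condition. *)
        assert (hW : 4 * phi * (1 + z) - 1 = (3 + z + 2 * wfun phi z) / (1 + z)).
        { unfold wfun. replace (RtoC 4) with (2 + 2) by (rewrite <- RtoC_plus; f_equal; ring).
          replace (RtoC 3) with (1 + 2) by (rewrite <- RtoC_plus; f_equal; ring).
          replace (RtoC 2) with (1 + 1) by (rewrite <- RtoC_plus; f_equal; ring). field. exact n1. }
        destruct (first_order_condition (Cconj (wfun phi z) * (4 * phi * (1 + z) - 1) * z - RtoC (Cmod z * Cmod z))) as [c1 c2].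
        { intros dl d1 d2. destruct (shrink phi z dl nz em d1 d2) as [z' [s1 s2]]. exact (small z' s1 s2). }
        rewrite Im_minus, hW in c1. rewrite Re_minus, hW in c2. simpl (Im (RtoC _)) in c1. simpl (Re (RtoC _)) in c2.
        apply envelope_point; [lra | exact em | lra | lra]. }
    destruct (F_param phi z) as [f1 f2]; [lra | |].
    + transitivity (2 + z + wfun phi z); [unfold wfun; ring |]. rewrite ew. unfold Cdiv. ring.
    + split; [exact f2 |]. now exists z.
Qed.

(** * Extremal functions *)

Section Extremal.

Variables x y : C.
Hypothesis hx : (Cmod x <= 1)%R.
Hypothesis hy : (Cmod y <= 1)%R.

(** Maps the unit disk onto a half-plane if |y| = 1 and onto a disk if |y| < 1; the latter case
    serves the values F z with |z| < r. *)
Definition gext (u : C) : C := u / (1 - y * u).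
Definition fext (u : C) : C := u * (1 - (x + y) / 2 * u) / ((1 - y * u) * (1 - y * u)).

Lemma one_minus_mult_neq_0 (u : C) : (Cmod u < 1)%R -> 1 - y * u <> 0.
Proof.
  intro hu. apply Re_pos_neq_0, Re_1_minus_pos. rewrite Cmod_mult.
  pose proof (Cmod_ge_0 u). pose proof (Cmod_ge_0 y). nra.
Qed.

Lemma cder_one_minus (c u : C) : cder (fun u => 1 - c * u) u (- c).
Proof.
  eapply cder_unique_at; [apply cder_minus; [apply cder_const | apply cder_scal, cder_id] |]. ring.
Qed.

Lemma gext_cder (u : C) : (Cmod u < 1)%R -> cder gext u (/ ((1 - y * u) * (1 - y * u))).
Proof.
  intro hu. pose proof (one_minus_mult_neq_0 u hu). eapply cder_unique_at.
  - apply cder_div; [assumption | apply cder_id | apply cder_one_minus].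
  - cbv beta. field. assumption.
Qed.

Lemma fext_cder (u : C) : (Cmod u < 1)%R ->
  cder fext u ((1 - x * u) / ((1 - y * u) * (1 - y * u) * (1 - y * u))).
Proof.
  intro hu. pose proof (one_minus_mult_neq_0 u hu). eapply cder_unique_at.
  - apply cder_div; [now apply Cmult_neq_0 | apply cder_mult; [apply cder_id | apply cder_one_minus] |
      apply cder_mult; apply cder_one_minus].
  - cbv beta. field. assumption.
Qed.

Lemma gext_image (w : C) : image gext unit_disk w <-> (Cmod w < Cmod (1 + y * w))%R.
Proof.
  split.
  - intros [u [hu ->]]. unfold unit_disk in hu. pose proof (one_minus_mult_neq_0 u hu) as h.
    unfold gext. replace (1 + y * (u / (1 - y * u))) with (/ (1 - y * u)) by (field; exact h).
    unfold Cdiv. rewrite Cmod_mult. rewrite <- (Rmult_1_l (Cmod (/ _))) at 2.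
    apply Rmult_lt_compat_r; [| exact hu]. now apply Cmod_gt_0, Cinv_neq_0.
  - intro h. assert (hm : (0 < Cmod (1 + y * w))%R) by (pose proof (Cmod_ge_0 w); lra).
    assert (n : 1 + y * w <> 0) by (intro e; rewrite e, Cmod_0 in hm; lra).
    exists (w / (1 + y * w)). split.
    + unfold unit_disk. rewrite Cmod_div by exact n. apply Rmult_lt_reg_r with (Cmod (1 + y * w)); [exact hm |].
      unfold Rdiv. rewrite Rmult_assoc, Rinv_l by lra. lra.
    + unfold gext. field. split; [exact n |].
      replace (1 + y * w - y * w) with (RtoC 1) by ring. apply C1_nz.
Qed.

(** The image is where |w|^2 - |1 + yw|^2 is negative, a function with quadratic part (1 -
    |y|^2)|w|^2, hence convex. *)
Lemma gext_image_convex : convex_set (image gext unit_disk).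
Proof.
  intros w1 w2 t h1 h2 ht. apply gext_image in h1. apply gext_image in h2. apply gext_image.
  assert (sq : forall a b, (Cmod a < Cmod b)%R -> (Cmod a * Cmod a < Cmod b * Cmod b)%R).
  { intros a b h. pose proof (Cmod_ge_0 a). nra. }
  apply sq in h1. apply sq in h2.
  assert (hy2 : (Cmod y * Cmod y <= 1)%R) by (pose proof (Cmod_ge_0 y); nra).
  set (w := RtoC (1 - t) * w1 + RtoC t * w2).
  assert (goal : (Cmod w * Cmod w < Cmod (1 + y * w) * Cmod (1 + y * w))%R).
  { rewrite !Cmod_sqr in *. unfold w. clear - h1 h2 ht hy2. destruct w1 as [a b], w2 as [c d], y as [p q].
    unfold Re, Im in *. simpl in *.
    (* The convexity defect of that quadratic along the segment from w1 to w2. *)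
    assert (hs : (0 <= t * (1 - t) * (1 - (p * p + q * q)) * ((a - c) * (a - c) + (b - d) * (b - d)))%R).
    { repeat apply Rmult_le_pos; try lra. pose proof (Rle_0_sqr (a - c)). pose proof (Rle_0_sqr (b - d)). unfold Rsqr in *. lra. }
    destruct ht as [t0 t1].
    set (Q1 := (a * a + b * b - ((1 + (p * a - q * b)) * (1 + (p * a - q * b)) + (0 + (p * b + q * a)) * (0 + (p * b + q * a))))%R) in *.
    set (Q2 := (c * c + d * d - ((1 + (p * c - q * d)) * (1 + (p * c - q * d)) + (0 + (p * d + q * c)) * (0 + (p * d + q * c))))%R) in *.
    assert (q1 : (Q1 < 0)%R) by (unfold Q1; lra). assert (q2 : (Q2 < 0)%R) by (unfold Q2; lra).
    assert (hq : ((1 - t) * Q1 + t * Q2 < 0)%R).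
    { destruct (Req_dec t 0) as [-> | nt]; [lra |]. nra. }
    unfold Q1, Q2 in hq. clear - hs hq. lra. }
  pose proof (Cmod_ge_0 w). pose proof (Cmod_ge_0 (1 + y * w)). nra.
Qed.

Lemma zero_in_disk : (Cmod 0 < 1)%R.
Proof. rewrite Cmod_0. lra. Qed.

Lemma gext_convex : convex_function gext.
Proof.
  split; [| split; [split | split]].
  - apply analytic_holo. intros u hu. eexists. now apply gext_cder.
  - unfold gext, Cdiv. ring.
  - rewrite (cder_C_derive _ _ _ (gext_cder 0 zero_in_disk)), Cmult_0_r. field.
  - intros u v hu hv e. pose proof (one_minus_mult_neq_0 u hu) as n1. pose proof (one_minus_mult_neq_0 v hv) as n2.
    unfold gext in e.
    assert (e1 : u * (1 - y * v) = v * (1 - y * u)).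
    { replace (u * (1 - y * v)) with (u / (1 - y * u) * ((1 - y * u) * (1 - y * v))) by (field; exact n1).
      rewrite e. field. exact n2. }
    replace u with (u * (1 - y * v) + y * u * v) by ring. rewrite e1. ring.
  - exact gext_image_convex.
Qed.

(* With [v = (1 - x u) / (1 - y u)], [|1 - v| <= |x - y v|] for [|u| < 1]; expanding the
   squares shows that [v] lies in the half-plane [Re ((1 - conj x * y) v) > 0]. *)
Lemma quotient_half_plane (u : C) : (Cmod u < 1)%R -> 1 - Cconj x * y <> 0 ->
  (0 < Re ((1 - Cconj x * y) * ((1 - x * u) / (1 - y * u))))%R.
Proof.
  intros hu hk. pose proof (one_minus_mult_neq_0 u hu) as n1.
  assert (x2 : (Cmod x * Cmod x <= 1)%R) by (pose proof (Cmod_ge_0 x); nra).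
  assert (y2 : (Cmod y * Cmod y <= 1)%R) by (pose proof (Cmod_ge_0 y); nra).
  set (v := (1 - x * u) / (1 - y * u)).
  destruct (classic (x = y)) as [e | ne].
  - assert (ev : v = 1) by (unfold v; rewrite e; field; exact n1).
    assert (ek : 1 - Cconj x * y = RtoC (1 - Cmod x * Cmod x)).
    { rewrite RtoC_minus, <- Cconj_mult_self, e. ring. }
    rewrite ev, Cmult_1_r. rewrite ek in hk |- *. simpl.
    destruct (Req_dec (1 - Cmod x * Cmod x) 0) as [e0 | n0]; [exfalso; apply hk; now rewrite e0 | lra].
  - assert (e1 : x - y * v = (x - y) / (1 - y * u)) by (unfold v; field; exact n1).
    assert (e2 : 1 - v = u * (x - y * v)) by (rewrite e1; unfold v; field; exact n1).
    assert (hpos : (0 < Cmod (x - y * v))%R).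
    { apply Cmod_gt_0. rewrite e1. apply Cmult_neq_0; [now apply Cminus_neq_0 | now apply Cinv_neq_0]. }
    assert (hlt : (Cmod (1 - v) < Cmod (x - y * v))%R).
    { rewrite e2, Cmod_mult. nra. }
    assert (hsq : (Cmod (1 - v) * Cmod (1 - v) < Cmod (x - y * v) * Cmod (x - y * v))%R).
    { pose proof (Cmod_ge_0 (1 - v)). nra. }
    rewrite !Cmod_sqr in *. clear - hsq x2 y2. clearbody v. destruct v as [a b], x as [p q], y as [c d].
    unfold Re, Im in *. simpl in *.
    assert (0 <= (1 - (c * c + d * d)) * (a * a + b * b))%R.
    { apply Rmult_le_pos; [lra |]. pose proof (Rle_0_sqr a). pose proof (Rle_0_sqr b). unfold Rsqr in *. lra. }
    lra.
Qed.

(** The quotient of derivatives is (1 - xu)/(1 - yu), and lambda is the argument of k = 1 - conj(x)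
    y, as in [quotient_half_plane]; Re k > 0 gives |lambda| < PI/2. If k = 0, then x = y and the
    quotient is 1, so lambda = 0 serves. *)
Lemma fext_close_to_convex : close_to_convex fext.
Proof.
  split; [| split; [split |]].
  - apply analytic_holo. intros u hu. eexists. now apply fext_cder.
  - unfold fext, Cdiv. ring.
  - rewrite (cder_C_derive _ _ _ (fext_cder 0 zero_in_disk)), !Cmult_0_r. field.
  - exists gext. set (k := 1 - Cconj x * y).
    assert (q : forall u, (Cmod u < 1)%R -> C_derive fext u / C_derive gext u = (1 - x * u) / (1 - y * u)).
    { intros u hu. pose proof (one_minus_mult_neq_0 u hu).
      rewrite (cder_C_derive _ _ _ (fext_cder u hu)), (cder_C_derive _ _ _ (gext_cder u hu)). field. assumption. }
    assert (cm : (Cmod (Cconj x * y) <= 1)%R).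
    { rewrite Cmod_mult, Cmod_conj. pose proof (Cmod_ge_0 x). pose proof (Cmod_ge_0 y). nra. }
    destruct (classic (k = 0)) as [ek | nk].
    + exists 0%R. split; [apply gext_convex |]. split; [rewrite Rabs_R0; pose proof PI_RGT_0; lra |].
      intros u hu. rewrite q, expi_0 by exact hu.
      assert (e1 : Cconj x * y = 1) by (replace (Cconj x * y) with (1 - k) by (unfold k; ring); rewrite ek; ring).
      assert (exy : x = y).
      { assert (m1 : (Cmod x * Cmod y = 1)%R) by (rewrite <- (Cmod_conj x), <- Cmod_mult, e1; apply Cmod_1).
        assert (mx : Cmod x = 1%R) by (pose proof (Cmod_ge_0 x); pose proof (Cmod_ge_0 y); nra).
        transitivity (x * (Cconj x * y)); [rewrite e1; ring |].
        rewrite Cmult_assoc, Cconj_mult_self, mx. rewrite Rmult_1_r. ring. }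
      rewrite exy. unfold Cdiv. rewrite Cinv_r by now apply one_minus_mult_neq_0. simpl. lra.
    + assert (hre : (0 < Re k)%R).
      { unfold k. rewrite Re_minus. simpl (Re 1).
        pose proof (Re_le_mod (Cconj x * y)) as h1. apply Rabs_le_between in h1.
        apply Rnot_le_lt. intro hle. apply nk. unfold k.
        assert (r1 : Re (Cconj x * y) = 1%R) by lra.
        pose proof (Cmod_sqr (Cconj x * y)) as h2. pose proof (Cmod_ge_0 (Cconj x * y)).
        assert (i0 : Im (Cconj x * y) = 0%R) by nra.
        rewrite (real_of_Im_0 _ i0), r1. ring. }
      exists (carg k). split; [apply gext_convex |]. split.
      * unfold carg. pose proof (atan_bound (Im k / Re k)). apply Rabs_def1; lra.
      * intros u hu. rewrite q by exact hu.
        pose proof (quotient_half_plane u hu nk) as h. fold k in h.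
        rewrite (polar_right k hre), <- Cmult_assoc, Re_RtoC_mult in h.
        pose proof (Cmod_ge_0 k). apply Rnot_le_lt. intro hle. nra.
Qed.

End Extremal.

Theorem theorem1p3 (r : R) (hr : (0 < r < 1)%R) :
  forall w : C, U r w <-> image F (closed_disk (RtoC 0) r) w.
Proof.
  intro w. assert (r0 : RtoC r <> 0) by (apply RtoC_neq_0; lra). split.
  - intros [f [hf ->]].
    destruct (region_in_image (f (RtoC r) / RtoC r) r hr) as [h0 [z [hz ez]]].
    + intros q hq. apply (close_to_convex_region f r q hf); lra.
    + exists z. split; [unfold closed_disk; now replace (z - RtoC 0) with z by ring |].
      rewrite <- ez. assert (f (RtoC r) <> 0) by (intro e; apply h0; rewrite e; unfold Cdiv; ring).
      field. auto.
  - intros [z [hz ->]]. unfold closed_disk in hz. replace (z - RtoC 0) with z in hz by ring.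
    assert (n1 : 1 + z <> 0) by (apply Re_pos_shift; lra).
    assert (n4 : 3 + Cconj z <> 0) by (apply Re_pos_shift; rewrite Cmod_conj; lra).
    assert (nD : denF z <> 0) by now apply Cmult_neq_0.
    set (v := - z * Cconj (denF z) / denF z).
    assert (hv : Cmod v = Cmod z).
    { unfold v. rewrite Cmod_div, Cmod_mult, Cmod_opp, Cmod_conj by exact nD.
      assert (0 < Cmod (denF z))%R by now apply Cmod_gt_0. field. lra. }
    assert (hdiv : forall a, (Cmod a <= r)%R -> (Cmod (- a / RtoC r) <= 1)%R).
    { intros a ha. rewrite Cmod_div, Cmod_opp, Cmod_RtoC_nonneg by (auto; lra).
      apply Rmult_le_reg_r with r; [lra |]. unfold Rdiv. rewrite Rmult_assoc, Rinv_l; lra. }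
    (* y = -z/r makes 1 - yr = 1 + z, and x = -v/r makes 2 phi (1 + z)^2 = 2 + z + v, the relation
       of [F_param]. Both lie in the closed unit disk since |v| = |z| <= r. *)
    set (f := fext (- v / RtoC r) (- z / RtoC r)).
    exists f. split.
    + apply fext_close_to_convex; apply hdiv; lra.
    + assert (ef : f (RtoC r) = RtoC r * (1 + (v + z) / 2) / ((1 + z) * (1 + z))).
      { unfold f, fext. replace (1 - - z / RtoC r * RtoC r) with (1 + z) by (field; exact r0). field. auto. }
      destruct (F_param (f (RtoC r) / RtoC r) z) as [f1 f2]; [lra | |].
      * rewrite ef. unfold v. field. auto.
      * rewrite <- f1. assert (f (RtoC r) <> 0) by (intro e; apply f2; rewrite e; unfold Cdiv; ring).
        field. auto.
Qed.
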